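(* Let $r$ be an integer prime to $l$ and $a=[r]$. (1) When $l=11$, each of $p_{8,1},p_{8,3},p_{8,6},p_{16,4},p_{16,8},p_{16,10},p_{32,0},p_{32,12},p_{64,16}$ takes $1/a$ to an element of $S$. (2) When $l=13$, each of $p_{8,2},p_{8,3},p_{8,5},p_{16,4},p_{16,8},p_{16,14},p_{32,0},p_{32,12},p_{64,16}$ takes $1/a$ to an element of $S$. (3) When $l=15$, each of $p_{8,1},p_{8,2},p_{8,3},p_{16,4},p_{16,6},p_{16,8},p_{32,0},p_{32,12},p_{64,16}$ takes $1/a$ to an element of $S$.
   Context: Here $l=2m+1\in\{11,13,15\}$. For an integer $i$, $[i]=\sum x^{n^2}\in\mathbb{Z}/2[[x]]$, summed over $n\in\mathbb{Z}$ with $n\equiv i\pmod l$. $S$ is the subring of $\mathbb{Z}/2[[x]]$ generated over $\mathbb{Z}/2$ by $[1],\dots,[m]$. $1/a$ is taken in the field $L$ of Laurent series over $\mathbb{Z}/2$. For $q$ a power of $2$ and $0\le j<q$, $p_{q,j}:L\to L$ is $\sum_n c_nx^n\mapsto\sum_{n\equiv j\pmod q}c_nx^n$ (the projection onto $x^jL^{q}$ in $L=\bigoplus_{0\le j<q}x^jL^{q}$, $L^{q}$ the subfield of $q$th powers). *)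

(* Defs.v *)
From HB Require Import structures.
From mathcomp Require Import all_boot all_order all_algebra.
From mathcomp Require Import boolp classical_sets functions cardinality fsbigop.
From mathcomp Require Import zify.

Set Implicit Arguments.
Unset Strict Implicit.
Unset Printing Implicit Defensive.

Import Order.TTheory GRing.Theory Num.Theory.

Local Open Scope classical_set_scope.
Local Open Scope ring_scope.

Section Laurent.
Variable K : fieldType.

Definition vanishes_below (f : int -> K) (N : int) := forall n, n < N -> f n = 0.

Record laurent := Laurent {
  lcoef :> int -> K;
  _ : `[< exists N, vanishes_below lcoef N >] }.

HB.instance Definition _ := [isSub for lcoef].
HB.instance Definition _ := [Choice of laurent by <:].

Implicit Types f g h : laurent.

Lemma laurentP f g : (forall n, f n = g n) -> f = g.
Proof. by move=> fg; apply/val_inj/funext. Qed.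

Lemma laurent_bounded f : exists N, vanishes_below f N.
Proof. by case: f => f /= /asboolP. Qed.

Lemma vanishes_below_le (u : int -> K) N M :
  (M <= N)%R -> vanishes_below u N -> vanishes_below u M.
Proof. by move=> MN uN n nM; apply: uN; apply: lt_le_trans MN. Qed.

Lemma laurent_bounded2 f g : exists N, vanishes_below f N /\ vanishes_below g N.
Proof.
have [N fN] := laurent_bounded f; have [M gM] := laurent_bounded g.
exists (Num.min N M); split.
  by apply: vanishes_below_le fN; rewrite ge_min lexx.
by apply: vanishes_below_le gM; rewrite ge_min lexx orbT.
Qed.

Definition laurent_of (u : int -> K) (uP : exists N, vanishes_below u N) :
  laurent := Laurent (asboolT uP).

Fact zero_subproof : exists N, vanishes_below (fun=> 0) N.
Proof. by exists 0. Qed.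
Definition laurent_zero := laurent_of zero_subproof.

Fact opp_subproof f : exists N, vanishes_below (fun n => - f n) N.
Proof.
by have [N fN] := laurent_bounded f; exists N => n nN; rewrite fN ?oppr0.
Qed.
Definition laurent_opp f := laurent_of (opp_subproof f).

Fact add_subproof f g : exists N, vanishes_below (fun n => f n + g n) N.
Proof.
have [N [fN gN]] := laurent_bounded2 f g.
by exists N => n nN; rewrite fN ?gN ?addr0.
Qed.
Definition laurent_add f g := laurent_of (add_subproof f g).

Fact laurent_addA : associative laurent_add.
Proof. by move=> f g h; apply/laurentP => n /=; rewrite addrA. Qed.
Fact laurent_addC : commutative laurent_add.
Proof. by move=> f g; apply/laurentP => n /=; rewrite addrC. Qed.
Fact laurent_add0 : left_id laurent_zero laurent_add.
Proof. by move=> f; apply/laurentP => n /=; rewrite add0r. Qed.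
Fact laurent_addN : left_inverse laurent_zero laurent_opp laurent_add.
Proof. by move=> f; apply/laurentP => n /=; rewrite addNr. Qed.

HB.instance Definition _ := GRing.isZmodule.Build laurent
  laurent_addA laurent_addC laurent_add0 laurent_addN.

Lemma lcoef0 n : (0 : laurent) n = 0. Proof. by []. Qed.
Lemma lcoefD f g n : (f + g) n = f n + g n. Proof. by []. Qed.
Lemma lcoefN f n : (- f) n = - f n. Proof. by []. Qed.

Lemma lcoef_sum (I : Type) (r : seq I) (P : pred I) (F : I -> laurent) n :
  (\sum_(i <- r | P i) F i) n = \sum_(i <- r | P i) F i n.
Proof. by elim/big_rec2: _ => [|i y x _ <-]; rewrite ?lcoef0 ?lcoefD. Qed.

(* Each of these sums has only finitely many nonzero terms. *)
Definition conv (u v : int -> K) (n : int) : K :=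
  \sum_(i \in [set: int]) u i * v (n - i).

Lemma convE (u v : int -> K) N M : vanishes_below u N -> vanishes_below v M ->
  forall d : nat,
  conv u v (N + M + d%:Z) = \sum_(i < d.+1) u (N + i%:Z) * v (M + (d - i)%N%:Z).
Proof.
move=> uN vM d; pose s := [seq N + k%:Z | k <- iota 0 d.+1].
have us : uniq s by rewrite map_inj_uniq ?iota_uniq // => i j; lia.
rewrite /conv -(fsbig_widen [set` s]) //; last first.
  move=> i [_ /= /negP nsi].
  have [iN|Ni] := ltP i N; first by rewrite uN ?mul0r.
  rewrite [v _]vM ?mulr0 // ltNge; apply: contra nsi => Mi.
  apply/mapP; exists `|(i - N)%R|%N; last lia.
  by rewrite mem_iota; lia.
rewrite -fsbig_seq // big_map -[iota _ _]/(index_iota 0 d.+1) big_mkord.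
apply: eq_bigr => i _; congr (_ * v _).
by have := ltn_ord i; lia.
Qed.

Lemma conv_below (u v : int -> K) N M : vanishes_below u N ->
  vanishes_below v M -> vanishes_below (conv u v) (N + M).
Proof.
move=> uN vM n nNM; apply: fsbig1 => i _.
have [iN|Ni] := ltP i N; first by rewrite uN ?mul0r.
by rewrite [v _]vM ?mulr0 //; lia.
Qed.

Fact mul_subproof f g : exists N, vanishes_below (conv f g) N.
Proof.
have [N fN] := laurent_bounded f; have [M gM] := laurent_bounded g.
by exists (N + M); apply: conv_below.
Qed.
Definition laurent_mul f g := laurent_of (mul_subproof f g).

Fact one_subproof : exists N, vanishes_below (fun n => (n == 0)%:R) N.
Proof. by exists 0 => n n0; rewrite lt_eqF. Qed.
Definition laurent_one := laurent_of one_subproof.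

Let trunc (u : int -> K) (N : int) (D : nat) : {poly K} :=
  \poly_(i < D) u (N + i%:Z).

Let convE_poly u v N M D d : vanishes_below u N -> vanishes_below v M ->
  (d < D)%N -> conv u v (N + M + d%:Z) = (trunc u N D * trunc v M D)`_d.
Proof.
move=> uN vM dD; rewrite (convE uN vM) coefM; apply: eq_bigr => i _.
by rewrite !coef_poly !ifT //; have := ltn_ord i; lia.
Qed.

Fact laurent_mulC : commutative laurent_mul.
Proof.
move=> f g; apply/laurentP => n /=.
have [N fN] := laurent_bounded f; have [M gM] := laurent_bounded g.
have [nNM|] := ltP n (N + M).
  by rewrite (conv_below fN gM) // (conv_below gM fN) // addrC.
move=> NMn; have -> : n = N + M + `|(n - (N + M))%R|%N%:Z by lia.
set d := absz _; rewrite (convE_poly fN gM (ltnSn d)) mulrC.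
by rewrite -(convE_poly gM fN (ltnSn d)) [M + N]addrC.
Qed.

Let conv_trunc u v w N M D d : vanishes_below u N -> vanishes_below v M ->
  (d < D)%N -> (w * trunc (conv u v) (N + M) D)`_d
             = (w * (trunc u N D * trunc v M D))`_d.
Proof.
move=> uN vM dD; rewrite !coefM; apply: eq_bigr => i _; congr (_ * _).
rewrite coef_poly ifT; last by have := ltn_ord i; lia.
by apply: convE_poly => //; have := ltn_ord i; lia.
Qed.

Fact laurent_mulA : associative laurent_mul.
Proof.
move=> f g h; rewrite [RHS]laurent_mulC; apply/laurentP => n /=.
have [N fN] := laurent_bounded f; have [M gM] := laurent_bounded g.
have [P hP] := laurent_bounded h.
have gh := conv_below gM hP; have fg := conv_below fN gM.
have [nl|] := ltP n (N + (M + P)).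
  by rewrite (conv_below fN gh) // (conv_below hP fg) //; lia.
move=> NMn; have -> : n = N + (M + P) + `|(n - (N + (M + P)))%R|%N%:Z by lia.
set d := absz _; rewrite (convE_poly fN gh (ltnSn d)).
have -> : N + (M + P) = P + (N + M) by lia.
rewrite (convE_poly hP fg (ltnSn d)) !conv_trunc //.
by rewrite mulrA mulrC.
Qed.

Fact laurent_mul1 : left_id laurent_one laurent_mul.
Proof.
move=> f; apply/laurentP => n /=; rewrite /conv.
rewrite -(fsbig_widen [set 0]) //; last first.
  by move=> i [_ /= /eqP/negPf ->]; rewrite mul0r.
by rewrite fsbig_set1 eqxx mul1r subr0.
Qed.

Fact laurent_mulDl : left_distributive laurent_mul laurent_add.
Proof.
move=> f g h; apply/laurentP => n /=.
have [N [fN gN]] := laurent_bounded2 f g; have [M hM] := laurent_bounded h.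
have fgN : vanishes_below (f + g) N.
  by move=> i iN; rewrite lcoefD fN ?gN ?addr0.
have [nNM|] := ltP n (N + M).
  by rewrite !(@conv_below _ _ N M) ?addr0.
move=> NMn; have -> : n = N + M + `|(n - (N + M))%R|%N%:Z by lia.
rewrite (convE fgN hM) (convE fN hM) (convE gN hM) -big_split /=.
by apply: eq_bigr => i _; rewrite -mulrDl.
Qed.

Fact laurent_one_neq0 : laurent_one != 0.
Proof. by apply/eqP => /(congr1 (fun f => f 0)) /eqP; rewrite /= oner_eq0. Qed.

HB.instance Definition _ := GRing.Zmodule_isComNzRing.Build laurent
  laurent_mulA laurent_mulC laurent_mul1 laurent_mulDl laurent_one_neq0.

Lemma lcoef1 n : (1 : laurent) n = (n == 0)%:R. Proof. by []. Qed.
Lemma lcoefM f g n : (f * g) n = \sum_(i \in [set: int]) f i * g (n - i).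
Proof. by []. Qed.

Lemma laurent_order f : f != 0 -> exists N, vanishes_below f N /\ f N != 0.
Proof.
move=> f0; have [M fM] := laurent_bounded f.
have /existsNP[n /eqP fn] : ~ forall n, f n = 0.
  by move=> fz; case/eqP: f0; apply/laurentP.
have Mn : M <= n by rewrite leNgt; apply: contra fn => /fM ->.
have ex : exists k : nat, f (M + k%:Z) != 0.
  by exists `|(n - M)%R|%N; have -> : M + `|(n - M)%R|%N%:Z = n by lia.
case: (ex_minnP ex) => k fk kmin; exists (M + k%:Z); split => // i iMk.
have [iM|Mi] := ltP i M; first exact: fM.
apply/eqP; apply: contraTT (iMk) => fi.
have -> : i = M + `|(i - M)%R|%N%:Z by lia.
rewrite -leNgt lerD2l lez_nat; apply: kmin.
by have -> : M + `|(i - M)%R|%N%:Z = i by lia.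
Qed.

(* [inv_coefs u d] lists the first [d] coefficients of the inverse of the
   power series with coefficients [u], when [u 0 != 0]. *)
Fixpoint inv_coefs (u : nat -> K) (d : nat) : seq K :=
  if d is e.+1 then
    let s := inv_coefs u e in
    rcons s (((e == 0%N)%:R - \sum_(i < e) u (e - i)%N * s`_i) / u 0%N)
  else [::].

Lemma size_inv_coefs u d : size (inv_coefs u d) = d.
Proof. by elim: d => //= d IH; rewrite size_rcons IH. Qed.

Lemma nth_inv_coefs u d i :
  (i < d)%N -> (inv_coefs u d)`_i = (inv_coefs u i.+1)`_i.
Proof.
elim: d => // d IH; rewrite ltnS leq_eqVlt => /predU1P[-> //|id].
by rewrite -IH //= nth_rcons size_inv_coefs id.
Qed.

Lemma inv_coefsP (u : nat -> K) : u 0%N != 0 -> forall d,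
  \sum_(i < d.+1) u (d - i)%N * (inv_coefs u i.+1)`_i = (d == 0%N)%:R.
Proof.
move=> u0 d; rewrite big_ord_recr /= subnn nth_rcons size_inv_coefs ltnn eqxx.
rewrite mulrC divfK // addrC -[RHS]addr0 -addrA; congr (_ + _).
apply/eqP; rewrite addrC subr_eq0; apply/eqP/eq_bigr => i _.
by rewrite -[rcons _ _]/(inv_coefs u i.+1) [in RHS]nth_inv_coefs.
Qed.

Lemma laurent_inv_exists f : f != 0 -> exists g, g * f = 1.
Proof.
move=> /laurent_order[N [fN fN0]].
pose u (k : nat) := f (N + k%:Z).
pose v n := if (n < - N)%R then 0
            else (inv_coefs u `|(n + N)%R|.+1)`_`|(n + N)%R|.
have vN : vanishes_below v (- N) by move=> n nN; rewrite /v nN.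
exists (laurent_of (ex_intro _ _ vN)); apply/laurentP => n.
have [n0|n0] := ltP n 0.
  rewrite lcoef1 lt_eqF // -[LHS]/(conv v f n).
  by rewrite (conv_below vN fN) // addNr.
have -> : n = - N + N + `|n|%N%:Z by lia.
rewrite -[LHS]/(conv v f (- N + N + `|n|%N%:Z)) (convE vN fN) lcoef1.
rewrite addNr add0r [_ == 0](_ : _ = (`|n|%N == 0%N)) //.
have u0 : u 0%N != 0 by rewrite /u addr0.
rewrite -(inv_coefsP u0); apply: eq_bigr => i _; rewrite mulrC; congr (_ * _).
rewrite /v ifF; last by lia.
by have -> : `|(- N + i%:Z + N)%R|%N = i by lia.
Qed.

Definition laurent_inv f : laurent := xget 0 [set g | g * f = 1].

Fact laurent_mulVf f : f != 0 -> laurent_inv f * f = 1.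
Proof.
by move=> /laurent_inv_exists[g gf]; rewrite /laurent_inv; case: xgetP => [x _ //|/(_ g)].
Qed.

Fact laurent_inv0 : laurent_inv 0 = 0.
Proof.
rewrite /laurent_inv; case: xgetP => // g _ /= /eqP.
by rewrite mulr0 eq_sym oner_eq0.
Qed.

HB.instance Definition _ :=
  GRing.ComNzRing_isField.Build laurent laurent_mulVf laurent_inv0.

Fact proj_subproof (q j : nat) f :
  exists N, vanishes_below
    (fun n => if (n == j%:Z %[mod q%:Z])%Z then f n else 0) N.
Proof.
by have [N fN] := laurent_bounded f; exists N => n /fN ->; rewrite if_same.
Qed.
Definition laurent_proj (q j : nat) f : laurent :=
  laurent_of (proj_subproof q j f).

End Laurent.

Definition subring_gen (R : nzRingType) (G : set R) : set R :=
  [set f | forall P : {pred R}, subring_closed P ->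
             (forall g, G g -> g \in P) -> f \in P].

Notation L2 := (laurent 'F_2).

(* The coefficient of x^k is the number, reduced modulo 2, of integers n with
   n^2 = k and n = i modulo l; the set of these n is always finite. *)
Definition theta_coef (l : nat) (i k : int) : 'F_2 :=
  \sum_(n \in [set n : int | n ^+ 2 = k /\ (n = i %[mod l%:Z])%Z]) (1 : 'F_2).

Fact theta_subproof l i : exists N, vanishes_below (theta_coef l i) N.
Proof.
exists 0 => k k0; apply: fsbig1 => n [nk _].
by move: k0; rewrite -nk ltNge sqr_ge0.
Qed.
Definition theta (l : nat) (i : int) : L2 := laurent_of (theta_subproof l i).

(* Z/2[[x]] is identified with its image in the Laurent series field; the subring
   generated by [1], ..., [m], l = 2m + 1, is the same in either ring. *)
Definition theta_ring (l : nat) : set L2 :=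
  subring_gen [set f | exists2 i : nat, (1 <= i <= l./2)%N & f = theta l i%:Z].

(* Main.v *)
From HB Require Import structures.
From Stdlib Require Import BinNat.
Require Import Defs.
From mathcomp Require Import all_boot all_order all_algebra.
From mathcomp Require Import boolp classical_sets functions cardinality fsbigop.
From mathcomp Require Import zify ring.

(* Write X_i = [i], choose u with 8 u = r modulo l, and put a = X_8u, b = X_4u,
   c = X_2u, d = X_6u. The series X_2s + X_s^4 only has exponents congruent to 1
   modulo 8, so that a = b^4 + o splits into two classes modulo 8; expanding
   1/a = a^7 / a^8 = a^3 / a^4 = a / a^2 and separating classes, each projection
   of 1/a becomes a power of an explicit polynomial in the X_iu divided by a power
   of a. The division is possible in S because of the relations between the X_i:
   those obtained by separating exponents in X_2s X_2t by parity, their square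
   roots, and a few cubic and quartic relations that follow from them. Quotients
   N / M = Q are verified through certificates writing M Q + N as a combination of
   such relations. Only a few are needed, as X_v^4 / X_2v multiplies the ideal of S
   generated by the X_i into itself. *)

Set Implicit Arguments.
Unset Strict Implicit.
Unset Printing Implicit Defensive.

Import Order.TTheory GRing.Theory Num.Theory.

Local Open Scope classical_set_scope.
Local Open Scope ring_scope.

(** For even residues the modulus is halved: if f = g^2 + h with h supported on odd exponents, then
    p_{2q,2j}(f) = p_{q,j}(g)^2. As N/a = aN/a^2, this replaces a numerator N by the square root of
    the even part of aN. The numerators met in this way are 1, b^2, b^3, bcd and a polynomial H, so
    that p_{64,16}(1/a) is the 16th power of p_{4,1}(H/a). The obstacle is then size: denominators
    reach a^8, and certificates grow quickly with the degree. So each result is written as a product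
    of multipliers such as b^4/a, which only have to preserve the ideal, and one quotient of lower
    degree that a certificate places in the ideal. Such a product is in the ideal, hence in S,
    without any of the multipliers having to be in S. All relations are proved for every u prime to
    l. One list of certificates therefore serves every r, and a relation can be reused after
    multiplying its indices by a unit modulo l. *)

Lemma laurent2_addrr (f : L2) : f + f = 0.
Proof. by apply: laurentP => n; rewrite lcoefD lcoef0 addrr_pchar2 // pchar_Fp. Qed.

Lemma pchar_laurent2 : 2 \in [pchar L2].
Proof. by apply/andP; split=> //; apply/eqP; exact: (laurent2_addrr 1). Qed.

Lemma laurent2_opp (f : L2) : - f = f.
Proof. exact: (oppr_pchar2 pchar_laurent2). Qed.

Lemma laurent2_sqrD (f g : L2) : (f + g) ^+ 2 = f ^+ 2 + g ^+ 2.
Proof. by rewrite sqrrD mulr2n laurent2_addrr addr0. Qed.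

(** * Coefficients of theta series, of their products and of squares *)

Definition int_box (k : int) : seq int :=
  [seq i%:Z - `|k| | i <- iota 0 (absz k).*2.+1].

Arguments int_box : simpl never.

Lemma int_box_uniq k : uniq (int_box k).
Proof. by rewrite map_inj_uniq ?iota_uniq // => i j; lia. Qed.

Lemma mem_int_box (k n : int) : n ^+ 2 <= k -> n \in int_box k.
Proof.
move=> nk; have nk' : `|n| <= `|k| by nia.
apply/mapP; exists (absz (n + `|k|)); last lia.
by rewrite mem_iota; lia.
Qed.

Lemma theta_coef_box l i (k p : int) : p <= k ->
  theta_coef l i p =
  \sum_(n <- int_box k | (n ^+ 2 == p) && (n == i %[mod l%:Z])%Z) 1.
Proof.
move=> pk; rewrite (bigfs _ (int_box_uniq k)); last first.
  by move=> n /andP[/eqP np _]; rewrite mem_int_box // np.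
apply: eq_fsbigl; apply/seteqP; split=> n /=.
  by case=> np ni; apply/andP; split; apply/eqP.
by move=> /andP[/eqP np /eqP ni].
Qed.

Lemma theta_below l i (k : int) : k < 0 -> theta l i k = 0.
Proof.
by move=> k0; apply: fsbig1 => n [nk _]; have := sqr_ge0 n; rewrite nk; lia.
Qed.

(** Indexing by pairs instead of by a convolution lets [theta_rel] change variables inside the index
    set. *)
Lemma thetaM_coef l i j (k : int) :
  (theta l i * theta l j) k =
  \sum_(p \in [set p : int * int | p.1 ^+ 2 + p.2 ^+ 2 = k /\
     (p.1 = i %[mod l%:Z])%Z /\ (p.2 = j %[mod l%:Z])%Z]) (1 : 'F_2).
Proof.
pose B := int_box k.
pose r := [seq q%:Z | q <- iota 0 (absz k).+1].
have ur : uniq r by rewrite map_inj_uniq ?iota_uniq // => x y; lia.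
have rE p : (p \in r) = (0 <= p <= `|k|).
  apply/mapP/idP => [[q]|pk]; first by rewrite mem_iota => ? ->; lia.
  by exists (absz p); rewrite ?mem_iota; lia.
pose cond (n m : int) := ((n == i %[mod l%:Z]) && (m == j %[mod l%:Z]))%Z.
rewrite lcoefM (fsbigE r) //; last first.
  move=> p _; rewrite rE => np.
  have [p0|p0] := ltP p 0; first by rewrite theta_below ?mul0r.
  by rewrite (theta_below l j) ?mulr0 //; lia.
under eq_bigl do rewrite in_setT.
have E p : p \in r -> theta l i p * theta l j (k - p) =
   \sum_(n <- B) \sum_(m <- B | cond n m && (n ^+ 2 + m ^+ 2 == k))
     (if n ^+ 2 == p then 1 : 'F_2 else 0).
  rewrite rE => /andP[p0 pk].
  have [kp|kp] := ltP k p.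
    rewrite (theta_below l j) ?mulr0; last lia.
    rewrite big1 // => n _; rewrite big1 // => m /andP[_ /eqP nm].
    by case: eqP => // np; have := sqr_ge0 m; lia.
  rewrite -[theta l i p]/(theta_coef l i p) (theta_coef_box l i kp).
  rewrite -[theta l j _]/(theta_coef l j (k - p)).
  rewrite (@theta_coef_box l j k (k - p)); last lia.
  rewrite mulr_suml [LHS]big_mkcond; apply: eq_bigr => n _.
  case: ifP => [/andP[/eqP np ni]|nP].
    rewrite mul1r -/B; apply: eq_big => [m|m _]; last by rewrite np eqxx.
    by rewrite /cond ni /= andbC; congr (_ && _); rewrite -np; lia.
  rewrite big1 // => m /andP[/andP[ni _] _]; case: eqP => // np.
  by rewrite np eqxx ni in nP.
rewrite (eq_big_seq _ E) exchange_big /=.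
rewrite (eq_bigr (fun n => \sum_(m <- B | cond n m && (n ^+ 2 + m ^+ 2 == k)) (1 : 'F_2)));
  last first.
  move=> n _; rewrite exchange_big /=; apply: eq_bigr => m /andP[_ /eqP nm].
  rewrite (bigD1_seq (n ^+ 2)) //=; last first.
    by rewrite rE; have := sqr_ge0 m; have := sqr_ge0 n; lia.
  by rewrite eqxx big1 ?addr0 // => x /negPf; rewrite eq_sym => ->.
pose P (p : int * int) := cond p.1 p.2 && (p.1 ^+ 2 + p.2 ^+ 2 == k).
rewrite [RHS](_ : _ = \sum_(p \in [set` P]) (1 : 'F_2)); last first.
  apply: eq_fsbigl; apply/seteqP; split=> p.
    by case=> pk [pi pj]; apply/andP; split; [apply/andP; split|]; apply/eqP.
  by move=> /andP[/andP[/eqP pi /eqP pj] /eqP pk].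
rewrite -(bigfs _ (r := [seq (n, m) | n <- B, m <- B])); first last.
- move=> [n m] /andP[_ /eqP nm] /negP[]; have {}nm : n ^+ 2 + m ^+ 2 = k := nm.
  apply: allpairs_f; apply: mem_int_box.
  + by have := sqr_ge0 m; lia.
  + by have := sqr_ge0 n; lia.
- by apply: allpairs_uniq => //; [exact: int_box_uniq|exact: int_box_uniq|move=> [? ?] [? ?] _
  _].
rewrite [RHS]big_mkcond [RHS]big_allpairs; apply: eq_bigr => n _.
by rewrite [LHS]big_mkcond.
Qed.

(** The terms of indices p and n - p cancel modulo 2, leaving only p = n/2 when n is even; its
    square is itself since every element of Z/2 is idempotent. *)
Lemma lcoef_sqr (f : L2) n :
  (f ^+ 2) n = if (2 %| n)%Z then f (n %/ 2)%Z else 0.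
Proof.
have [N fN] := laurent_bounded f.
have [nN|Nn] := ltP n (N + N).
  rewrite expr2 -[LHS]/(conv f f n) (conv_below fN fN) //.
  by case: ifP => // n2; rewrite fN //; lia.
pose r := [seq N + i%:Z | i <- iota 0 (absz (n - N - N)%R).+1].
have ur : uniq r by rewrite map_inj_uniq ?iota_uniq // => x y; lia.
have rE p : (p \in r) = (N <= p <= n - N).
  apply/mapP/idP => [[q]|pk]; first by rewrite mem_iota => ? ->; lia.
  by exists (absz (p - N)); rewrite ?mem_iota; lia.
have pr : perm_eq r [seq n - i | i <- r].
  apply: uniq_perm => //; first by rewrite map_inj_uniq // => x y; lia.
  move=> p; apply/idP/mapP => [pr|[q qr ->]]; last by move: qr; rewrite !rE; lia.
  by exists (n - p); [move: pr; rewrite !rE; lia | lia].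
rewrite expr2 lcoefM (fsbigE r) //; last first.
  move=> p _; rewrite rE => np.
  have [pN|pN] := ltP p N; first by rewrite fN ?mul0r.
  by rewrite [f (n - p)]fN ?mulr0 //; lia.
under eq_bigl do rewrite in_setT.
rewrite (bigID (fun p => p + p < n)) /= [X in _ + X](bigID (fun p => p + p == n)) /=.
rewrite addrCA [X in _ + (_ + X)](_ : _ = \sum_(p <- r | p + p < n) f p * f (n - p)); last
  first.
  rewrite [LHS](perm_big _ pr) big_map /=; apply: eq_big => [p|p _]; first lia.
  by rewrite mulrC; congr (f _ * _); lia.
rewrite addrr_pchar2 ?pchar_Fp // addr0.
case: ifP => n2.
  rewrite (eq_bigl (pred1 (n %/ 2)%Z)) => [|p /=]; last lia.
  rewrite big_mkcond (bigD1_seq (n %/ 2)%Z) //=; last by rewrite rE; lia.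
  rewrite eqxx big1 ?addr0 => [|p /negPf-> //].
  have -> : n - (n %/ 2)%Z = (n %/ 2)%Z by lia.
  by case: (f _) => [[|[|m]] im] //; apply: val_inj.
by rewrite big_pred0 // => p; lia.
Qed.

(** * Series supported on one residue class of exponents *)

Definition lhom (q j : int) (f : L2) := forall n, f n != 0 -> (n = j %[mod q])%Z.

Lemma lhomD q j f g : lhom q j f -> lhom q j g -> lhom q j (f + g).
Proof.
move=> hf hg n; rewrite lcoefD; have [->|/hf//] := eqVneq (f n) 0.
by rewrite add0r => /hg.
Qed.

Lemma fsum_neq0 (T : choiceType) (A : set T) (F : T -> 'F_2) :
  \sum_(i \in A) F i != 0 -> exists2 i, A i & F i != 0.
Proof.
move=> nz; apply: contrapT => no; case/eqP: nz; apply: fsbig1 => i Ai.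
by apply/eqP/negPn/negP => Fi; apply: no; exists i.
Qed.

Lemma lhomM q i j f g : lhom q i f -> lhom q j g -> lhom q (i + j) (f * g).
Proof.
move=> hf hg n; rewrite lcoefM => /fsum_neq0[p _]; rewrite mulf_eq0 negb_or => /andP[/hf fp
  /hg gp].
by rewrite -[in LHS](subrK p n) -[LHS]modzDm gp fp modzDm addrC.
Qed.

Lemma lhom_sqr q j f : lhom q j f -> lhom (2 * q) (2 * j) (f ^+ 2).
Proof.
move=> hf n; rewrite lcoef_sqr; case: ifP => [n2 /hf|_]; last by rewrite eqxx.
move=> /eqP; rewrite eqz_mod_dvd => /dvdzP[z nz]; apply/eqP; rewrite eqz_mod_dvd.
by apply/dvdzP; exists z; rewrite mulrCA -nz; lia.
Qed.

Lemma lhom_dvd (q q' j : int) f : (q' %| q)%Z -> lhom q j f -> lhom q' j f.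
Proof.
move=> qq hf n /hf /eqP; rewrite eqz_mod_dvd => h; apply/eqP.
by rewrite eqz_mod_dvd; exact: dvdz_trans h.
Qed.

Lemma lhom_mod (q i j : int) f : (i = j %[mod q])%Z -> lhom q i f -> lhom q j f.
Proof. by move=> ij hf n /hf ->. Qed.

Lemma lhom1 f : lhom 1 0 f.
Proof. by move=> n _; rewrite !modz1. Qed.

Lemma int_parity (n : int) : {m | n = 2 * m} + {m | n = 2 * m + 1}.
Proof.
have [n2|n2] := boolP (2 %| n)%Z; [left | right]; exists (n %/ 2)%Z; lia.
Qed.

Lemma odd_even (q w : int) : q * 2 = 2 * w + 1 -> False.
Proof. by lia. Qed.

(** * Quadratic relations between theta series *)

Section Theta.
Variable l : nat.
Hypothesis l_odd : odd l.
Local Notation X := (theta l).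

Lemma theta_mod (i j : int) : (i = j %[mod l%:Z])%Z -> X i = X j.
Proof.
move=> ij; apply: laurentP => k; apply: eq_fsbigl; apply/seteqP.
by split=> n [nk ni]; split=> //; rewrite ni ij.
Qed.

Lemma thetaN (i : int) : X (- i) = X i.
Proof.
apply: laurentP => k; rewrite /= /theta_coef.
rewrite (reindex_fsbig (fun n : int => - n) [set n : int | n ^+ 2 = k /\ (n = i %[mod
  l%:Z])%Z]) //.
have modN (x y : int) : (x = y %[mod l%:Z])%Z -> (- x = - y %[mod l%:Z])%Z.
  by move=> xy; rewrite -modzNm xy modzNm.
split.
- by move=> n [nk ni]; split; rewrite ?sqrrN //; apply: modN.
- by move=> x y _ _; lia.
- move=> n [nk ni]; exists (- n); last lia.
  by split; rewrite ?sqrrN // -[i]opprK; apply: modN.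
Qed.

(** In class 0 each nonzero n cancels against -n, which lies in the same class. *)
Lemma theta0 : X 0 = 1.
Proof.
apply: laurentP => k; rewrite lcoef1 /= /theta_coef.
have [->|k0] := eqVneq k 0.
  rewrite (_ : [set _ | _] = [set 0]) ?fsbig_set1 //; apply/seteqP; split=> n /=.
    by case=> /eqP; rewrite sqrf_eq0 => /eqP.
  by move=> ->; rewrite expr0n.
set A := [set _ | _]; have [/eqP->|/set0P[m Am]] := boolP (A == set0).
  by rewrite fsbig_set0.
have [mk m0] := Am.
have mN : m <> - m by move=> e; case/eqP: k0; rewrite -mk (_ : m = 0) ?expr0n //; lia.
have -> : A = [set` [:: m; - m]].
  apply/seteqP; split=> n /=; rewrite !inE.
    by case=> nk _; move/eqP: nk; rewrite -mk eqf_sqr.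
  case/orP=> /eqP -> //; split; first by rewrite sqrrN.
  by rewrite -modzNm m0 modzNm oppr0.
rewrite -fsbig_seq ?big_cons ?big_nil /=; first by apply/eqP.
by rewrite inE andbT; apply/eqP.
Qed.

(** A square divisible by 4 comes from an even n = 2m, and 2 can be cancelled from 2m = 2s modulo
    the odd l. So the terms of X_2s with exponent divisible by 4 add up to X_s^4. *)
Lemma theta_double (s k : int) : theta_coef l (2 * s) (4 * k) = theta_coef l s k.
Proof.
rewrite /theta_coef.
rewrite (reindex_fsbig (fun n : int => 2 * n) [set n : int | n ^+ 2 = k /\ (n = s %[mod
  l%:Z])%Z]) //.
have c2 : coprimez l%:Z 2 by rewrite coprimezE /= coprimen2.
split.
- move=> n [nk ni]; split; first by rewrite exprMn nk.
  by rewrite -modzMmr ni modzMmr.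
- by move=> x y _ _; lia.
- move=> n [nk ni]; have [[m nm]|[m nm]] := int_parity n; last by move: nk; rewrite nm expr2;
  lia.
  exists m => //; split; first by move: nk; rewrite nm !expr2; lia.
  apply/eqP; rewrite eqz_mod_dvd -(Gauss_dvdzr _ c2) mulrBr -nm -eqz_mod_dvd; exact/eqP.
Qed.

(** The contribution of the odd n to X_2s: adding X_s^4 removes that of the even n. Odd squares are
    1 modulo 8, which gives the residue class in [thetaO_lhom]. *)
Definition thetaO (s : int) := X (2 * s) + X s ^+ 4.

Lemma thetaO_lhom s : lhom 8 1 (thetaO s).
Proof.
move=> n; rewrite lcoefD -[4%N]/(2 * 2)%N exprM !lcoef_sqr.
have [n4|n4] := boolP (4 %| n)%Z.
  rewrite !ifT; [|lia..].
  set m := divz _ _; have -> : n = 4 * m by rewrite /m; lia.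
  rewrite -[theta _ _ _]/(theta_coef l (2 * s) (4 * m)) theta_double.
  by rewrite addrr_pchar2 ?pchar_Fp ?eqxx.
rewrite (_ : (if _ then _ else _) = 0); last by do 2 case: ifP => // ?; lia.
rewrite addr0 => Xn.
have /fsum_neq0[m [mn _] _] : theta_coef l (2 * s) n != 0 := Xn.
rewrite -mn.
have [[z mz]|[z ->]] := int_parity m.
  by case/negP: n4; rewrite -mn mz; apply/dvdzP; exists (z ^+ 2); ring.
have [y zy] : exists y, z * (z + 1) = 2 * y.
  have [[y ->]|[y ->]] := int_parity z.
    by exists (y * (2 * y + 1)); ring.
  by exists ((2 * y + 1) * (y + 1)); ring.
apply/eqP; rewrite eqz_mod_dvd; apply/dvdzP; exists y.
rewrite (_ : _ - 1 = 4 * (z * (z + 1))); last by ring.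
by rewrite zy; ring.
Qed.

(** This is multiplication by 1 + i on Gaussian integers. In X_2s X_2t an even exponent x^2 + y^2
    has x, y of equal parity, so x = p + q, y = p - q with p in class s + t, q in class s - t, and
    x^2 + y^2 = 2(p^2 + q^2). Hence the even part of X_2s X_2t is (X_{s+t} X_{s-t})^2. *)
Lemma theta_rel s t :
  thetaO s * thetaO t = (X (s + t) * X (s - t)) ^+ 2 + (X s * X t) ^+ 4.
Proof.
have E0 f : lhom 4 0 (f ^+ 4).
  by rewrite -[4%N]/(2 * 2)%N exprM; exact: (lhom_sqr (lhom_sqr (@lhom1 f))).
have d24 : (2 %| 4)%Z by []. have d28 : (2 %| 8)%Z by [].
have O1 u : lhom 2 1 (thetaO u) := lhom_dvd d28 (@thetaO_lhom u).
have E2 f : lhom 2 0 (f ^+ 4) := lhom_dvd d24 (@E0 f).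
(* Expanding X_2s X_2t along X_2s = X_s^4 + [thetaO s], the odd part is g and the even part is e. *)
pose g := X s ^+ 4 * thetaO t + thetaO s * X t ^+ 4.
pose e := thetaO s * thetaO t + (X s * X t) ^+ 4.
have eg : X (2 * s) * X (2 * t) = e + g.
  have split2 u : X (2 * u) = X u ^+ 4 + thetaO u by rewrite addrCA laurent2_addrr addr0.
  by rewrite !split2 /e /g exprMn; ring.
have ge : lhom 2 1 g.
  apply: lhomD; first by apply: (@lhomM 2 0 1).
  by apply: (@lhomM 2 1 0).
have he : lhom 2 0 e.
  apply: lhomD; last exact: E2.
  by apply: (@lhom_mod 2 (1 + 1)) => //; apply: lhomM.
suff ee : e = (X (s + t) * X (s - t)) ^+ 2 by rewrite -ee /e -addrA laurent2_addrr addr0.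
have e2 : forall n, (2 %| n)%Z -> e n = (X (2 * s) * X (2 * t)) n.
  move=> n n2; have gn : g n = 0 by apply/eqP/negPn/negP => /ge /eqP; lia.
  by rewrite eg (lcoefD e g) gn addr0.
apply: laurentP => n; rewrite lcoef_sqr; case: ifP => n2; last first.
  by apply/eqP/negPn/negP => /he; lia.
rewrite e2 // !thetaM_coef.
rewrite (reindex_fsbig (fun p : int * int => (p.1 + p.2, p.1 - p.2))
  [set p : int * int | p.1 ^+ 2 + p.2 ^+ 2 = (n %/ 2)%Z /\
     (p.1 = s + t %[mod l%:Z])%Z /\ (p.2 = s - t %[mod l%:Z])%Z]) //.
split.
- move=> [u v] [/= uv [us vt]]; split => /=.
    have /divzK <- := n2; rewrite -uv; ring.
  split; first by rewrite -modzDm us vt modzDm; congr (_ %% _)%Z; ring.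
  by rewrite -modzDm us -modzNm vt modzNm modzDm; congr (_ %% _)%Z; ring.
- by move=> [u v] [u' v'] _ _ /= [h1 h2]; congr (_, _); lia.
- move=> [x y] [/= xy [xs yt]].
  have [[u xu]|[u xu]] := int_parity (x + y); last first.
    have : n = 2 * (2 * u ^+ 2 + 2 * u - x * y) + 1.
      by rewrite -xy -[RHS]/(_ + 1) (_ : x = 2 * u + 1 - y); [ring|rewrite -xu; ring].
    by move: n2 => /dvdzP[q ->] /odd_even.
  have xE : x = 2 * u - y by rewrite -xu; ring.
  exists (u, u - y); last by rewrite xE; congr (_, _) => /=; ring.
  have nE : n = 2 * (u ^+ 2 + (u - y) ^+ 2) by rewrite -xy xE; ring.
  split => /=; first by rewrite nE mulKz.
  have c2 : coprimez l%:Z 2 by rewrite coprimezE /= coprimen2.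
  have us : (u = s + t %[mod l%:Z])%Z.
    apply/eqP; rewrite eqz_mod_dvd -(Gauss_dvdzr _ c2) mulrBr -xu mulrDr.
    by rewrite -eqz_mod_dvd -modzDm xs yt modzDm.
  split=> //; move/eqP: us; move/eqP: yt => /=; rewrite !eqz_mod_dvd => yt us.
  apply/eqP; rewrite eqz_mod_dvd (_ : _ - _ = u - (s + t) - (y - 2 * t)); last by ring.
  by move: yt us => /dvdzP[p ->] /dvdzP[q ->]; apply/dvdzP; exists (q - p); rewrite mulrBl.
Qed.
End Theta.

(** The other root -n lies in the class of n only if l divides 2n. *)
Lemma theta_sq l (n : int) : ~~ (l%:Z %| 2 * n)%Z -> theta l n (n ^+ 2) = 1.
Proof.
move=> n0; rewrite /= /theta_coef (_ : [set _ | _] = [set n]) ?fsbig_set1 //.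
apply/seteqP; split=> m /=; last by move=> ->.
case=> /eqP; rewrite eqf_sqr => /orP[/eqP -> //|/eqP ->] /eqP.
rewrite eqz_mod_dvd (_ : - n - n = - (2 * n)); last by ring.
by rewrite dvdzE abszN -dvdzE (negPf n0).
Qed.

Lemma theta_neq0 l (n : int) : odd l -> ~~ (l%:Z %| n)%Z -> theta l n != 0.
Proof.
move=> lo ln; apply/eqP => /(congr1 (fun f : L2 => f (n ^+ 2))).
rewrite theta_sq ?lcoef0; first by move/eqP; rewrite oner_eq0.
by rewrite Gauss_dvdzr // coprimezE /= coprimen2.
Qed.

Lemma thetaO_neq0 l (s : int) : odd l -> ~~ (l%:Z %| s)%Z -> thetaO l s != 0.
Proof.
(* An odd representative of the class 2s: X_s^4 has no odd exponent, so the coefficient at n^2 is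
   that of X_2s. *)
move=> lo ls; pose n : int := 2 * s + l%:Z.
have nodd : ~~ (2 %| n ^+ 2)%Z by rewrite dvdzE abszX Euclid_dvdX // /n; lia.
have c2 : coprimez l%:Z 2 by rewrite coprimezE /= coprimen2.
apply/eqP => /(congr1 (fun f : L2 => f (n ^+ 2))).
rewrite lcoefD -[4%N]/(2 * 2)%N exprM !lcoef_sqr (negPf nodd) addr0.
rewrite (@theta_mod l _ n); last by rewrite /n modzDr.
rewrite theta_sq ?lcoef0; first by move/eqP; rewrite oner_eq0.
by rewrite Gauss_dvdzr // /n rpredDr ?dvdzz // Gauss_dvdzr.
Qed.

(** * Polynomials over Z/2 by reflection *)

(* A monomial is the list of the indices of its variables, with repetition; a
   polynomial over Z/2 is a list of monomials. *)
Definition mon := seq nat.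
Definition pol := seq mon.

Definition pmul (p q : pol) : pol := [seq m ++ m' | m <- p, m' <- q].
Fixpoint ppow (p : pol) n : pol := if n is n'.+1 then pmul p (ppow p n') else [:: [::]].

Fixpoint lexleq (s t : mon) : bool :=
  match s, t with
  | [::], _ => true
  | _ :: _, [::] => false
  | i :: s', j :: t' => (i < j)%N || ((i == j) && lexleq s' t')
  end.

(** Deleting two adjacent equal monomials is sound on any list; sorting in [vanishing] only brings
    equal monomials together, so soundness uses nothing about the order beyond its producing a
    permutation. *)
Fixpoint cancel_pairs (p : pol) : pol :=
  if p is m :: p' then
    let r := cancel_pairs p' in
    if r is m' :: r' then if m == m' then r' else m :: r else [:: m]
  else [::].

Definition vanishing (p : pol) : bool :=
  nilp (cancel_pairs (sort lexleq [seq sort leq m | m <- p])).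

Section Eval.
Variables (R : comNzRingType) (x : nat -> R).
Hypothesis R2 : forall y : R, y + y = 0.

Definition pev (p : pol) : R := \sum_(m <- p) \prod_(i <- m) x i.

Lemma pev_nil : pev [::] = 0. Proof. by rewrite /pev big_nil. Qed.

Lemma pev_cat p q : pev (p ++ q) = pev p + pev q.
Proof. by rewrite /pev big_cat. Qed.

Lemma pev_cons m p : pev (m :: p) = \prod_(i <- m) x i + pev p.
Proof. by rewrite /pev big_cons. Qed.

Lemma pev_mul p q : pev (pmul p q) = pev p * pev q.
Proof.
rewrite /pev /pmul big_allpairs_dep mulr_suml; apply: eq_bigr => m _.
by rewrite mulr_sumr; apply: eq_bigr => m' _; rewrite big_cat.
Qed.

Lemma pev_pow p n : pev (ppow p n) = pev p ^+ n.
Proof.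
elim: n => [|n IH] /=; first by rewrite expr0 /pev big_seq1 big_nil.
by rewrite pev_mul IH exprS.
Qed.

Lemma pev_var i : pev [:: [:: i]] = x i.
Proof. by rewrite /pev !big_seq1. Qed.

Lemma pev_perm p q : perm_eq p q -> pev p = pev q.
Proof. exact: perm_big. Qed.

Lemma pev_cancel p : pev (cancel_pairs p) = pev p.
Proof.
elim: p => //= m p; case: (cancel_pairs p) => [|m' r] IH.
  by rewrite !pev_cons -IH.
case: eqP => [->|_]; last by rewrite [RHS]pev_cons -IH -pev_cons.
by rewrite pev_cons -IH pev_cons addrA R2 add0r.
Qed.

Lemma vanishingP p : vanishing p -> pev p = 0.
Proof.
move=> /nilP v; have /= := pev_cancel (sort lexleq [seq sort leq m | m <- p]).
rewrite v pev_nil => /esym; rewrite (pev_perm (permEl (perm_sort _ _))) => <-.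
rewrite /pev big_map; apply: eq_bigr => m _.
by apply/esym/perm_big; rewrite perm_sort.
Qed.

End Eval.

(* Monomials are coded by hexadecimal numbers whose digits are the indices. *)
Fixpoint bits (p : positive) : seq bool :=
  match p with xH => [:: true] | xO q => false :: bits q | xI q => true :: bits q end.
Fixpoint nibbles (s : seq bool) : mon :=
  match s with
  | b0 :: b1 :: b2 :: b3 :: s' =>
      rcons (nibbles s') (b0 + (b1 + (b2 + b3.*2).*2).*2)%N
  | [::] => [::]
  | _ => [:: foldr (fun (b : bool) n => b + n.*2)%N 0%N s]
  end.
(** The code 0 is the empty monomial, hence the entry [0] in a certificate is the factor 1. *)
Definition hex (n : N) : mon := if n is Npos p then nibbles (bits p) else [::].
Definition hexp (s : seq N) : pol := map hex s.

(** The tactic [ring] does not know that 2 = 0. Supplying the doubled terms z turns an identity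
    modulo 2 into one valid in every commutative ring. *)
Lemma laurent2_eq (x y z : L2) : x = y + z *+ 2 -> x = y.
Proof. by rewrite mulr2n laurent2_addrr addr0. Qed.

(** * Projections onto residue classes of exponents *)

Lemma projE q j (f : L2) n :
  laurent_proj q j f n = if (n == j%:Z %[mod q%:Z])%Z then f n else 0.
Proof. by []. Qed.

Lemma projD q j (f g : L2) :
  laurent_proj q j (f + g) = laurent_proj q j f + laurent_proj q j g.
Proof. by apply: laurentP => n; rewrite lcoefD /=; case: ifP; rewrite ?addr0. Qed.

Lemma proj_in (q j : nat) (i : int) f :
  lhom q%:Z i f -> (i == j%:Z %[mod q%:Z])%Z -> laurent_proj q j f = f.
Proof.
move=> hf /eqP ij; apply: laurentP => n /=; case: eqP => // nj.
by apply/esym/eqP/negPn/negP => /hf; rewrite ij.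
Qed.

Lemma proj_out (q j : nat) (q' i : int) f :
  lhom q' i f -> (q' %| q%:Z)%Z -> (i != j%:Z %[mod q'])%Z -> laurent_proj q j f = 0.
Proof.
move=> hf qq /eqP ij; apply: laurentP => n /=; case: eqP => // /eqP.
rewrite eqz_mod_dvd => nj; apply/eqP/negPn/negP => /hf ni; apply: ij.
by rewrite -ni; apply/eqP; rewrite eqz_mod_dvd; exact: dvdz_trans nj.
Qed.

Lemma proj_sqr q j (f : L2) :
  laurent_proj (2 * q) (2 * j) (f ^+ 2) = laurent_proj q j f ^+ 2.
Proof.
apply: laurentP => n; rewrite lcoef_sqr !projE lcoef_sqr.
have [n2|n2] := boolP (2 %| n)%Z; last by rewrite if_same.
have [m ->] : exists m, n = m * 2 by apply/dvdzP.
by rewrite !eqz_mod_dvd mulzK // !PoszM -[m * 2]mulrC -mulrBr dvdz_mul2l.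
Qed.

Lemma proj_red q j (f g h : L2) : f = g ^+ 2 + h -> lhom 2 1 h ->
  laurent_proj (2 * q) (2 * j) f = laurent_proj q j g ^+ 2.
Proof.
move=> -> hh; rewrite projD proj_sqr (proj_out hh) ?addr0 //.
by rewrite PoszM; apply: dvdz_mulr.
  by rewrite PoszM eq_sym eqz_mod_dvd dvdzE; lia.
Qed.

Lemma lhom_sqr2 f : lhom 2 0 (f ^+ 2).
Proof. exact: (lhom_sqr (@lhom1 f)). Qed.

Lemma lhom_exp4 q j f : lhom q j f -> lhom (4 * q) (4 * j) (f ^+ 4).
Proof.
move=> hf; rewrite -[4%N]/(2 * 2)%N exprM -[4]/(2 * 2 : int) -!mulrA.
exact: (lhom_sqr (lhom_sqr hf)).
Qed.

Lemma lhom_exp8 f : lhom 8 0 (f ^+ 8).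
Proof. by rewrite -[8%N]/(4 * 2)%N exprM; exact: (lhom_sqr (lhom_exp4 (@lhom1 f))). Qed.

(** * Projections of 1/a, b^2/a and b^3/a in closed form *)

Section Projections.
Variables a b c d c1 : L2.
Local Notation o := (a + b ^+ 4).
Local Notation ob := (b + c ^+ 4).
Local Notation oc := (c + c1 ^+ 4).
Local Notation E := (a * c ^+ 4 + b ^+ 5).
Local Notation v := (a^-1).
Hypothesis a0 : a != 0.
Hypothesis o_lhom : lhom 8 1 o.
Hypothesis ob_lhom : lhom 8 1 ob.
Hypothesis oc_lhom : lhom 8 1 oc.
Hypothesis o_ob : o * ob = (c * d) ^+ 2 + (b * c) ^+ 4.

Let av : a * v = 1. Proof. exact: divff. Qed.
Let aE : a = b ^+ 4 + o. Proof. by apply: (@laurent2_eq _ _ (- b ^+ 4)); ring. Qed.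
Let sqrD4 (f g : L2) : (f + g) ^+ 4 = f ^+ 4 + g ^+ 4.
Proof. by rewrite -[4%N]/(2 * 2)%N !exprM !laurent2_sqrD. Qed.
Let a2 : a ^+ 2 = b ^+ 8 + o ^+ 2.
Proof. by rewrite [in LHS]aE (laurent2_sqrD (b ^+ 4) o); congr (_ + _); ring. Qed.
Let a4 : a ^+ 4 = b ^+ 16 + o ^+ 4.
Proof. by rewrite [in LHS]aE (sqrD4 (b ^+ 4) o); congr (_ + _); ring. Qed.
Let bE : b = c ^+ 4 + ob. Proof. by apply: (@laurent2_eq _ _ (- c ^+ 4)); ring. Qed.
Let b2 : b ^+ 2 = c ^+ 8 + ob ^+ 2.
Proof. by rewrite [in LHS]bE (laurent2_sqrD (c ^+ 4) ob); congr (_ + _); ring. Qed.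
Let b4 : b ^+ 4 = c ^+ 16 + ob ^+ 4.
Proof. by rewrite [in LHS]bE (sqrD4 (c ^+ 4) ob); congr (_ + _); ring. Qed.
Let c4 : c ^+ 4 = c1 ^+ 16 + oc ^+ 4.
Proof.
have {1}-> : c = c1 ^+ 4 + oc by apply: (@laurent2_eq _ _ (- c1 ^+ 4)); ring.
by rewrite (sqrD4 (c1 ^+ 4) oc); congr (_ + _); ring.
Qed.
(** This is the parity splitting of ab: (cd)^2 is its even part and E its odd part. By [Eo], E is
    even supported on exponents congruent to 1 modulo 4. *)
Let cdE : (c * d) ^+ 2 = a * b + E.
Proof.
have -> : (c * d) ^+ 2 = o * ob - (b * c) ^+ 4 by rewrite o_ob addrK.
by ring.
Qed.
Let Eo : E = o * c ^+ 4 + b ^+ 4 * ob.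
Proof. by apply: (@laurent2_eq _ _ (- (b * c) ^+ 4)); ring. Qed.
Let E2 : E ^+ 2 = o ^+ 2 * c ^+ 8 + b ^+ 8 * ob ^+ 2.
Proof. by rewrite Eo (laurent2_sqrD (o * c ^+ 4)); ring. Qed.

Let v_exp n : v = a ^+ n * v ^+ n.+1.
Proof. by rewrite exprS mulrCA -exprMn av expr1n mulr1. Qed.

(* The class modulo 8 of a monomial in o, ob, oc and eighth powers. *)
Let o2 : lhom 8 2 (o ^+ 2) := lhom_dvd (isT : (8 %| 16)%Z) (lhom_sqr o_lhom).
Let ob2 : lhom 8 2 (ob ^+ 2) := lhom_dvd (isT : (8 %| 16)%Z) (lhom_sqr ob_lhom).
Let o4 : lhom 8 4 (o ^+ 4) := lhom_dvd (isT : (8 %| 32)%Z) (lhom_exp4 o_lhom).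
Let ob4 : lhom 8 4 (ob ^+ 4) := lhom_dvd (isT : (8 %| 32)%Z) (lhom_exp4 ob_lhom).
Let oc4 : lhom 8 4 (oc ^+ 4) := lhom_dvd (isT : (8 %| 32)%Z) (lhom_exp4 oc_lhom).
Let p8 f : lhom 8 0 (f ^+ 8) := @lhom_exp8 f.
Let p16 f : lhom 8 0 (f ^+ 16).
Proof. by rewrite -[16%N]/(2 * 8)%N exprM. Qed.

Let v8 := v ^+ 8.
Let v8_lhom : lhom 8 0 v8 := @lhom_exp8 v.

(** The denominator of v = a a^2 a^4 / a^8 does not affect classes modulo 8. Taking o out of the
    first factor, (b^8 + o^2)(b^16 + o^4) yields exactly one term in each odd class; taking b^4 out
    of it yields the even part. *)
Let inv_classes : v =
  (o * b ^+ 24 * v8 + o ^+ 3 * b ^+ 16 * v8 + o ^+ 5 * b ^+ 8 * v8) +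
  (o ^+ 7 * v8 + (c ^+ 16 + ob ^+ 4) * (b ^+ 8 + o ^+ 2) * (b ^+ 16 + o ^+ 4) * v8).
Proof.
rewrite {1}(v_exp 7) -/v8 (_ : a ^+ 7 = a * a ^+ 2 * a ^+ 4); last by ring.
rewrite a2 a4 {1}aE -b4; ring.
Qed.

Let o3 : lhom 8 3 (o ^+ 3). Proof. by rewrite exprS; apply: (@lhomM 8 1 2). Qed.
Let o5 : lhom 8 5 (o ^+ 5). Proof. by rewrite exprS; apply: (@lhomM 8 1 4). Qed.
Let o7 : lhom 8 7 (o ^+ 7).
Proof. by rewrite -[7%N]/(3 + 4)%N exprD; apply: (@lhomM 8 3 4). Qed.

Let lhom0r q i f g : lhom q i f -> lhom q 0 g -> lhom q i (f * g).
Proof. by move=> hf hg; rewrite -[i]addr0; apply: lhomM. Qed.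
Let p24 f : lhom 8 0 (f ^+ 24).
Proof. by rewrite -[24%N]/(3 * 8)%N exprM. Qed.

Let even_rest : lhom 2 0 ((c ^+ 16 + ob ^+ 4) * (b ^+ 8 + o ^+ 2) * (b ^+ 16 + o ^+ 4) * v8).
Proof.
(* Folding the sums back shows b^4 a^2 a^4 / a^8, a square. *)
rewrite -b4 -a2 -a4 /v8.
by rewrite (_ : _ * _ = (b ^+ 2 * a * a ^+ 2 * v ^+ 4) ^+ 2); [exact: lhom_sqr2|ring].
Qed.

Lemma proj81_inv : laurent_proj 8 1 v = o * b ^+ 24 * v ^+ 8.
Proof.
rewrite {1}inv_classes !projD.
rewrite (proj_in (i := 1)) //; last by apply: lhom0r => //; apply: lhom0r.
rewrite (proj_out (q' := 8) (i := 3)) //; last by apply: lhom0r => //; apply: lhom0r.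
rewrite (proj_out (q' := 8) (i := 5)) //; last by apply: lhom0r => //; apply: lhom0r.
rewrite (proj_out (q' := 8) (i := 7)) //; last by apply: lhom0r.
by rewrite (proj_out even_rest) // !addr0.
Qed.

Lemma proj83_inv : laurent_proj 8 3 v = o ^+ 3 * b ^+ 16 * v ^+ 8.
Proof.
rewrite {1}inv_classes !projD.
rewrite (proj_out (q' := 8) (i := 1)) //; last by apply: lhom0r => //; apply: lhom0r.
rewrite (proj_in (i := 3)) //; last by apply: lhom0r => //; apply: lhom0r.
rewrite (proj_out (q' := 8) (i := 5)) //; last by apply: lhom0r => //; apply: lhom0r.
rewrite (proj_out (q' := 8) (i := 7)) //; last by apply: lhom0r.
by rewrite (proj_out even_rest) // !addr0 add0r.
Qed.

Lemma proj85_inv : laurent_proj 8 5 v = o ^+ 5 * b ^+ 8 * v ^+ 8.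
Proof.
rewrite {1}inv_classes !projD.
rewrite (proj_out (q' := 8) (i := 1)) //; last by apply: lhom0r => //; apply: lhom0r.
rewrite (proj_out (q' := 8) (i := 3)) //; last by apply: lhom0r => //; apply: lhom0r.
rewrite (proj_in (i := 5)) //; last by apply: lhom0r => //; apply: lhom0r.
rewrite (proj_out (q' := 8) (i := 7)) //; last by apply: lhom0r.
by rewrite (proj_out even_rest) // !addr0 !add0r.
Qed.

Let o21 : lhom 2 1 o := lhom_dvd (isT : (2 %| 8)%Z) o_lhom.
Let o41 : lhom 4 1 o := lhom_dvd (isT : (4 %| 8)%Z) o_lhom.
Let E_lhom4 : lhom 4 1 E.
Proof.
have p4 f : lhom 4 0 (f ^+ 4) := lhom_exp4 (@lhom1 f).
rewrite Eo; apply: lhomD; first exact: lhom0r.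
by rewrite mulrC; apply: lhom0r => //; exact: lhom_dvd ob_lhom.
Qed.
Lemma proj_inv_b2 q j :
  laurent_proj (2 * q) (2 * j) v = laurent_proj q j (b ^+ 2 * v) ^+ 2.
Proof.
apply: (@proj_red _ _ _ _ (o * v ^+ 2)).
  by rewrite {1}(v_exp 1) expr1 {1}aE; ring.
by apply: lhom0r => //; exact: lhom_sqr2.
Qed.

Let b2v : b ^+ 2 * v = (b ^+ 3 * v) ^+ 2 + b ^+ 2 * o * v ^+ 2.
Proof. by rewrite {1}(v_exp 1) expr1 {1}aE; ring. Qed.
Let b2o_odd : lhom 2 1 (b ^+ 2 * o * v ^+ 2).
Proof.
by rewrite -mulrA mulrCA; apply: lhom0r => //; rewrite -exprMn; exact: lhom_sqr2.
Qed.

Lemma proj_b2v_b3 q j :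
  laurent_proj (2 * q) (2 * j) (b ^+ 2 * v) = laurent_proj q j (b ^+ 3 * v) ^+ 2.
Proof. exact: proj_red b2v b2o_odd. Qed.

Let b3v : b ^+ 3 * v = (b * c * d * v) ^+ 2 + b ^+ 2 * v ^+ 2 * E.
Proof.
have -> : (b * c * d * v) ^+ 2 = b ^+ 2 * v ^+ 2 * (c * d) ^+ 2 by ring.
rewrite cdE; apply: (@laurent2_eq _ _ (- (b ^+ 2 * v ^+ 2 * E))).
by rewrite {1}(v_exp 1) expr1; ring.
Qed.
Let b2E_odd : lhom 2 1 (b ^+ 2 * v ^+ 2 * E).
Proof.
rewrite mulrC; apply: lhom0r; first exact: lhom_dvd E_lhom4.
by rewrite -exprMn; exact: lhom_sqr2.
Qed.

Lemma proj_b3v_bcd q j :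
  laurent_proj (2 * q) (2 * j) (b ^+ 3 * v) = laurent_proj q j (b * c * d * v) ^+ 2.
Proof. exact: proj_red b3v b2E_odd. Qed.

(** Writing b^2/a^2 = (ab)^2/a^4 and squaring the parity splitting of ab separates the classes 0 and
    2 modulo 4. *)
Let bv2 : b ^+ 2 * v ^+ 2 = (c * d * v) ^+ 4 + E ^+ 2 * v ^+ 4.
Proof.
have -> : (c * d * v) ^+ 4 = ((c * d) ^+ 2) ^+ 2 * v ^+ 4 by ring.
rewrite cdE laurent2_sqrD; apply: (@laurent2_eq _ _ (- (E ^+ 2 * v ^+ 4))).
have {1}-> : v ^+ 2 = (a * v) ^+ 2 * v ^+ 2 by rewrite av expr1n mul1r.
by ring.
Qed.
Let p4 f : lhom 4 0 (f ^+ 4) := lhom_exp4 (@lhom1 f).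
Let Ev4 : lhom 4 2 (E ^+ 2 * v ^+ 4).
Proof. by apply: lhom0r => //; exact: lhom_dvd (lhom_sqr E_lhom4). Qed.
Let b2o_classes : b ^+ 2 * o * v ^+ 2
   = (c * d * v) ^+ 4 * o + E ^+ 2 * v ^+ 4 * o.
Proof. by rewrite -mulrDl -bv2; ring. Qed.

Lemma proj41_b2v : laurent_proj 4 1 (b ^+ 2 * v) = (c * d * v) ^+ 4 * o.
Proof.
rewrite b2v projD (proj_out (@lhom_sqr2 _)) // add0r b2o_classes projD.
rewrite (proj_in (i := 1)) //; last by rewrite mulrC; apply: lhom0r.
by rewrite (proj_out (lhomM Ev4 o41)) // addr0.
Qed.

Lemma proj43_b2v : laurent_proj 4 3 (b ^+ 2 * v) = E ^+ 2 * v ^+ 4 * o.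
Proof.
rewrite b2v projD (proj_out (@lhom_sqr2 _)) // add0r b2o_classes projD.
rewrite (proj_out (q' := 4) (i := 1)) //; last by rewrite mulrC; apply: lhom0r.
by rewrite (proj_in (lhomM Ev4 o41)) // add0r.
Qed.

Lemma proj41_b3v : laurent_proj 4 1 (b ^+ 3 * v) = (c * d * v) ^+ 4 * E.
Proof.
rewrite b3v projD (proj_out (@lhom_sqr2 _)) // add0r bv2 mulrDl projD.
rewrite (proj_in (i := 1)) //; last by rewrite mulrC; apply: lhom0r.
by rewrite (proj_out (lhomM Ev4 E_lhom4)) // addr0.
Qed.

Let E2_lhom8 : lhom 8 2 (E ^+ 2) := lhom_sqr E_lhom4.
(** Over a^8 the numerator is (c^8 + ob^2) o (b^8 + o^2)(b^16 + o^4), with eight terms. Those in the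
    classes 3, 5 and 7 modulo 8 come in pairs that recombine through E^2 = o^2 c^8 + b^8 ob^2; the
    two remaining terms are in class 1. *)
Let b2o_classes8 : b ^+ 2 * o * v ^+ 2
  = (o * b ^+ 16 * E ^+ 2 * v8 + o ^+ 3 * b ^+ 8 * E ^+ 2 * v8)
  + (o ^+ 5 * E ^+ 2 * v8
     + (o * c ^+ 8 * b ^+ 24 * v8 + o ^+ 7 * ob ^+ 2 * v8)).
Proof.
have -> : v ^+ 2 = (a ^+ 2 * a ^+ 4) * v8.
  have {1}-> : v ^+ 2 = (a * v) ^+ 6 * v ^+ 2 by rewrite av expr1n mul1r.
  by rewrite /v8; ring.
by rewrite {1}a2 {1}a4 b2 E2; ring.
Qed.
Let cl3 : lhom 8 3 (o * b ^+ 16 * E ^+ 2 * v8).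
Proof. by apply: lhom0r => //; apply: (@lhomM 8 1 2) => //; apply: lhom0r. Qed.
Let cl5 : lhom 8 5 (o ^+ 3 * b ^+ 8 * E ^+ 2 * v8).
Proof. by apply: lhom0r => //; apply: (@lhomM 8 3 2) => //; apply: lhom0r. Qed.
Let cl7 : lhom 8 7 (o ^+ 5 * E ^+ 2 * v8).
Proof. by apply: lhom0r => //; apply: (@lhomM 8 5 2). Qed.
Let cl1 : lhom 8 1 (o * c ^+ 8 * b ^+ 24 * v8).
Proof. by apply: lhom0r => //; apply: lhom0r => //; apply: lhom0r. Qed.
Let cl9 : lhom 8 9 (o ^+ 7 * ob ^+ 2 * v8).
Proof. by apply: lhom0r => //; apply: (@lhomM 8 7 2). Qed.

Lemma proj83_b2v : laurent_proj 8 3 (b ^+ 2 * v) = o * b ^+ 16 * E ^+ 2 * v ^+ 8.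
Proof.
rewrite b2v projD (proj_out (@lhom_sqr2 _)) // add0r b2o_classes8 !projD.
rewrite (proj_in cl3) // (proj_out cl5) // (proj_out cl7) // (proj_out cl1) // (proj_out cl9)
  //.
by rewrite !addr0.
Qed.

Lemma proj85_b2v : laurent_proj 8 5 (b ^+ 2 * v) = o ^+ 3 * b ^+ 8 * E ^+ 2 * v ^+ 8.
Proof.
rewrite b2v projD (proj_out (@lhom_sqr2 _)) // add0r b2o_classes8 !projD.
rewrite (proj_out cl3) // (proj_in cl5) // (proj_out cl7) // (proj_out cl1) // (proj_out cl9)
  //.
by rewrite !addr0 add0r.
Qed.

Lemma proj87_b2v : laurent_proj 8 7 (b ^+ 2 * v) = o ^+ 5 * E ^+ 2 * v ^+ 8.
Proof.
rewrite b2v projD (proj_out (@lhom_sqr2 _)) // add0r b2o_classes8 !projD.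
rewrite (proj_out cl3) // (proj_out cl5) // (proj_in cl7) // (proj_out cl1) // (proj_out cl9)
  //.
by rewrite !addr0 !add0r.
Qed.

(** [E1] and [E5] are the parts of E in the classes 1 and 5 modulo 8, obtained by splitting c^4 and
    b^4 in E = o c^4 + b^4 ob. *)
Let E1 := o * c1 ^+ 16 + c ^+ 16 * ob.
Let E5 := o * oc ^+ 4 + ob ^+ 5.
Let EE : E = E1 + E5.
Proof.
have e1 : o * c ^+ 4 = o * (c1 ^+ 16 + oc ^+ 4) by rewrite -c4.
have e2 : b ^+ 4 * ob = (c ^+ 16 + ob ^+ 4) * ob by rewrite -b4.
by rewrite Eo e1 e2 /E1 /E5; ring.
Qed.

(** The part of b^3/a in class 3 modulo 4 is E^3/a^4. Its refinement modulo 8 is rewritten with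
    (cd)^2 = a ob + b^5, so that the second summand contains the square of p_{4,1}(b^3/a). *)
Lemma proj83_b3v : laurent_proj 8 3 (b ^+ 3 * v) =
  E ^+ 2 * o * v ^+ 4 * (b ^+ 4 * v * c + oc) ^+ 4 + ob * ((c * d * v) ^+ 4 * E) ^+ 2.
Proof.
have E1c : lhom 8 1 E1 by apply: lhomD; [exact: lhom0r|rewrite mulrC; exact: lhom0r].
have E5c : lhom 8 5 E5.
  apply: lhomD; first exact: (lhomM (i := 1) (j := 4)).
  by rewrite exprS; exact: (lhomM (i := 1) (j := 4)).
rewrite b3v projD (proj_out (@lhom_sqr2 _)) // add0r bv2 mulrDl projD.
rewrite (proj_out (q' := 4) (i := 1)) //; last by rewrite mulrC; apply: lhom0r.
rewrite add0r.
(* With a^4 = b^16 + o^4 the first summand is in class 3 modulo 8 and the second in class 7. *)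
have -> : E ^+ 2 * v ^+ 4 * E =
   E ^+ 2 * (b ^+ 16 * E1 + o ^+ 4 * E5) * v8 + E ^+ 2 * (b ^+ 16 * E5 + o ^+ 4 * E1) * v8.
  have -> : v ^+ 4 = a ^+ 4 * v8.
    by rewrite /v8 -[8%N]/(4 + 4)%N exprD mulrA -exprMn av expr1n mul1r.
  by rewrite a4 {2}EE; ring.
rewrite projD (proj_in (i := 3)) //; last first.
  apply: lhom0r => //; apply: (lhomM (i := 2) (j := 1)) => //.
  apply: lhomD; first by rewrite mulrC; apply: lhom0r.
  by apply: (@lhom_mod 8 9) => //; exact: (lhomM (i := 4) (j := 5)).
rewrite (proj_out (q' := 8) (i := 7)) ?addr0 //; last first.
  apply: lhom0r => //; apply: (lhomM (i := 2) (j := 5)) => //.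
  apply: lhomD; first by rewrite mulrC; apply: lhom0r.
  exact: (lhomM (i := 4) (j := 1)).
(* Adding b^16 [E5] twice eliminates [E1] and makes a^4 appear, which cancels against half of the
   denominator. *)
have -> : b ^+ 16 * E1 + o ^+ 4 * E5 = b ^+ 16 * (o * c ^+ 4 + b ^+ 4 * ob) + a ^+ 4 * E5.
  by rewrite -Eo {1}a4; apply: (@laurent2_eq _ _ (- (b ^+ 16 * E5))); rewrite {1}EE; ring.
have v4 : v ^+ 4 = a ^+ 4 * v8.
  have {1}-> : v ^+ 4 = (a * v) ^+ 4 * v ^+ 4 by rewrite av expr1n mul1r.
  by rewrite /v8; ring.
have -> : ((c * d * v) ^+ 4 * E) ^+ 2 = (a ^+ 4 * ob ^+ 4 + b ^+ 20) * v8 * E ^+ 2.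
  have -> : a ^+ 4 * ob ^+ 4 + b ^+ 20 = (a * ob + b ^+ 5) ^+ 4.
    by rewrite (sqrD4 (a * ob)); ring.
  by rewrite (_ : a * ob + b ^+ 5 = (c * d) ^+ 2) /v8; [ring|rewrite cdE; ring].
have -> : E ^+ 2 * o * v ^+ 4 * (b ^+ 4 * v * c + oc) ^+ 4
     = E ^+ 2 * o * (b ^+ 16 * c ^+ 4 + a ^+ 4 * oc ^+ 4) * v8.
  rewrite (sqrD4 (b ^+ 4 * v * c)) mulrDr.
  have -> : E ^+ 2 * o * v ^+ 4 * oc ^+ 4 = E ^+ 2 * o * (a ^+ 4 * v8) * oc ^+ 4 by rewrite v4.
  by rewrite /v8; ring.
by rewrite /E5; ring.
Qed.

(** * Projections of bcd/a and H/a *)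

Section Deep.
Variables x1 x3 x5 x7 e1 e5 : L2.
Local Notation H := (x1 ^+ 2 * x3 * x7 + c ^+ 2 * b * d + x1 * x3 * x5 ^+ 2).
Local Notation Y0 := ((x1 * c * x5) ^+ 2).
Local Notation P37 := (x3 * x7 + (x5 * c) ^+ 2).
Local Notation P46 := (b * d + (x5 * x1) ^+ 2).
Local Notation P13 := (x1 * x3 + (c * x1) ^+ 2).
Local Notation P15 := (x1 * x5 + (x3 * c) ^+ 2).
Local Notation K := ((c * d) ^+ 3 + a * b ^+ 3 * c ^+ 2).
Local Notation H1 := (e1 ^+ 8 * P37 + x1 ^+ 8 * P46 + e5 ^+ 8 * P13).
Local Notation Y := (x1 ^+ 4 * (x3 * c) ^+ 2 + (c + x1 ^+ 4) * P15).
Hypothesis P26_lhom : lhom 4 1 (c * d + (b * c) ^+ 2).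
Hypothesis P37_lhom : lhom 4 1 P37.
Hypothesis P46_lhom : lhom 4 1 P46.
Hypothesis P13_lhom : lhom 4 1 P13.
Hypothesis P15_lhom : lhom 4 1 P15.
Hypothesis o1_lhom : lhom 8 1 (x1 + e1 ^+ 4).
Hypothesis o2_lhom : lhom 8 1 (c + x1 ^+ 4).
Hypothesis o5_lhom : lhom 8 1 (x5 + e5 ^+ 4).
Hypothesis H2 : H ^+ 2 = a * b * c * d + K.

(** With ab = (cd)^2 + E and cd = (bc)^2 + (cd + (bc)^2), each split as even plus odd, K is the odd
    part of (ab)(cd). By [H2], H is thus the square root of the even part of abcd. *)
Let K_odd : lhom 2 1 K.
Proof.
have -> : K = (c * d + (b * c) ^+ 2) * (c * d) ^+ 2 + E * (b * c) ^+ 2.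
  have -> : E = a * b + (c * d) ^+ 2.
    by apply: (@laurent2_eq _ _ (- (a * b))); rewrite cdE; ring.
  by apply: (@laurent2_eq _ _ (- ((b * c) ^+ 2 * (c * d) ^+ 2))); ring.
apply: lhomD; apply: lhom0r; try exact: lhom_sqr2.
  exact: lhom_dvd P26_lhom.
exact: lhom_dvd E_lhom4.
Qed.

Let bcdv : b * c * d * v = (H * v) ^+ 2 + K * v ^+ 2.
Proof.
rewrite exprMn H2; apply: (@laurent2_eq _ _ (- (K * v ^+ 2))).
by rewrite {1}(v_exp 1) expr1; ring.
Qed.
Let Kv_odd : lhom 2 1 (K * v ^+ 2).
Proof. by apply: lhom0r => //; exact: lhom_sqr2. Qed.

Lemma proj21_bcdv : laurent_proj 2 1 (b * c * d * v) = K * v ^+ 2.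
Proof. by rewrite bcdv projD (proj_out (@lhom_sqr2 _)) // add0r (proj_in Kv_odd). Qed.

Lemma proj_bcdv_H q j :
  laurent_proj (2 * q) (2 * j) (b * c * d * v) = laurent_proj q j (H * v) ^+ 2.
Proof. exact: proj_red bcdv Kv_odd. Qed.

(** All three terms of H have the same even part Y0, so H + Y0 = x1^2 P37 + c^2 P46 + x5^2 P13.
    Splitting x1^2, c^2 and x5^2 into an eighth power plus a series in class 2 gives the part [H1]
    in class 1 modulo 4 and the part [H3] in class 3. *)
Let H3 := (x1 + e1 ^+ 4) ^+ 2 * P37 + (c + x1 ^+ 4) ^+ 2 * P46 + (x5 + e5 ^+ 4) ^+ 2 * P13.
Let HH : H + Y0 = H1 + H3.
Proof.
rewrite /H3 !laurent2_sqrD.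
apply: (@laurent2_eq _ _ (- Y0 - H1)); ring.
Qed.
Let H1_lhom : lhom 4 1 H1.
Proof.
have p84 f : lhom 4 0 (f ^+ 8) := lhom_dvd (isT : (4 %| 8)%Z) (@lhom_exp8 f).
by apply: lhomD; [apply: lhomD|]; rewrite mulrC; apply: lhom0r.
Qed.
Let H3_lhom : lhom 4 3 H3.
Proof.
have s42 f : lhom 8 1 f -> lhom 4 2 (f ^+ 2).
  by move=> hf; exact: lhom_dvd (lhom_sqr hf).
by apply: lhomD; [apply: lhomD|]; apply: (lhomM (i := 2) (j := 1)) => //; apply: s42.
Qed.
Let Hodd : lhom 2 1 (H + Y0).
Proof.
rewrite HH; apply: lhomD; first exact: lhom_dvd H1_lhom.
by apply: (@lhom_mod 2 3) => //; exact: lhom_dvd H3_lhom.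
Qed.

(** The parity splitting of (b^4 + o) H / a^2, where Y0 is the even part of H. The even half is
    written with Y0/a and (o/a)(H/a), which are the quotients controlled later. *)
Let Hv : H * v = (Y0 * v + o * H * v ^+ 2)
                 + (b ^+ 4 * (H + Y0) + o * Y0) * v ^+ 2.
Proof.
have e : Y0 * v = (b ^+ 4 + o) * Y0 * v ^+ 2.
  by rewrite {1}(v_exp 1) expr1 {1}aE; ring.
have -> : H * v = (b ^+ 4 + o) * H * v ^+ 2.
  by rewrite {1}(v_exp 1) expr1 {1}aE; ring.
by rewrite e; apply: (@laurent2_eq _ _ (- ((b ^+ 4 + o) * Y0 * v ^+ 2))); ring.
Qed.

Let Hv_even : lhom 2 0 (Y0 * v + o * H * v ^+ 2).
Proof.
have -> : Y0 * v + o * H * v ^+ 2 = (b ^+ 2 * (x1 * c * x5) * v) ^+ 2 + o * (H + Y0) * v ^+ 2.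
  have -> : Y0 * v = (b ^+ 4 + o) * Y0 * v ^+ 2.
    by rewrite {1}(v_exp 1) expr1 {1}aE; ring.
  by ring.
apply: lhomD; first exact: lhom_sqr2.
apply: lhom0r; last exact: lhom_sqr2.
by apply: (@lhom_mod 2 2) => //; exact: (lhomM (i := 1) (j := 1)).
Qed.
Let Hv_odd : lhom 2 1 ((b ^+ 4 * (H + Y0) + o * Y0) * v ^+ 2).
Proof.
apply: lhom0r; last exact: lhom_sqr2.
apply: lhomD; last by apply: lhom0r => //; exact: lhom_sqr2.
by rewrite mulrC; apply: lhom0r => //; exact: (lhom_dvd (isT : (2 %| 4)%Z) (@p4 b)).
Qed.

Lemma proj20_Hv : laurent_proj 2 0 (H * v) = Y0 * v + o * H * v ^+ 2.
Proof. by rewrite Hv projD (proj_in Hv_even) // (proj_out Hv_odd) // addr0. Qed.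

(** Y is the even part of x1 c x5, from x1 x5 = (x3 c)^2 + P15 and c = x1^4 + (c + x1^4). Hence Y^2
    is the part of Y0 in class 0 modulo 4. *)
Let Y_even : lhom 2 0 Y.
Proof.
have d8 f : lhom 8 1 f -> lhom 2 1 f by move=> hf; exact: lhom_dvd hf.
apply: lhomD.
  by rewrite -[4%N]/(2 * 2)%N exprM -exprMn; exact: lhom_sqr2.
apply: (@lhom_mod 2 2) => //; apply: (lhomM (i := 1) (j := 1)); first exact: d8.
exact: lhom_dvd P15_lhom.
Qed.
Let Y_odd : lhom 2 1 (x1 * c * x5 + Y).
Proof.
have d8 f : lhom 8 1 f -> lhom 2 1 f by move=> hf; exact: lhom_dvd hf.
have -> : x1 * c * x5 + Y = x1 ^+ 4 * P15 + (c + x1 ^+ 4) * (x3 * c) ^+ 2.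
  by apply: (@laurent2_eq _ _ (x1 * c * x5)); ring.
apply: lhomD; last by apply: lhom0r; [exact: d8|exact: lhom_sqr2].
rewrite mulrC; apply: lhom0r; first exact: lhom_dvd P15_lhom.
by rewrite -[4%N]/(2 * 2)%N exprM; exact: lhom_sqr2.
Qed.

Lemma proj41_Hv : laurent_proj 4 1 (H * v) =
  (b ^+ 4 * H1 + o * Y ^+ 2) * v ^+ 2
  + (b ^+ 4 * (H + Y0) + o * Y0) * o ^+ 2 * v ^+ 4.
Proof.
rewrite Hv projD (proj_out Hv_even) // add0r.
(* [Z1] and [Z3] are the parts of the numerator in the classes 1 and 3 modulo 4, kept opaque so that
   [ring] handles them as atoms. *)
have [Z1 Z1E] : {z | z = b ^+ 4 * H1 + o * Y ^+ 2} by eexists.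
have [Z3 Z3E] : {z | z = b ^+ 4 * H3 + o * (x1 * c * x5 + Y) ^+ 2} by eexists.
have ZZ : b ^+ 4 * (H + Y0) + o * Y0 = Z1 + Z3.
  rewrite HH Z1E Z3E (laurent2_sqrD (x1 * c * x5) Y).
  by apply: (@laurent2_eq _ _ (- (o * Y ^+ 2))); ring.
have v2 : v ^+ 2 = (b ^+ 8 + o ^+ 2) * v ^+ 4.
  by rewrite -a2 (_ : _ * v ^+ 4 = (a * v) ^+ 2 * v ^+ 2); [rewrite av expr1n mul1r|ring].
have Y42 : lhom 4 0 (Y ^+ 2) := lhom_sqr Y_even.
have Y42' : lhom 4 2 ((x1 * c * x5 + Y) ^+ 2) := lhom_sqr Y_odd.
have Z1c : lhom 4 1 Z1.
  by rewrite Z1E; apply: lhomD; [rewrite mulrC|]; apply: lhom0r.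
have Z3c : lhom 4 3 Z3.
  rewrite Z3E; apply: lhomD; first by rewrite mulrC; apply: lhom0r.
  exact: (lhomM (i := 1) (j := 2)).
have p84 f : lhom 4 0 (f ^+ 8) := lhom_dvd (isT : (4 %| 8)%Z) (@lhom_exp8 f).
have o42 : lhom 4 2 (o ^+ 2) := lhom_dvd (isT : (4 %| 8)%Z) o2.
have -> : (b ^+ 4 * (H + Y0) + o * Y0) * v ^+ 2 =
   (Z1 * b ^+ 8 + Z3 * o ^+ 2) * v ^+ 4 + (Z1 * o ^+ 2 + Z3 * b ^+ 8) * v ^+ 4.
  by rewrite ZZ v2; ring.
have c1' : lhom 4 1 ((Z1 * b ^+ 8 + Z3 * o ^+ 2) * v ^+ 4).
  apply: lhom0r; last exact: p4.
  apply: lhomD; first exact: (lhom0r Z1c (@p84 b)).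
  exact: (@lhom_mod 4 5 1 _ (erefl _) (lhomM Z3c o42)).
have c3' : lhom 4 3 ((Z1 * o ^+ 2 + Z3 * b ^+ 8) * v ^+ 4).
  apply: lhom0r; last exact: p4.
  by apply: lhomD; [exact: (lhomM Z1c o42)|exact: (lhom0r Z3c (@p84 b))].
(* The class 1 part Z1 b^8 + Z3 o^2 equals Z1 a^2 + (Z1 + Z3) o^2, so one term keeps only the
   denominator a^2. *)
rewrite projD (proj_in c1') // (proj_out c3') // addr0 -Z1E ZZ v2.
by apply: (@laurent2_eq _ _ (- (Z1 * o ^+ 2 * v ^+ 4))); ring.
Qed.
End Deep.

End Projections.

(** * Certified relations between theta series *)

Section Relations.
Variable l : nat.

Definition theta_at (u : int) (k : nat) : L2 := theta l (k%:Z * u).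

(* The index in [0, l/2] representing the class of k modulo l up to sign. *)
Definition index (k : nat) : nat := minn (k %% l) (l - k %% l).
Definition monom (ks : seq nat) : mon := [seq i <- map index ks | i != 0]%N.
(** A natural number congruent to s - t modulo l, which avoids truncated subtraction. *)
Definition minus (s t : nat) : nat := s + t * l.-1.

(** By [theta_rel] its square is [thetaO s] times [thetaO t], so these polynomials evaluate to the
    entries of a symmetric matrix of rank one. *)
Definition minor (s t : nat) : pol :=
  [:: monom [:: (s + t)%N; minus s t]; monom [:: s; s; t; t]].

Definition rel2 (s t : nat) : pol :=
  [:: monom [:: (s + t)%N; (s + t)%N; minus s t; minus s t];
      monom [:: (2 * s)%N; (2 * t)%N];
      monom [:: (2 * s)%N; t; t; t; t]; monom [:: (2 * t)%N; s; s; s; s]].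
(** The combination of three relations [rel2], each multiplied by the remaining X_2s, X_2t or X_2u,
    in which all fourth powers cancel. *)
Definition rel3 (s t u : nat) : pol :=
  [:: monom [:: (2 * u)%N; (s + t)%N; (s + t)%N; minus s t; minus s t];
      monom [:: (2 * s)%N; (u + t)%N; (u + t)%N; minus u t; minus u t];
      monom [:: (2 * t)%N; (s + u)%N; (s + u)%N; minus s u; minus s u];
      monom [:: (2 * s)%N; (2 * t)%N; (2 * u)%N]].
(** A vanishing 2 by 2 determinant of the rank one matrix of the [minor] polynomials: both products
    have the square O_s O_t O_u O_v, and square roots are unique in characteristic 2. *)
Definition rel4 (s t u v : nat) : pol :=
  pmul (minor s t) (minor u v) ++ pmul (minor s u) (minor t v).

(** A base relation holds at every u prime to l, hence also at ku when k is prime to l; for other k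
    the zero polynomial keeps the result a valid relation. *)
Definition rotate (k : nat) (p : pol) : pol :=
  if coprime k l then [seq monom (map (muln k) m) | m <- p] else [::].

(* The first entry of a name tells the kind of the relation: 1 for the base
   relation number i with its indices multiplied by k, otherwise the number of
   parameters of one of the relations above. *)
Definition relation (base : seq pol) (name : seq nat) : pol :=
  match name with
  | [:: 1; i; k] => rotate k (nth [::] base i)
  | [:: 2; s; t] => rel2 s t
  | [:: 3; s; t; u] => rel3 s t u
  | [:: 4; s; t; u; v] => rel4 s t u v
  | _ => [::]
  end%N.

(* A certificate pairs the name of a relation with the monomials multiplying it. *)
Definition check (base : seq pol) (p : pol) (c : seq (N * seq N)) : bool :=
  vanishing (p ++ flatten [seq pmul (relation base (hex e.1)) (hexp e.2) | e <- c]).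

Hypothesis l_odd : odd l.

Lemma L2_2 (f : L2) : f + f = 0. Proof. exact: laurent2_addrr. Qed.

Lemma theta_at0 u : theta_at u 0 = 1.
Proof. by rewrite /theta_at mul0r theta0. Qed.

Lemma theta_at_mod u (i j : nat) : (i = j %[mod l])%N -> theta_at u i = theta_at u j.
Proof.
move=> ij; apply: theta_mod; rewrite -modzMml -[RHS]modzMml.
by rewrite !modz_nat ij.
Qed.

Lemma theta_at_index u k : theta_at u (index k) = theta_at u k.
Proof.
have l0 : (0 < l)%N by case: l l_odd.
rewrite /index; have [kl|kl] := leqP (k %% l) (l - k %% l).
  by apply: theta_at_mod; rewrite modn_mod.
rewrite -(theta_at_mod u (modn_mod k l)) /theta_at -thetaN.
apply: theta_mod; apply/eqP; rewrite eqz_mod_dvd; apply/dvdzP; exists (- u).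
rewrite -subzn; first by ring.
  exact/ltnW/ltn_pmod.
exact: l_odd.
Qed.

Lemma prod_monom u ks :
  \prod_(i <- monom ks) theta_at u i = \prod_(k <- ks) theta_at u k.
Proof.
rewrite /monom big_filter big_map.
rewrite big_mkcond; apply: eq_bigr => k _; rewrite -[in RHS]theta_at_index.
by case: eqP => //= ->; rewrite theta_at0.
Qed.

Lemma theta_at_minus u s t : theta_at u (minus s t) = theta l (s%:Z * u - t%:Z * u).
Proof.
have l0 : (0 < l)%N by case: l l_odd.
apply: theta_mod; apply/eqP; rewrite eqz_mod_dvd; apply/dvdzP; exists (t%:Z * u).
by rewrite /minus -[l in RHS](prednK l0) PoszD PoszM -addn1 PoszD; ring.
Qed.

Lemma theta_at_add u s t : theta_at u (s + t) = theta l (s%:Z * u + t%:Z * u).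
Proof. by rewrite /theta_at PoszD mulrDl. Qed.

Lemma theta_at_dbl u s : theta_at u (2 * s) = theta l (2 * (s%:Z * u)).
Proof. by rewrite /theta_at PoszM mulrA. Qed.

Definition pevE := (pev_cat, pev_mul, pev_pow).

Lemma theta_rel' (s t : int) : (theta l (s + t) * theta l (s - t)) ^+ 2
  = theta l (2 * s) * theta l (2 * t)
    + theta l (2 * s) * theta l t ^+ 4 + theta l (2 * t) * theta l s ^+ 4.
Proof.
have := theta_rel l_odd s t; rewrite /thetaO => r.
apply: (addIr ((theta l s * theta l t) ^+ 4)); rewrite -r; ring.
Qed.

Lemma minor_sqr u s t : pev (theta_at u) (minor s t) ^+ 2
  = thetaO l (s%:Z * u) * thetaO l (t%:Z * u).
Proof.
rewrite theta_rel // /minor !pev_cons pev_nil addr0 laurent2_sqrD !prod_monom.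
rewrite !big_cons !big_nil theta_at_add theta_at_minus /theta_at; ring.
Qed.

Lemma rel2_vanish u s t : pev (theta_at u) (rel2 s t) = 0.
Proof.
rewrite /rel2 !pev_cons pev_nil !prod_monom !big_cons !big_nil.
rewrite theta_at_add theta_at_minus !theta_at_dbl.
rewrite -[RHS](L2_2 ((theta l (s%:Z * u + t%:Z * u) * theta l (s%:Z * u - t%:Z * u)) ^+ 2)).
by rewrite {2}theta_rel' /theta_at; ring.
Qed.

Lemma rel3_vanish u s t w : pev (theta_at u) (rel3 s t w) = 0.
Proof.
rewrite /rel3 !pev_cons pev_nil !prod_monom !big_cons !big_nil.
rewrite !theta_at_minus !theta_at_dbl !theta_at_add.
set S_ := s%:Z * u; set T_ := t%:Z * u; set W_ := w%:Z * u.
have := theta_rel' S_ T_; have := theta_rel' W_ T_; have := theta_rel' S_ W_.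
move: (theta l (S_ + T_)) (theta l (S_ - T_)) (theta l (W_ + T_)) (theta l (W_ - T_))
  (theta l (S_ + W_)) (theta l (S_ - W_)) (theta l (2 * S_)) (theta l (2 * T_))
  (theta l (2 * W_)) (theta l S_) (theta l T_) (theta l W_) => p q p' q' p'' q'' X Y Z x y z.
move=> e1 e2 e3.
apply: (@laurent2_eq _ _ (Z * (X * Y + X * y ^+ 4) + X * (Y * z ^+ 4) + Y * (X * Z + Z * x ^+
  4))).
transitivity (Z * (p * q) ^+ 2 + X * (p' * q') ^+ 2 + Y * (p'' * q'') ^+ 2 + X * Y * Z); first
  ring.
by rewrite e1 e2 e3; ring.
Qed.

Lemma rel4_vanish u s t w v : pev (theta_at u) (rel4 s t w v) = 0.
Proof.
apply/eqP; rewrite -sqrf_eq0 /rel4 pev_cat !pev_mul laurent2_sqrD !exprMn !minor_sqr.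
by rewrite [X in X + _](_ : _ = thetaO l (s%:Z * u) * thetaO l (w%:Z * u) *
  (thetaO l (t%:Z * u) * thetaO l (v%:Z * u))) ?L2_2 //; ring.
Qed.

Definition vanish_on (base : seq pol) := forall u, coprimez u l%:Z ->
  forall p, p \in base -> pev (theta_at u) p = 0.

Lemma relation_vanish base u name : vanish_on base -> coprimez u l%:Z ->
  pev (theta_at u) (relation base name) = 0.
Proof.
move=> vb ul; have z := pev_nil (theta_at u).
have rot k i : pev (theta_at u) (rotate k (nth [::] base i)) = 0.
  rewrite /rotate; case: ifP => // kl.
  have [ib|bi] := ltnP i (size base); last by rewrite nth_default.
  have kul : coprimez (k%:Z * u) l%:Z by rewrite coprimezMl ul coprimezE /= kl.
  rewrite -(vb _ kul _ (mem_nth [::] ib)) /pev big_map; apply: eq_bigr => m _.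
  rewrite prod_monom big_map; apply: eq_bigr => j _.
  by rewrite /theta_at PoszM mulrA [k%:Z * _]mulrC.
case: name => [//|[//|[|[|[|[|k]]]]] [//|i [//|j [|q [|q' [|? ?]]]]]] /=;
  by rewrite ?rot ?rel2_vanish ?rel3_vanish ?rel4_vanish ?z.
Qed.

Lemma checkP base u p c : vanish_on base -> coprimez u l%:Z ->
  check base p c -> pev (theta_at u) p = 0.
Proof.
move=> vb ul /(@vanishingP _ (theta_at u) L2_2) => <-; rewrite /check pev_cat.
rewrite [X in _ + X](_ : _ = 0) ?addr0 //.
elim: c => [|e c IH] /=; first exact: pev_nil.
by rewrite pev_cat pev_mul relation_vanish // mul0r IH addr0.
Qed.

Lemma vanish_nil : vanish_on [::]. Proof. by []. Qed.

(** A new base relation may fail to be a combination of the known ones. Since L is a field, it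
    suffices that its product with some h, nonzero at every admissible u, is one. *)
Lemma vanish_rcons base h p c : vanish_on base ->
  (forall u, coprimez u l%:Z -> pev (theta_at u) h != 0) ->
  check base (pmul h p) c -> vanish_on (rcons base p).
Proof.
move=> vb h0 ok u ul q; rewrite mem_rcons inE => /predU1P[->|]; last exact: vb.
by have /eqP := checkP vb ul ok; rewrite pev_mul mulf_eq0 (negPf (h0 u ul)) => /eqP.
Qed.

Lemma unit_ndvd (u k : int) : coprimez u l%:Z -> (~~ (l%:Z %| k))%Z -> (~~ (l%:Z %| k * u))%Z.
Proof. by move=> ul; rewrite Gauss_dvdzl // coprimez_sym. Qed.

Lemma minor_neq0 u s t : coprimez u l%:Z -> ~~ (l %| s)%N -> ~~ (l %| t)%N ->
  pev (theta_at u) (minor s t) != 0.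
Proof.
move=> ul sl tl; rewrite -sqrf_eq0 minor_sqr mulf_neq0 //;
  by apply: thetaO_neq0 => //; apply: unit_ndvd => //; rewrite dvdzE.
Qed.

Lemma theta_at_neq0 u k : coprimez u l%:Z -> ~~ (l %| k)%N -> theta_at u k != 0.
Proof. by move=> ul kl; apply: theta_neq0 => //; apply: unit_ndvd => //; rewrite dvdzE. Qed.

(** * The ring S, its ideals, and their multipliers *)

Local Notation S := (theta_ring l).

Lemma theta_ring1 : S 1.
Proof. by move=> P [P1 _ _] _. Qed.
Lemma theta_ringB f g : S f -> S g -> S (f - g).
Proof. by move=> fS gS P hP hG; have [_ PB _] := hP; apply: PB; [apply: fS|apply: gS]. Qed.
Lemma theta_ringM f g : S f -> S g -> S (f * g).
Proof. by move=> fS gS P hP hG; have [_ _ PM] := hP; apply: PM; [apply: fS|apply: gS]. Qed.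
Lemma theta_ring0 : S 0.
Proof. by rewrite -(subrr 1); apply: theta_ringB; exact: theta_ring1. Qed.
Lemma theta_ringD f g : S f -> S g -> S (f + g).
Proof.
by move=> fS gS; rewrite -[g]laurent2_opp; apply: theta_ringB.
Qed.
Lemma theta_ringX f n : S f -> S (f ^+ n).
Proof.
by move=> fS; elim: n => [|n IH]; rewrite ?exprS; [exact: theta_ring1|exact: theta_ringM].
Qed.

Lemma index_le k : (index k <= l./2)%N.
Proof.
have l0 : (0 < l)%N by case: l l_odd.
by rewrite /index; have := ltn_pmod k l0; lia.
Qed.

Lemma theta_ring_theta (i : int) : S (theta l i).
Proof.
have l0 : (0 < l)%N by case: l l_odd.
have -> : theta l i = theta_at 1 (index `|(i %% l%:Z)%Z|%N).
  rewrite theta_at_index /theta_at mulr1; apply: theta_mod.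
  by rewrite gez0_abs ?modz_mod // modz_ge0 //; lia.
case: (index _) (index_le `|(i %% l%:Z)%Z|%N) => [_|k kl].
  by rewrite theta_at0; exact: theta_ring1.
move=> P _; apply; exists k.+1; first by rewrite kl.
by rewrite /theta_at mulr1.
Qed.

Lemma theta_ring_prod u (m : mon) : S (\prod_(i <- m) theta_at u i).
Proof.
by elim/big_rec: _ => [|i f _ fS]; [exact: theta_ring1|apply: theta_ringM => //; exact:
  theta_ring_theta].
Qed.

Inductive span (G : L2 -> Prop) : L2 -> Prop :=
| span0 : span G 0
| span_cons g s f : G g -> S s -> span G f -> span G (g * s + f).

Lemma spanD G f g : span G f -> span G g -> span G (f + g).
Proof.
elim=> [|h s f' Gh Ss _ IH] gG; first by rewrite add0r.
by rewrite -addrA; apply: span_cons => //; exact: IH.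
Qed.

Lemma span_gen G g s : G g -> S s -> span G (g * s).
Proof. by move=> Gg Ss; rewrite -[_ * s]addr0; apply: span_cons => //; exact: span0. Qed.

Lemma spanZ G s f : S s -> span G f -> span G (s * f).
Proof.
move=> Ss; elim=> [|h t f' Gh St _ IH]; first by rewrite mulr0; exact: span0.
by rewrite mulrDr mulrCA; apply: span_cons => //; exact: theta_ringM.
Qed.

Lemma span_map G G' phi : (forall g, G g -> span G' (phi * g)) ->
  forall f, span G f -> span G' (phi * f).
Proof.
move=> h f; elim=> [|g s f' Gg Ss _ IH]; first by rewrite mulr0; exact: span0.
by rewrite mulrDr mulrA [_ * s]mulrC; apply: spanD => //; apply: spanZ => //; exact: h.
Qed.

Lemma span_sub G f : (forall g, G g -> S g) -> span G f -> S f.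
Proof.
move=> GS; elim=> [|g s f' Gg Ss _ IH]; first exact: theta_ring0.
by apply: theta_ringD => //; apply: theta_ringM => //; exact: GS.
Qed.

Definition divides (g m : mon) : bool :=
  perm_eq (g ++ foldr (fun i r => rem i r) m g) m.
Definition supported (G : seq mon) (p : pol) : bool :=
  all (fun m => has (fun g => divides g m) G) p.

Definition ideal u (G : seq mon) : L2 -> Prop :=
  span (fun f => exists2 g, g \in G & f = \prod_(i <- g) theta_at u i).

Lemma ideal_pev u G p : supported G p -> ideal u G (pev (theta_at u) p).
Proof.
elim: p => [_|m p IH /= /andP[/hasP[g gG gm] /IH pG]]; first by rewrite pev_nil; exact: span0.
rewrite pev_cons -(perm_big _ gm) big_cat /=; apply: spanD => //.
by apply: span_gen; [exists g|exact: theta_ring_prod].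
Qed.

Lemma ideal_ring u G f : ideal u G f -> S f.
Proof. by apply: span_sub => g [m _ ->]; exact: theta_ring_prod. Qed.

(* N / M is a polynomial in the theta series, in the ideal generated by G. *)
Definition lies base (G : seq mon) (M N : pol) :=
  exists2 Q, supported G Q & exists c, check base (pmul M Q ++ N) c.

Lemma check_quo base u M N Q c : vanish_on base -> coprimez u l%:Z ->
  pev (theta_at u) M != 0 -> check base (pmul M Q ++ N) c ->
  pev (theta_at u) N / pev (theta_at u) M = pev (theta_at u) Q.
Proof.
move=> vb ul M0 /(checkP vb ul); rewrite pev_cat pev_mul => e.
apply: (mulfI M0); rewrite mulrCA divff // mulr1.
by rewrite -[RHS]addr0 -(L2_2 (pev (theta_at u) N)) addrA e add0r.
Qed.

Lemma liesP base u G M N : vanish_on base -> coprimez u l%:Z ->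
  pev (theta_at u) M != 0 -> lies base G M N ->
  ideal u G (pev (theta_at u) N / pev (theta_at u) M).
Proof.
move=> vb ul M0 [Q QG [c ok]]; rewrite (check_quo vb ul M0 ok).
exact: ideal_pev.
Qed.

Definition var k : pol := [:: [:: index k]].
Lemma pev_var_at u k : pev (theta_at u) (var k) = theta_at u k.
Proof. by rewrite pev_var theta_at_index. Qed.

(* For l = 15 the series [5] is left out of the ideal, hence e = 5; else e = l. *)
Variable e : nat.
Hypothesis e_dvd : (e %| l)%N.

(** Generators are taken over all integers i so that the ideal does not depend on u, and quotients
    certified at different u land in the same ideal. *)
Definition nil_ideal : L2 -> Prop :=
  span (fun f => exists2 i : int, ~~ (e%:Z %| i)%Z & f = theta l i).
Local Notation n := nil_ideal.
Definition nil_gens : seq mon := [seq [:: i] | i <- iota 1 l./2 & ~~ (e %| i)%N].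
Definition multiplier t := forall f, n f -> n (t * f).
Local Notation T := multiplier.

Lemma ideal_nil u f : coprimez u l%:Z -> ideal u nil_gens f -> n f.
Proof.
move=> ul; elim=> [|g s f' [m /mapP[i]] ]; first exact: span0.
rewrite mem_filter => /andP[ei _] -> -> Ss _ IH; apply: span_cons => //.
rewrite big_seq1; exists (i%:Z * u) => //.
have eu : coprimez e%:Z u.
  by move: ul; rewrite coprimez_sym !coprimezE /=; exact: coprime_dvdl.
by rewrite Gauss_dvdzl // dvdzE.
Qed.

Lemma nil_ring f : n f -> S f.
Proof. by apply: span_sub => g [i _ ->]; exact: theta_ring_theta. Qed.

Lemma nil_theta u k : coprimez u l%:Z -> ~~ (e %| k)%N -> n (theta_at u k).
Proof.
move=> ul ek; rewrite -[theta_at _ _]mulr1; apply: span_gen; last exact: theta_ring1.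
exists (k%:Z * u) => //.
have eu : coprimez e%:Z u.
  by move: ul; rewrite coprimez_sym !coprimezE /=; exact: coprime_dvdl.
by rewrite Gauss_dvdzl // dvdzE.
Qed.

Lemma multS s : S s -> T s. Proof. by move=> Ss f; exact: spanZ. Qed.
Lemma mult1 : T 1. Proof. exact: multS theta_ring1. Qed.
Lemma multD s t : T s -> T t -> T (s + t).
Proof. by move=> hs ht f fn; rewrite mulrDl; apply: spanD; [exact: hs|exact: ht]. Qed.
Lemma multM s t : T s -> T t -> T (s * t).
Proof. by move=> hs ht f fn; rewrite -mulrA; apply: hs; exact: ht. Qed.
Lemma multX s k : T s -> T (s ^+ k).
Proof. by move=> hs; elim: k => [|k IH]; rewrite ?exprS; [exact: mult1|exact: multM]. Qed.

(** The ratio X_4u^4 / X_8u alone is certified on generators: u runs over all units modulo l, so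
    [mult_ratio] reaches every X_k^4 / X_2k with k prime to l. *)
Definition mult_certs base := forall k, (1 <= k <= l./2)%N -> ~~ (e %| k)%N ->
  lies base nil_gens (var 8) (pmul (ppow (var 4) 4) (var k)).

Lemma inverse_mod (u : int) : coprimez u l%:Z -> exists s, (s * u = 1 %[mod l%:Z])%Z.
Proof.
move=> /coprimezP[[s t] /= h]; exists s.
by rewrite -h -modzDmr modzMl addr0.
Qed.

Lemma l_ndvd_pow2 k : (1 < l)%N -> ~~ (l %| 2 ^ k)%N.
Proof.
move=> l1; apply/negP => h.
have c : coprime l (2 ^ k) by rewrite coprimeXr // coprimen2.
by move: c; rewrite /coprime (gcdn_idPl h) => /eqP l_1; rewrite l_1 in l1.
Qed.

Lemma mult_ratio base k : (1 < l)%N -> vanish_on base -> mult_certs base ->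
  coprimez k l%:Z -> T (theta l k ^+ 4 / theta l (2 * k)).
Proof.
(* h is the inverse of 2 modulo l, so u below is k/4, and k, 2k are the classes of 4u, 8u. *)
move=> l1 vb certs kl; pose h : int := (l./2).+1%:Z.
have l2h : l%:Z = 2 * h - 1.
  by rewrite /h -[in LHS](odd_double_half l) l_odd; lia.
have hl : coprimez h l%:Z.
  by apply/coprimezP; exists (2, -1) => /=; rewrite l2h; ring.
pose u := k * h * h.
have ul : coprimez u l%:Z by rewrite !coprimezMl kl hl.
have -> : theta l k = theta_at u 4.
  apply: theta_mod; apply/eqP; rewrite eqz_mod_dvd; apply/dvdzP.
  by exists (- k * (2 * h + 1)); rewrite l2h /u; ring.
have -> : theta l (2 * k) = theta_at u 8.
  apply: theta_mod; apply/eqP; rewrite eqz_mod_dvd; apply/dvdzP.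
  by exists (- k * 2 * (2 * h + 1)); rewrite l2h /u; ring.
apply: span_map => g [i ei ->]; apply: (ideal_nil ul).
have [s su] := inverse_mod ul.
have l0 : (0 < l)%N by case: l l_odd.
(* The generator [i] has to be an index of the form ju, so j = i/u modulo l. As e divides l and s is
   a unit, e does not divide j either. *)
pose j := `|((i * s) %% l%:Z)%Z|%N.
have jE : j%:Z = ((i * s) %% l%:Z)%Z by rewrite gez0_abs // modz_ge0 //; lia.
have -> : theta l i = theta_at u j.
  apply: theta_mod; rewrite jE modzMml -mulrA -modzMmr su modzMmr mulr1 //.
have ej : ~~ (e %| j)%N.
  apply: contra ei => ej.
  have edz : (e%:Z %| l%:Z)%Z by rewrite dvdzE.
  have : (e%:Z %| i * s)%Z.
    rewrite (divz_eq (i * s) l%:Z) -jE.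
    by apply: rpredD; [exact: dvdz_mull|rewrite dvdzE].
  have es : coprimez e%:Z s.
    have : coprimez s l%:Z.
      move/eqP: su; rewrite eqz_mod_dvd => /dvdzP[q qE].
      by apply/coprimezP; exists (u, - q) => /=; rewrite mulNr -qE; ring.
    by rewrite coprimez_sym !coprimezE /=; exact: coprime_dvdl.
  by rewrite Gauss_dvdzl.
have eij : ~~ (e %| index j)%N.
  have jl : (j < l)%N by rewrite -ltz_nat jE ltz_pmod //; lia.
  rewrite /index modn_small // /minn; case: ifP => // _.
  by apply: contra ej => h'; rewrite -(subKn (ltnW jl)); exact: dvdn_sub.
have ij : (1 <= index j <= l./2)%N.
  by rewrite index_le andbT lt0n; apply: contra eij => /eqP ->; rewrite dvdn0.
have n8 : pev (theta_at u) (var 8) != 0.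
  by rewrite pev_var_at theta_at_neq0 // (l_ndvd_pow2 3 l1).
have := liesP vb ul n8 (certs _ ij eij).
rewrite !pevE !pev_var_at theta_at_index.
by rewrite -[X in ideal u _ X]mulrAC.
Qed.
End Relations.

Local Notation "p ** q" := (pmul p q) (at level 40, left associativity).
Local Notation "p ^^ n" := (ppow p n%N) (at level 30, right associativity).

(** * Relations and quotients for l = 11 *)

(* The base relations, the quotients and the certificates below were found by
   linear algebra over Z/2 on truncated theta series. *)
Section Certificates11.
Local Notation a := (var 11 8).
Local Notation b := (var 11 4).
Local Notation c := (var 11 2).
Local Notation d := (var 11 6).
Local Notation y1 := (var 11 1).
Local Notation y3 := (var 11 3).
Local Notation y5 := (var 11 5).
Local Notation y7 := (var 11 7).
Local Notation o := (a ++ b ^^ 4).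
Local Notation oc := (c ++ y1 ^^ 4).
Local Notation E := (a ** c ^^ 4 ++ b ^^ 5).

Definition base11_0 : pol :=
  hexp [:: 0x45; 0x125; 0x133; 0x1114; 0x1155; 0x1234; 0x2355; 0x2444]%num.
Definition base11 : seq pol := [:: base11_0].

Lemma base11_vanish : vanish_on 11 base11.
Proof.
rewrite (_ : base11 = (rcons [::] base11_0)) //.
apply: (@vanish_rcons 11 isT [::] [:: [::]] base11_0
  [:: (0x212, [:: 0x44]); (0x223, [:: 0]); (0x225, [:: 0x11]); (0x43321, [::
  0x55]); (0x44211, [:: 0x22]); (0x44212, [:: 0x11]); (0x44421, [:: 0]);
  (0x44432, [:: 0x55]); (0x45212, [:: 0x55]); (0x45321, [:: 0x33]); (0x45323,
  [:: 0x11]); (0x45423, [:: 0x44]); (0x45424, [:: 0x33]); (0x45433, [:: 0]);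
  (0x45521, [:: 0x22])]%num);
  [|by move=> u ul; by rewrite /pev big_seq1 big_nil oner_neq0|by vm_compute].
exact: vanish_nil.
Qed.

Lemma mult11_5 : lies 11 base11 (nil_gens 11 11) a (b ^^ 4 ** var 11 5).
Proof.
exists (hexp [:: 0x244; 0x1135; 0x1445; 0x4555; 0x11245; 0x13444; 0x22345]%num);
  first by vm_compute.
exists [:: (0x104, [:: 0x4; 0x235]); (0x3321, [:: 0]); (0x44253, [:: 0x5]);
  (0x44535, [:: 0x4])]%num.
by vm_compute.
Qed.

Lemma mult11_2 : lies 11 base11 (nil_gens 11 11) a (b ^^ 4 ** var 11 2).
Proof.
exists (hexp [:: 0x2; 0x355; 0x1111]%num);
  first by vm_compute.
exists [:: (0x214, [:: 0])]%num.
by vm_compute.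
Qed.

Lemma mult11_1 : lies 11 base11 (nil_gens 11 11) a (b ^^ 4 ** var 11 1).
Proof.
exists (hexp [:: 0x245; 0x334; 0x1233; 0x1455; 0x2344; 0x11124; 0x12234; 0x13445;
0x22444]%num);
  first by vm_compute.
exists [:: (0x101, [:: 0x23]); (0x103, [:: 0x444]); (0x105, [:: 0x344]); (0x3321,
  [:: 0x3]); (0x44413, [:: 0x5]); (0x44425, [:: 0x3])]%num.
by vm_compute.
Qed.

Lemma mult11_4 : lies 11 base11 (nil_gens 11 11) a (b ^^ 4 ** var 11 4).
Proof.
exists (hexp [:: 0x4; 0x115; 0x1134; 0x1355; 0x4455; 0x11123; 0x11244; 0x22344;
0x34445]%num);
  first by vm_compute.
exists [:: (0x101, [:: 0x14]); (0x103, [:: 0x22]); (0x104, [:: 0x25]); (0x224, [::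
  0]); (0x254, [:: 0x2]); (0x3354, [:: 0x1]); (0x3514, [:: 0]); (0x44531, [::
  0])]%num.
by vm_compute.
Qed.

Lemma mult11 : mult_certs 11 11 base11.
Proof.
case=> [//|[|[|[|[|[|k]]]]]] // _ _.
- exact: mult11_1.
- exact: mult11_2.
(* Since 8 = -3 modulo 11, the variable of index 3 is a itself and the quotient is b^4. *)
- by exists (b ^^ 4); [vm_compute|exists [::]; vm_compute].
- exact: mult11_4.
- exact: mult11_5.
Qed.

Lemma t1_11 : lies 11 base11 (nil_gens 11 11) a (y1 ^^ 2 ** y3 ** y7).
Proof.
exists (hexp [:: 0x114]%num);
  first by vm_compute.
exists [::].
by vm_compute.
Qed.

Lemma t5_11 : lies 11 base11 (nil_gens 11 11) a (y1 ** y3 ** y5 ^^ 2).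
Proof.
exists (hexp [:: 0x155]%num);
  first by vm_compute.
exists [::].
by vm_compute.
Qed.

Lemma t2_11 : lies 11 base11 (nil_gens 11 11) a (y1 ** c ** b ** d).
Proof.
exists (hexp [:: 0x15; 0x2233; 0x2455; 0x3345; 0x12335; 0x14555; 0x23445]%num);
  first by vm_compute.
exists [:: (0x44413, [:: 0x55]); (0x44415, [:: 0x33]); (0x44423, [:: 0]); (0x44531,
  [:: 0x44])]%num.
by vm_compute.
Qed.

Lemma sigma_11 : lies 11 base11 (nil_gens 11 11) a ((y1 ** c ** y5) ^^ 2).
Proof.
exists (hexp [:: 0x11115; 0x11235; 0x12224; 0x12445; 0x24555]%num);
  first by vm_compute.
exists [:: (0x104, [:: 0x24]); (0x231, [:: 0x3]); (0x234, [:: 0x2]); (0x3321, [::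
  0x2])]%num.
by vm_compute.
Qed.

(** Controls the remaining term c^2 b d of H, after multiplication by o/a. *)
Lemma delta_11 : lies 11 base11 (nil_gens 11 11) (a ^^ 2) (o ** (c ** b ** d)).
Proof.
exists (hexp [:: 0x5; 0x244; 0x1224; 0x1445; 0x3333; 0x23334]%num);
  first by vm_compute.
exists [:: (0x104, [:: 0x34]); (0x214, [:: 0x45]); (0x231, [:: 0x34]); (0x234, [::
  0x3])]%num.
by vm_compute.
Qed.

(** The numerator is K, the odd part of abcd, so this quotient is p_{2,1}(bcd/a). *)
Lemma nu_11 : lies 11 base11 (nil_gens 11 11) (a ^^ 2) ((c ** d) ^^ 3 ++ a ** b ^^ 3 ** c ^^
  2).
Proof.
exists (hexp [:: 0x5; 0x244; 0x1135; 0x1224; 0x1445; 0x3333]%num);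
  first by vm_compute.
exists [:: (0x104, [:: 0x34]); (0x234, [:: 0x3]); (0x3214, [:: 0x5])]%num.
by vm_compute.
Qed.

(** Used for p_{4,1}(b^3/a) = (cd/a)^4 E. The factor b comes from (cd)^2/a = b (1 + b^4/a +
    c^4/b). *)
Lemma zeta_11 : lies 11 base11 (nil_gens 11 11) (a ^^ 3) ((c ** d) ^^ 2 ** E ** b).
Proof.
exists (hexp [:: 0x345; 0x1115; 0x1235; 0x11134; 0x11355; 0x12334; 0x14455; 0x23444;
0x111244; 0x444445]%num);
  first by vm_compute.
exists [:: (0x101, [:: 0x13355]); (0x102, [:: 0x1233]); (0x103, [:: 0x33555]);
  (0x104, [:: 0x33344]); (0x105, [:: 0x1133]); (0x214, [:: 0x24455]); (0x224,
  [:: 0x133]); (0x231, [:: 0x23445]); (0x232, [:: 0x22345]); (0x252, [::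
  0x1355]); (0x254, [:: 0x334]); (0x3214, [:: 0x3345]); (0x3321, [:: 0x335;
  0x3334]); (0x3524, [:: 0x1223]); (0x42535, [:: 0x345]); (0x44125, [::
  0x33]); (0x44135, [:: 0x133]); (0x44251, [:: 0x234])]%num.
by vm_compute.
Qed.

Lemma H2_11 : exists cert, check 11 base11
  ((y1 ^^ 2 ** y3 ** y7 ++ c ^^ 2 ** b ** d ++ y1 ** y3 ** y5 ^^ 2) ^^ 2
   ++ a ** b ** c ** d ++ ((c ** d) ^^ 3 ++ a ** b ^^ 3 ** c ^^ 2)) cert.
Proof.
exists [:: (0x221, [:: 0x5555]); (0x251, [:: 0x4; 0x2222]); (0x252, [:: 0x1111]);
  (0x44252, [:: 0])]%num.
by vm_compute.
Qed.

(** [kap_11], [kap1_11] and [kap2_11] stand for o b^3/a^2, o b^6/a^3 and o b^9/a^4. They are named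
    because each is a factor of the numerator of the next division, ending with o b^12/a^5 in
    [g_11]; dividing by a single a keeps the steps small. *)
Definition kap_11 : pol :=
  hexp [:: 0x55; 0x345; 0x1235; 0x2445; 0x11355; 0x11444; 0x14455;
  0x33335]%num.

Lemma kap_11_quo : exists cert, check 11 base11 ((a ^^ 2) ** kap_11 ++ o ** b ^^ 3) cert.
Proof.
exists [:: (0x102, [:: 0x244]); (0x104, [:: 0x3344]); (0x224, [:: 0x44]); (0x234,
  [:: 0x35]); (0x3514, [:: 0x44]); (0x44133, [:: 0x24]); (0x44233, [:: 0x34]);
  (0x44415, [:: 0x33])]%num.
by vm_compute.
Qed.

Definition kap1_11 : pol :=
  hexp [:: 0x245; 0x334; 0x1144; 0x1233; 0x1455; 0x5555; 0x11124; 0x13445;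
  0x22444; 0x23335; 0x122244; 0x133444; 0x344444; 0x1122445; 0x1144455;
  0x2444444]%num.

Lemma kap1_11_quo : exists cert, check 11 base11 (a ** kap1_11 ++ b ^^ 3 ** kap_11) cert.
Proof.
exists [:: (0x102, [:: 0; 0x2234]); (0x103, [:: 0x2; 0x444]); (0x104, [:: 0x5]);
  (0x224, [:: 0x114; 0x234]); (0x234, [:: 0x145]); (0x254, [:: 0]); (0x3352,
  [:: 0x334]); (0x41233, [:: 0x45]); (0x44133, [:: 0x55]); (0x44153, [::
  0x33]); (0x44533, [:: 0x11])]%num.
by vm_compute.
Qed.

Definition kap2_11 : pol :=
  hexp [:: 0x114; 0x155; 0x234; 0x1223; 0x11115; 0x11235; 0x13344; 0x22335;
  0x34444; 0x111444; 0x1134445; 0x1224444; 0x1444445; 0x2244455; 0x4444555;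
  0x44444444; 0x111144444; 0x222444445; 0x244444455; 0x334444445]%num.

Lemma kap2_11_quo : exists cert, check 11 base11 (a ** kap2_11 ++ b ^^ 3 ** kap1_11) cert.
Proof.
exists [:: (0x101, [:: 0x45; 0x1155]); (0x102, [:: 0x112; 0x1115; 0x444445]);
  (0x103, [:: 0x2345]); (0x104, [:: 0x122; 0x4444; 0x1125; 0x1344]); (0x105,
  [:: 0x5; 0x34; 0x111; 0x123; 0x1224; 0x4555; 0x2335; 0x22223]); (0x214, [::
  0x5; 0x44444]); (0x221, [:: 0x114; 0x1345]); (0x224, [:: 0x445; 0x1222;
  0x2555; 0x1334; 0x3355]); (0x231, [:: 0x122; 0x555; 0x1344]); (0x232, [::
  0x125]); (0x234, [:: 0x1244]); (0x235, [:: 0x222; 0x245]); (0x251, [::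
  0x144]); (0x252, [:: 0x13]); (0x254, [:: 0x345])]%num.
by vm_compute.
Qed.

Lemma g_11 : lies 11 base11 (nil_gens 11 11) a (b ^^ 3 ** kap2_11).
Proof.
exists (hexp [:: 0x135; 0x445; 0x1334; 0x2555; 0x11144; 0x11225; 0x11455; 0x15555;
0x33345; 0x122444; 0x144445; 0x444555; 0x1133444; 0x1344444; 0x11114444;
0x12444444; 0x22244445; 0x24444455; 0x33444445; 0x111344445; 0x114444445;
0x234444445; 0x333444444; 0x1134444444; 0x2244444445; 0x4444444455;
0x11111444444; 0x11244444444; 0x22344444444; 0x34444444445]%num);
  first by vm_compute.
exists [:: (0x101, [:: 0x1224455; 0x1134555; 0x22344555; 0x23334455]); (0x102, [::
  0x35; 0x113334; 0x12222345]); (0x103, [:: 0x33555; 0x22444444; 0x11222224;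
  0x11111455]); (0x104, [:: 0x134455; 0x1123455; 0x1111233]); (0x105, [::
  0x1344; 0x12444; 0x333355]); (0x214, [:: 0x11234; 0x1111235; 0x1233344]);
  (0x221, [:: 0x135; 0x3444; 0x12344]); (0x224, [:: 0x1114; 0x13555; 0x444444;
  0x133455; 0x3344445]); (0x231, [:: 0x11445; 0x14555; 0x144444; 0x1334445;
  0x3344555]); (0x232, [:: 0x1445; 0x11334; 0x2334555]); (0x234, [::
  0x245555]); (0x235, [:: 0x2244455]); (0x251, [:: 0x223455; 0x344555]);
  (0x252, [:: 0x22344; 0x334444; 0x2223345]); (0x254, [:: 0x1225; 0x244555;
  0x113334; 0x1111344; 0x1112333; 0x1333345]); (0x3214, [:: 0x111222;
  0x1244455]); (0x3314, [:: 0x12245; 0x3444444]); (0x3321, [:: 0x2345;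
  0x245555; 0x1122233]); (0x3324, [:: 0x235; 0x12455; 0x123445; 0x1144444;
  0x1134455]); (0x3351, [:: 0x34; 0x13444; 0x111144; 0x244455; 0x223344;
  0x334445; 0x2245555; 0x1112234]); (0x3352, [:: 0x11144; 0x1111145;
  0x1222455]); (0x3354, [:: 0x24; 0x333444]); (0x3514, [:: 0x1234; 0x133455]);
  (0x3521, [:: 0x1445555]); (0x3524, [:: 0x4445; 0x12224; 0x1134445;
  0x1223455]); (0x41125, [:: 0x144444; 0x111222]); (0x41153, [:: 0x235;
  0x2245; 0x34445; 0x111135; 0x333455]); (0x41232, [:: 0x13555]); (0x41233,
  [:: 0x22245]); (0x41235, [:: 0x44; 0x2345]); (0x41252, [:: 0x3; 0x11155]);
  (0x41253, [:: 0x44; 0x22224]); (0x41255, [:: 0x11145; 0x112333; 0x333345]);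
  (0x41535, [:: 0x35; 0x112223; 0x133444]); (0x42253, [:: 0x444; 0x134;
  0x33344; 0x224445]); (0x42533, [:: 0x123445]); (0x42535, [:: 0x444445]);
  (0x44121, [:: 0x114444]); (0x44122, [:: 0x222444]); (0x44123, [::
  0x344555]); (0x44125, [:: 0x24555]); (0x44131, [:: 0x112223]); (0x44132, [::
  0x55]); (0x44133, [:: 0x12224]); (0x44135, [:: 0x2355; 0x134444]); (0x44151,
  [:: 0x12344; 0x144445]); (0x44152, [:: 0x25; 0x34444]); (0x44153, [::
  0x1234]); (0x44155, [:: 0x111223]); (0x44231, [:: 0x11134; 0x11355;
  0x125555]); (0x44232, [:: 0x144; 0x455]); (0x44233, [:: 0x13445; 0x112345]);
  (0x44235, [:: 0x144445]); (0x44251, [:: 0x11333]); (0x44252, [:: 0x344444]);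
  (0x44253, [:: 0x12344]); (0x44413, [:: 0x11445]); (0x44415, [:: 0x4455;
  0x11244; 0x223335]); (0x44453, [:: 0x144; 0x1255; 0x13334; 0x33355;
  0x111125]); (0x44531, [:: 0x133; 0x12244; 0x23345; 0x444444]); (0x44533, [::
  0x34; 0x11245; 0x111144]); (0x44535, [:: 0x2225; 0x123334])]%num.
by vm_compute.
Qed.

(** Accounts for the summand a^2 c^8 of E^2 in o E^2/a^4; the summand b^10 is covered by
    [kap1_11]. *)
Lemma mu_11 : lies 11 base11 (nil_gens 11 11) (a ^^ 2) (o ** c ^^ 3).
Proof.
exists (hexp [:: 0x111; 0x1445; 0x2255; 0x4555; 0x11245; 0x22345; 0x23334;
0x34455]%num);
  first by vm_compute.
exists [:: (0x232, [:: 0x23]); (0x3524, [:: 0x55]); (0x41153, [:: 0x2]); (0x42253,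
  [:: 0x5]); (0x44121, [:: 0x44]); (0x44412, [:: 0x11])]%num.
by vm_compute.
Qed.

End Certificates11.

(** * Relations and quotients for l = 13 *)

Section Certificates13.
Local Notation a := (var 13 8).
Local Notation b := (var 13 4).
Local Notation c := (var 13 2).
Local Notation d := (var 13 6).
Local Notation y1 := (var 13 1).
Local Notation y3 := (var 13 3).
Local Notation y5 := (var 13 5).
Local Notation y7 := (var 13 7).
Local Notation o := (a ++ b ^^ 4).
Local Notation oc := (c ++ y1 ^^ 4).
Local Notation E := (a ** c ^^ 4 ++ b ^^ 5).

Definition base13_0 : pol :=
  hexp [:: 0x15; 0x134; 0x256; 0x1116; 0x1155; 0x1235; 0x4466; 0x4555]%num.
Definition base13_1 : pol :=
  hexp [:: 0x266; 0x345; 0x1156; 0x1236; 0x1244; 0x1466; 0x1555; 0x2225]%num.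
Definition base13_2 : pol :=
  hexp [:: 0x136; 0x225; 0x1245; 0x2234; 0x2446; 0x3345; 0x4666; 0x5556]%num.
Definition base13 : seq pol := [:: base13_0; base13_1; base13_2].

Lemma base13_vanish : vanish_on 13 base13.
Proof.
rewrite (_ : base13 = (rcons (rcons (rcons [::] base13_0) base13_1) base13_2)) //.
apply: (@vanish_rcons 13 isT (rcons (rcons [::] base13_0) base13_1) [:: [::]] base13_2
  [:: (0x223, [:: 0x66]); (0x234, [:: 0x55]); (0x44421, [:: 0x55]); (0x45311,
  [:: 0]); (0x45321, [:: 0x66]); (0x45412, [:: 0x44]); (0x45414, [:: 0x22]);
  (0x45433, [:: 0x44]); (0x45434, [:: 0x33]); (0x45543, [:: 0]); (0x46213, [::
  0x55]); (0x46322, [:: 0x33]); (0x46323, [:: 0x22]); (0x46431, [:: 0]);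
  (0x46512, [:: 0x33]); (0x46523, [:: 0x11]); (0x46541, [:: 0x66]); (0x46641,
  [:: 0x55]); (0x46651, [:: 0x44])]%num);
  [|by move=> u ul; by rewrite /pev big_seq1 big_nil oner_neq0|by vm_compute].
apply: (@vanish_rcons 13 isT (rcons [::] base13_0) [:: [::]] base13_1
  [:: (0x214, [:: 0x22]); (0x246, [:: 0x55]); (0x43211, [:: 0x66]); (0x44211,
  [:: 0x44]); (0x44212, [:: 0]); (0x44323, [:: 0]); (0x44421, [:: 0x11]);
  (0x45213, [:: 0x55]); (0x45413, [:: 0]); (0x45531, [:: 0x22]); (0x45532, [::
  0x11]); (0x46311, [:: 0x22]); (0x46312, [:: 0x11]); (0x46324, [:: 0x55]);
  (0x46325, [:: 0x44]); (0x46542, [:: 0x33]); (0x46543, [:: 0x22]); (0x46544,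
  [:: 0x66]); (0x46654, [:: 0x44])]%num);
  [|by move=> u ul; by rewrite /pev big_seq1 big_nil oner_neq0|by vm_compute].
apply: (@vanish_rcons 13 isT [::] [:: [::]] base13_0
  [:: (0x213, [:: 0x5]); (0x214, [:: 0x6; 0x236]); (0x215, [:: 0x23; 0x15;
  0x134]); (0x216, [:: 0x35; 0x334]); (0x226, [:: 0x444]); (0x234, [:: 0x2;
  0x666]); (0x246, [:: 0; 0x15]); (0x256, [:: 0x4; 0x25]); (0x44212, [::
  0x45]); (0x44213, [:: 0x12]); (0x45212, [:: 0x6]); (0x45324, [:: 0x3]);
  (0x45421, [:: 0x34]); (0x45424, [:: 0x35]); (0x45521, [:: 0x66]); (0x45543,
  [:: 0x36]); (0x46211, [:: 0x24]); (0x46322, [:: 0x55]); (0x46324, [::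
  0x46]); (0x46411, [:: 0x56]); (0x46423, [:: 0x15]); (0x46424, [:: 0x5]);
  (0x46431, [:: 0x36]); (0x46513, [:: 0x26]); (0x46533, [:: 0x16]); (0x46535,
  [:: 0x12]); (0x46541, [:: 0x23]); (0x46631, [:: 0x12]); (0x46643, [::
  0x1])]%num);
  [|by move=> u ul; by rewrite /pev big_seq1 big_nil oner_neq0|by vm_compute].
exact: vanish_nil.
Qed.

Lemma mult13_3 : lies 13 base13 (nil_gens 13 13) a (b ^^ 4 ** var 13 3).
Proof.
exists (hexp [:: 0x3; 0x122; 0x346; 0x2445; 0x4566; 0x5555; 0x11136; 0x13456; 0x14445;
0x23444; 0x34466; 0x34555; 0x44446]%num);
  first by vm_compute.
exists [:: (0x103, [:: 0x166]); (0x105, [:: 0x35]); (0x106, [:: 0x556]); (0x112,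
  [:: 0x25; 0x145]); (0x113, [:: 0x23]); (0x114, [:: 0x123]); (0x115, [::
  0x566]); (0x116, [:: 0x45; 0x255]); (0x254, [:: 0]); (0x3264, [:: 0x12]);
  (0x3324, [:: 0x3]); (0x3526, [:: 0x22]); (0x3614, [:: 0x2]); (0x44252, [::
  0x1]); (0x44412, [:: 0x5])]%num.
by vm_compute.
Qed.

Lemma mult13_2 : lies 13 base13 (nil_gens 13 13) a (b ^^ 4 ** var 13 2).
Proof.
exists (hexp [:: 0x2; 0x335; 0x1111]%num);
  first by vm_compute.
exists [:: (0x214, [:: 0])]%num.
by vm_compute.
Qed.

Lemma mult13_6 : lies 13 base13 (nil_gens 13 13) a (b ^^ 4 ** var 13 6).
Proof.
exists (hexp [:: 0x13; 0x236; 0x244; 0x1122; 0x3333; 0x12445; 0x22344; 0x23555;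
0x33445]%num);
  first by vm_compute.
exists [:: (0x103, [:: 0x3; 0x122]); (0x106, [:: 0x122]); (0x111, [:: 0x224]);
  (0x116, [:: 0x4]); (0x3214, [:: 0x4]); (0x3564, [:: 0]); (0x41232, [::
  0x5]); (0x44655, [:: 0]); (0x46252, [:: 0x1])]%num.
by vm_compute.
Qed.

Lemma mult13_1 : lies 13 base13 (nil_gens 13 13) a (b ^^ 4 ** var 13 1).
Proof.
exists (hexp [:: 0x115; 0x123; 0x455; 0x1134; 0x11116; 0x11222; 0x11456; 0x12346;
0x12444; 0x14466; 0x14555; 0x33346; 0x33444]%num);
  first by vm_compute.
exists [:: (0x103, [:: 0x46]); (0x105, [:: 0x15]); (0x111, [:: 0x45; 0x255]);
  (0x112, [:: 0x556]); (0x115, [:: 0x55]); (0x224, [:: 0x55]); (0x3264, [::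
  0x6]); (0x3532, [:: 0x2]); (0x3561, [:: 0x5]); (0x3614, [:: 0x3]); (0x42355,
  [:: 0x2]); (0x44236, [:: 0]); (0x44252, [:: 0x44]); (0x44255, [:: 0x4]);
  (0x44425, [:: 0x22])]%num.
by vm_compute.
Qed.

Lemma mult13_4 : lies 13 base13 (nil_gens 13 13) a (b ^^ 4 ** var 13 4).
Proof.
exists (hexp [:: 0x4; 0x145; 0x446; 0x1126; 0x1255; 0x1336; 0x11123; 0x11333; 0x11455;
0x12224; 0x14456; 0x23446; 0x24444; 0x34666; 0x44555]%num);
  first by vm_compute.
exists [:: (0x106, [:: 0x45]); (0x111, [:: 0x2]); (0x116, [:: 0x56]); (0x224, [::
  0]); (0x3264, [:: 0x5]); (0x3521, [:: 0x5]); (0x41165, [:: 0x44]); (0x42355,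
  [:: 0x44]); (0x44151, [:: 0x66]); (0x44156, [:: 0x11]); (0x44352, [::
  0x55]); (0x44355, [:: 0x22])]%num.
by vm_compute.
Qed.

Lemma mult13 : mult_certs 13 13 base13.
Proof.
case=> [//|[|[|[|[|[|[|k]]]]]]] // _ _.
- exact: mult13_1.
- exact: mult13_2.
- exact: mult13_3.
- exact: mult13_4.
(* Since 8 = -5 modulo 13, the variable of index 5 is a itself. *)
- by exists (b ^^ 4); [vm_compute|exists [::]; vm_compute].
- exact: mult13_6.
Qed.

Lemma t1_13 : lies 13 base13 (nil_gens 13 13) a (y1 ^^ 2 ** y3 ** y7).
Proof.
exists (hexp [:: 0x3; 0x56; 0x122; 0x233; 0x346; 0x1166; 0x2445; 0x5555; 0x11144;
0x34555; 0x44446]%num);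
  first by vm_compute.
exists [:: (0x106, [:: 0x35; 0x124]); (0x111, [:: 0x236; 0x555]); (0x115, [::
  0x44]); (0x116, [:: 0x45]); (0x252, [:: 0x56]); (0x254, [:: 0]); (0x256, [::
  0x55]); (0x3526, [:: 0x22]); (0x3534, [:: 0x25]); (0x3564, [:: 0x5]);
  (0x3614, [:: 0x14]); (0x44252, [:: 0x1]); (0x44355, [:: 0x1]); (0x44416, [::
  0]); (0x44465, [:: 0x2]); (0x46255, [:: 0x6])]%num.
by vm_compute.
Qed.

Lemma t5_13 : lies 13 base13 (nil_gens 13 13) a (y1 ** y3 ** y5 ^^ 2).
Proof.
exists (hexp [:: 0x135]%num);
  first by vm_compute.
exists [::].
by vm_compute.
Qed.

Lemma t2_13 : lies 13 base13 (nil_gens 13 13) a (y1 ** c ** b ** d).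
Proof.
exists (hexp [:: 0x2344; 0x3466; 0x11125; 0x12455; 0x13346]%num);
  first by vm_compute.
exists [:: (0x111, [:: 0x24]); (0x112, [:: 0x46]); (0x3534, [:: 0]); (0x41352, [::
  0x33]); (0x41353, [:: 0x22]); (0x42353, [:: 0x11]); (0x44425, [:: 0])]%num.
by vm_compute.
Qed.

Lemma sigma_13 : lies 13 base13 (nil_gens 13 13) a ((y1 ** c ** y5) ^^ 2).
Proof.
exists (hexp [:: 0x11225]%num);
  first by vm_compute.
exists [::].
by vm_compute.
Qed.

Lemma delta_13 : lies 13 base13 (nil_gens 13 13) (a ^^ 2) (o ** (c ** b ** d)).
Proof.
exists (hexp [:: 0x12; 0x226; 0x3346; 0x3444; 0x11111; 0x11234; 0x13334; 0x14455;
0x22244; 0x23445]%num);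
  first by vm_compute.
exists [:: (0x105, [:: 0x25; 0x145]); (0x112, [:: 0x55]); (0x115, [:: 0x115]);
  (0x214, [:: 0x46]); (0x3521, [:: 0x15]); (0x3526, [:: 0x25]); (0x41135, [::
  0x3]); (0x41235, [:: 0x4]); (0x44161, [:: 0x5])]%num.
by vm_compute.
Qed.

Lemma nu_13 : lies 13 base13 (nil_gens 13 13) (a ^^ 2) ((c ** d) ^^ 3 ++ a ** b ^^ 3 ** c ^^
  2).
Proof.
exists (hexp [:: 0x1125; 0x3346]%num);
  first by vm_compute.
exists [:: (0x3314, [:: 0x4]); (0x3324, [:: 0x2])]%num.
by vm_compute.
Qed.

Lemma zeta_13 : lies 13 base13 (nil_gens 13 13) (a ^^ 3) ((c ** d) ^^ 2 ** E ** b).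
Proof.
exists (hexp [:: 0x13; 0x236; 0x1122; 0x3333; 0x12445; 0x22344; 0x23555; 0x111144;
0x114445; 0x123444; 0x144446; 0x333444]%num);
  first by vm_compute.
exists [:: (0x103, [:: 0x225]); (0x105, [:: 0x66; 0x24; 0x225]); (0x106, [:: 0x66;
  0x24]); (0x111, [:: 0x3]); (0x112, [:: 0x11]); (0x113, [:: 0x5]); (0x114,
  [:: 0; 0x23; 0x15]); (0x115, [:: 0x33]); (0x116, [:: 0x26]); (0x214, [::
  0x2]); (0x221, [:: 0x4555]); (0x226, [:: 0x111]); (0x231, [:: 0x44; 0x566;
  0x2255]); (0x232, [:: 0x5556; 0x22456]); (0x234, [:: 0x266; 0x224; 0x1466;
  0x1156; 0x4556; 0x1555; 0x22446]); (0x251, [:: 0x144; 0x225; 0x355; 0x2234;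
  0x3345]); (0x252, [:: 0x334]); (0x253, [:: 0x26; 0x2244]); (0x254, [::
  0x116; 0x222; 0x1224; 0x3366; 0x2334]); (0x256, [:: 0x6; 0x1444; 0x1122;
  0x3333]); (0x3264, [:: 0x2]); (0x3314, [:: 0x66; 0x24]); (0x3321, [:: 0x4;
  0x25; 0x446]); (0x3326, [:: 0x566]); (0x3361, [:: 0x114]); (0x3364, [::
  0x6]); (0x3514, [:: 0x35]); (0x3521, [:: 0x2; 0x14; 0x666; 0x1366; 0x1145;
  0x4455]); (0x3524, [:: 0x346; 0x135]); (0x3526, [:: 0x66; 0x24; 0x225;
  0x355; 0x4666; 0x2366; 0x1133; 0x1245; 0x3345]); (0x3531, [:: 0x466; 0x244;
  0x555; 0x1444; 0x3333; 0x1135; 0x3455]); (0x3532, [:: 0x16; 0x266; 0x224;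
  0x113; 0x345; 0x1466; 0x3344; 0x3336]); (0x3534, [:: 0x255; 0x2266; 0x2224;
  0x4456; 0x1455]); (0x3536, [:: 0; 0x46; 0x23; 0x15; 0x4466; 0x2444;
  0x1155]); (0x3561, [:: 0x36; 0x1445; 0x3555]); (0x3564, [:: 0x55; 0x224;
  0x113; 0x345; 0x4556]); (0x3614, [:: 0x25]); (0x44355, [:: 0]); (0x46252,
  [:: 0x5])]%num.
by vm_compute.
Qed.

Lemma H2_13 : exists cert, check 13 base13
  ((y1 ^^ 2 ** y3 ** y7 ++ c ^^ 2 ** b ** d ++ y1 ** y3 ** y5 ^^ 2) ^^ 2
   ++ a ** b ** c ** d ++ ((c ** d) ^^ 3 ++ a ** b ^^ 3 ** c ^^ 2)) cert.
Proof.
exists [:: (0x221, [:: 0x5555]); (0x251, [:: 0x4; 0x2222]); (0x252, [:: 0x1111]);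
  (0x44622, [:: 0])]%num.
by vm_compute.
Qed.

Definition kap_13 : pol :=
  hexp [:: 0x156; 0x1233; 0x1346; 0x3333; 0x11166; 0x11334; 0x23555;
  0x33445]%num.

Lemma kap_13_quo : exists cert, check 13 base13 ((a ^^ 2) ** kap_13 ++ o ** b ^^ 3) cert.
Proof.
exists [:: (0x103, [:: 0x35]); (0x106, [:: 0x22; 0x35]); (0x112, [:: 0x25]);
  (0x113, [:: 0x23]); (0x224, [:: 0x44]); (0x251, [:: 0x35]); (0x3214, [::
  0x11]); (0x3314, [:: 0x22]); (0x3321, [:: 0x2]); (0x3364, [:: 0x55]);
  (0x3532, [:: 0x5])]%num.
by vm_compute.
Qed.

(** The quotient o^2 b^2/a^3, obtained from o times [kap_13] by dividing by ab. A further factor o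
    b^2/a^2 gives o^3 b^4/a^5 in [g_13]. *)
Definition tau_13 : pol :=
  hexp [:: 0x136; 0x144; 0x1112; 0x2234; 0x3345; 0x4666; 0x11356; 0x11445;
  0x13555; 0x14446; 0x33336; 0x33344; 0x44455; 0x223446; 0x446666; 0x1144456;
  0x1244444; 0x1444466; 0x1444555; 0x4444556]%num.

Lemma tau_13_quo : exists cert, check 13 base13 ((a ** b) ** tau_13 ++ o ** kap_13) cert.
Proof.
exists [:: (0x103, [:: 0x56]); (0x105, [:: 0x56; 0x233]); (0x106, [:: 0x3]);
  (0x112, [:: 0x14]); (0x115, [:: 0x66]); (0x221, [:: 0x255]); (0x224, [::
  0x1245]); (0x226, [:: 0x114; 0x2455]); (0x232, [:: 0x56; 0x1166; 0x1556]);
  (0x234, [:: 0x46; 0x1456; 0x1155; 0x4555]); (0x236, [:: 0x55; 0x224]);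
  (0x251, [:: 0x346; 0x5555]); (0x252, [:: 0x6; 0x13; 0x236; 0x3333; 0x3455]);
  (0x253, [:: 0x4; 0x366; 0x2222]); (0x254, [:: 0x146; 0x333; 0x115; 0x1134;
  0x2236; 0x3445; 0x2555]); (0x256, [:: 0x5; 0x155; 0x4444; 0x1224; 0x1345]);
  (0x264, [:: 0x122]); (0x3214, [:: 0x25]); (0x3264, [:: 0x44; 0x245]);
  (0x3321, [:: 0x12; 0x114]); (0x3324, [:: 0x466; 0x156]); (0x3361, [:: 0x66;
  0x24; 0x144]); (0x3364, [:: 0x5; 0x222]); (0x3514, [:: 0x555]); (0x3521, [::
  0x44; 0x36; 0x2255]); (0x3524, [:: 0x16; 0x1466; 0x3336]); (0x3526, [::
  0x56]); (0x3531, [:: 0x34; 0x116; 0x456; 0x3446; 0x3366; 0x2556]); (0x3532,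
  [:: 0; 0x23; 0x4466; 0x2233; 0x3335; 0x1155]); (0x3534, [:: 0x2; 0x3334;
  0x3556]); (0x3536, [:: 0x45; 0x2266]); (0x3561, [:: 0x35; 0x166; 0x556]);
  (0x3564, [:: 0x15; 0x134]); (0x41235, [:: 0x3]); (0x41655, [:: 0x2]);
  (0x42355, [:: 0; 0x46]); (0x44255, [:: 0x5])]%num.
by vm_compute.
Qed.

Lemma g_13 : lies 13 base13 (nil_gens 13 13) (a ^^ 2) (o ** b ^^ 2 ** tau_13).
Proof.
exists (hexp [:: 0x146; 0x333; 0x1134; 0x1256; 0x2466; 0x2555; 0x11222; 0x14466;
0x23455; 0x33346; 0x224446; 0x1244446; 0x1444666; 0x2444455; 0x3444444;
0x23444445; 0x111344444; 0x122444444; 0x124444466; 0x233444444; 0x1144444466;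
0x1334444444; 0x2444444445; 0x4444444566; 0x11144444444; 0x12244444446;
0x14444444445; 0x22444444455; 0x23444444444; 0x44444444446]%num);
  first by vm_compute.
exists [:: (0x103, [:: 0x11466; 0x222256; 0x125556; 0x1233344; 0x1114566;
  0x1234556; 0x22333366; 0x22234455; 0x111112234; 0x222334445; 0x144455666;
  0x123455555]); (0x105, [:: 0x1223355; 0x12224444; 0x22334444; 0x11333346;
  0x11233333; 0x11125566; 0x112333356; 0x124444556; 0x334444556]); (0x106, [::
  0x22335; 0x224455; 0x33344445; 0x22345566; 0x144444444; 0x244444566;
  0x224555666]); (0x111, [:: 0x2466; 0x111266; 0x112334; 0x1225566; 0x2344556;
  0x11144445; 0x122444444; 0x112246666; 0x333346666]); (0x112, [:: 0x113346;
  0x1444466; 0x11444444; 0x22444446; 0x22245566; 0x133444445; 0x122355666]);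
  (0x113, [:: 0x22444; 0x122556; 0x1222335; 0x12334666; 0x12233366;
  0x22333334; 0x22234566; 0x34455666; 0x112222456; 0x123456666; 0x223334445;
  0x222244556]); (0x114, [:: 0x1246; 0x11244566; 0x12234555; 0x111112233;
  0x113333566; 0x112245566; 0x333444556]); (0x115, [:: 0x123346; 0x1112366;
  0x1333334; 0x1244456; 0x2222355; 0x11113466; 0x11335666; 0x122222344;
  0x111333566; 0x133345566]); (0x116, [:: 0x11246; 0x1233346; 0x1155566;
  0x11123446; 0x22222456; 0x33344456; 0x11233556; 0x112334445; 0x444444455;
  0x344444556; 0x134444555; 0x113345555]); (0x214, [:: 0x2334466; 0x1144455;
  0x2244556; 0x34566666; 0x34444455; 0x22555666]); (0x221, [:: 0x33346666;
  0x23334555]); (0x224, [:: 0x14566; 0x33445; 0x1334455; 0x22233566;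
  0x44444556]); (0x226, [:: 0x2333366; 0x22334445; 0x11345556]); (0x231, [::
  0x1112666; 0x11222466; 0x13334566; 0x12333356]); (0x232, [:: 0x456; 0x235;
  0x12225; 0x144445; 0x3344455; 0x12235556]); (0x234, [:: 0x1222366;
  0x1223345; 0x1114555; 0x11122445; 0x12225666; 0x13345556]); (0x236, [::
  0x22566; 0x122226; 0x1133355]); (0x251, [:: 0x1345; 0x11224456]); (0x252,
  [:: 0x2444; 0x1155; 0x144566; 0x124445; 0x22244556; 0x22334555]); (0x253,
  [:: 0x122466; 0x12244666; 0x23344666]); (0x254, [:: 0x2; 0x12456; 0x112266;
  0x333446; 0x12223334]); (0x256, [:: 0x1455; 0x113666; 0x222234;
  0x11233335]); (0x261, [:: 0x1244444; 0x2333336; 0x1345556]); (0x264, [::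
  0x456; 0x235; 0x4444; 0x11466; 0x344466; 0x222256; 0x1233344; 0x2223335;
  0x3555566]); (0x3214, [:: 0x36; 0x3555; 0x3566666; 0x2234456]); (0x3261, [::
  0x124444; 0x1112244; 0x11244445]); (0x3264, [:: 0x122256; 0x113345;
  0x1666666; 0x1335666; 0x24445555]); (0x3314, [:: 0x233446; 0x113333;
  0x112566; 0x556666; 0x1111334; 0x11112246; 0x11123346; 0x11134555]);
  (0x3321, [:: 0x3456; 0x122235; 0x3334666; 0x1115566; 0x12333344;
  0x11333356]); (0x3324, [:: 0x15; 0x122223; 0x113344; 0x123456; 0x2222236;
  0x1223334; 0x1134456; 0x2223356; 0x3444556; 0x1344555; 0x12222233;
  0x11233344; 0x11133445; 0x13334556; 0x22334555]); (0x3326, [:: 0x344444;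
  0x333466; 0x222456; 0x1233333; 0x2344445; 0x1444455; 0x12223336; 0x22333336;
  0x12255666]); (0x3361, [:: 0x244; 0x1346; 0x23466; 0x33356; 0x333346;
  0x1333556; 0x11246666; 0x11133344; 0x11234445; 0x12235566; 0x14444555]);
  (0x3364, [:: 0x111456; 0x1222344; 0x3336666; 0x2233336; 0x1111345;
  0x1334566; 0x1134455; 0x12344556]); (0x3514, [:: 0; 0x2244456; 0x2234566;
  0x22444444; 0x11123466; 0x22334466]); (0x3521, [:: 0x11144; 0x13456;
  0x25566; 0x333334; 0x223445; 0x1223666; 0x12222356; 0x13333345; 0x13556666;
  0x11455566]); (0x3524, [:: 0x13666; 0x114444; 0x1444666; 0x2222266;
  0x2224456; 0x1145555; 0x22444466; 0x11344466; 0x12222236; 0x11223334;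
  0x22222355]); (0x3526, [:: 0x133566; 0x223556; 0x3333344; 0x1112445;
  0x1244455; 0x12224444; 0x11333444]); (0x3531, [:: 0x45; 0x44444; 0x112346;
  0x1133334; 0x13444444; 0x11113344; 0x13344446; 0x11233666; 0x14445566]);
  (0x3532, [:: 0x224445; 0x2444446; 0x11134455; 0x34444556; 0x11223555]);
  (0x3534, [:: 0x2234; 0x12344; 0x11445; 0x25666; 0x344445; 0x11122233;
  0x13333444; 0x33345666; 0x23333566; 0x12333455; 0x33445555]); (0x3536, [::
  0x356; 0x124466; 0x1133345; 0x12234466; 0x12233666; 0x11333336;
  0x12355566]); (0x3561, [:: 0x1112335; 0x1444455; 0x11134444; 0x11234566]);
  (0x3564, [:: 0x25; 0x145; 0x1126; 0x23446; 0x222335; 0x1444566; 0x2333345;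
  0x14556666]); (0x3614, [:: 0x33366; 0x111445; 0x134556; 0x1122266;
  0x3556666; 0x2233556; 0x12244566]); (0x41123, [:: 0x33446]); (0x41125, [::
  0x112233; 0x122245]); (0x41135, [:: 0x11366; 0x223333]); (0x41162, [::
  0x15566; 0x223344; 0x255666; 0x1344446]); (0x41163, [:: 0x25566; 0x124455]);
  (0x41232, [:: 0x234456; 0x1133556]); (0x41233, [:: 0x112235]); (0x41236, [::
  0x1114466]); (0x41252, [:: 0x11144; 0x12335; 0x1111445; 0x1125666]);
  (0x41253, [:: 0x111346; 0x223556]); (0x41255, [:: 0x114455; 0x1146666;
  0x1233444; 0x1223455]); (0x41256, [:: 0x3444445; 0x1113345; 0x1334455]);
  (0x41352, [:: 0x5; 0x4444; 0x2223666; 0x3334556; 0x2345555]); (0x41353, [::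
  0x133346]); (0x41355, [:: 0x135; 0x123334; 0x113345; 0x2334466; 0x1333355;
  0x4444555]); (0x41356, [:: 0x2346; 0x111244; 0x223444; 0x2333334]);
  (0x41622, [:: 0x2233; 0x13366; 0x124445; 0x333456; 0x1122234; 0x1223556]);
  (0x41623, [:: 0x44555; 0x112236; 0x235666; 0x1233566; 0x4445556]); (0x41625,
  [:: 0x224456; 0x3444445; 0x2444555]); (0x41626, [:: 0x3356; 0x3334466;
  0x2444455]); (0x41632, [:: 0x112555; 0x1133346; 0x2223556]); (0x41633, [::
  0x122244; 0x233466]); (0x41635, [:: 0x46; 0x223346; 0x1233366]); (0x41636,
  [:: 0x444556; 0x1112466; 0x1235666; 0x2333456; 0x2222455]); (0x41652, [::
  0x3333; 0x11556]); (0x41653, [:: 0x123456; 0x1124666; 0x1233366;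
  0x1344555]); (0x41655, [:: 0x13466; 0x113346; 0x1336666]); (0x41656, [::
  0x11346; 0x122344; 0x2233345]); (0x42235, [:: 0x11246; 0x24456]); (0x42353,
  [:: 0x2226; 0x133446]); (0x44122, [:: 0x115; 0x222336; 0x156666; 0x1444666;
  0x2335566]); (0x44123, [:: 0x1145; 0x133345; 0x1134446; 0x2445556]);
  (0x44125, [:: 0x3336; 0x12566; 0x13455; 0x111166; 0x112356; 0x2344445]);
  (0x44126, [:: 0x12244; 0x11256; 0x1344456; 0x4556666]); (0x44131, [::
  0x1333334; 0x2333445; 0x1333556]); (0x44132, [:: 0x23666; 0x333366;
  0x222356; 0x1333336]); (0x44133, [:: 0x22456; 0x244466; 0x1123445]);
  (0x44135, [:: 0x13335; 0x1123456]); (0x44136, [:: 0x111126; 0x244556;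
  0x1123446]); (0x44151, [:: 0x335; 0x4455; 0x22233; 0x134666; 0x1222223;
  0x1333336; 0x1224445]); (0x44152, [:: 0x136666]); (0x44155, [:: 0x1111223]);
  (0x44156, [:: 0x155; 0x22666; 0x44566; 0x223334; 0x123345; 0x2223666]);
  (0x44161, [:: 0x222444; 0x2345566]); (0x44162, [:: 0x13356; 0x112444;
  0x222366; 0x223345; 0x2223355]); (0x44163, [:: 0x2223466]); (0x44165, [::
  0x444446; 0x1112445; 0x2233456; 0x1355666]); (0x44166, [:: 0x234; 0x44466;
  0x11333; 0x13566; 0x1112444; 0x1122245; 0x3334456]); (0x44231, [::
  0x1123336; 0x2234555]); (0x44232, [:: 0x2355; 0x33566; 0x13455; 0x122336]);
  (0x44233, [:: 0x2466; 0x2333444; 0x1222455; 0x1234555]); (0x44235, [::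
  0x1113444; 0x1145666; 0x1233345; 0x2345566; 0x1244555]); (0x44236, [::
  0x11555; 0x111444; 0x222256; 0x1122336]); (0x44251, [:: 0x1223566]);
  (0x44252, [:: 0x11446; 0x11366; 0x134445; 0x2233445]); (0x44253, [::
  0x11245; 0x24455; 0x4455666]); (0x44255, [:: 0x1146; 0x33466; 0x133444;
  0x1334566]); (0x44256, [:: 0x333445; 0x1134445; 0x2223345; 0x1124555]);
  (0x44351, [:: 0x23455; 0x112556]); (0x44352, [:: 0x35; 0x22256; 0x224466;
  0x1234666; 0x2222356; 0x1334456]); (0x44353, [:: 0x1222266; 0x1222224;
  0x2223366; 0x1335566]); (0x44355, [:: 0x445; 0x3334455]); (0x44356, [::
  0x112366]); (0x44412, [:: 0x1112346; 0x1222366; 0x3344445; 0x2335556]);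
  (0x44413, [:: 0x15566; 0x224556]); (0x44415, [:: 0x1235; 0x114556;
  0x2334455]); (0x44416, [:: 0x3334; 0x34445; 0x256666; 0x1112244; 0x1112236;
  0x1334556; 0x1245555]); (0x44423, [:: 0x256; 0x14444; 0x111244; 0x244446;
  0x445556]); (0x44425, [:: 0x115566]); (0x44435, [:: 0x3455; 0x566666;
  0x111225; 0x133335; 0x4446666; 0x2234446]); (0x44462, [:: 0x2355; 0x44445;
  0x23345; 0x133356]); (0x44463, [:: 0x122445; 0x222255]); (0x44621, [::
  0x23336; 0x233566; 0x1245556]); (0x44622, [:: 0x114666; 0x445666;
  0x223356]); (0x44623, [:: 0x1266; 0x245566]); (0x44625, [:: 0x234446;
  0x1134445; 0x2233566]); (0x44626, [:: 0x12226; 0x45556]); (0x44631, [::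
  0x22244; 0x11145; 0x235566]); (0x44632, [:: 0x333345; 0x1222456]); (0x44633,
  [:: 0x22355; 0x1223466]); (0x44635, [:: 0x13456; 0x3346666]); (0x44636, [::
  0x124445; 0x2235555]); (0x44651, [:: 0x122446; 0x223334; 0x1222456;
  0x1222235]); (0x44652, [:: 0x111446]); (0x44653, [:: 0x123334; 0x223445;
  0x1111226; 0x1133344]); (0x44655, [:: 0x2233366; 0x2224455]); (0x44656, [::
  0x233345; 0x2222335; 0x1114455; 0x2233355; 0x1345556]); (0x46232, [::
  0x233333; 0x444455; 0x1114666; 0x1244456; 0x1333556; 0x2444555]); (0x46233,
  [:: 0x56666; 0x111236; 0x234555; 0x1166666; 0x2445666; 0x1224455]);
  (0x46235, [:: 0x123566; 0x233345; 0x3445566]); (0x46252, [:: 0x123446;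
  0x256666; 0x1144444; 0x4444445]); (0x46253, [:: 0x224444; 0x113444;
  0x1222355]); (0x46352, [:: 0x34556; 0x122345; 0x1123356]); (0x46353, [::
  0x2566; 0x223566; 0x1123334; 0x3344456; 0x1334455]); (0x46623, [:: 0x13455;
  0x133356; 0x1222345]); (0x46625, [:: 0x1335; 0x11366; 0x222245; 0x1113566;
  0x1112345]); (0x46635, [:: 0x45566; 0x444456; 0x1111246; 0x3344466])]%num.
by vm_compute.
Qed.

(** Used for p_{4,1}(b^2/a) = (cd/a)^4 o, again with the factor b taken from (cd)^2/a. *)
Lemma x1_13 : lies 13 base13 (nil_gens 13 13) (a ^^ 3) (o ** (c ** d) ^^ 2 ** b).
Proof.
exists (hexp [:: 0x136; 0x2366; 0x2446; 0x11445; 0x13466; 0x13555; 0x14446; 0x22456;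
0x33336; 0x223446; 0x224444; 0x244466; 0x244555; 0x344445]%num);
  first by vm_compute.
exists [:: (0x103, [:: 0x3556]); (0x105, [:: 0x22444; 0x11255]); (0x106, [::
  0x3334; 0x1145; 0x34445; 0x11255]); (0x111, [:: 0x11246; 0x13444; 0x23566]);
  (0x112, [:: 0x11236; 0x44566; 0x35666; 0x33355]); (0x113, [:: 0x5555;
  0x22455; 0x34555]); (0x114, [:: 0x1135; 0x12356; 0x15555]); (0x115, [::
  0x1455; 0x12466]); (0x116, [:: 0x11346; 0x34456]); (0x214, [:: 0x3445;
  0x2555]); (0x221, [:: 0x236; 0x3455]); (0x231, [:: 0x1255]); (0x232, [::
  0x223; 0x1145]); (0x234, [:: 0x1355]); (0x251, [:: 0x1446; 0x3556]); (0x252,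
  [:: 0x5566]); (0x253, [:: 0x1156; 0x2355; 0x1555]); (0x254, [:: 0x56]);
  (0x256, [:: 0x136]); (0x3214, [:: 0x345]); (0x3261, [:: 0x346; 0x5555]);
  (0x3264, [:: 0x3445]); (0x3314, [:: 0x246; 0x4455]); (0x3321, [:: 0x1222;
  0x2233]); (0x3324, [:: 0x356]); (0x3326, [:: 0x234; 0x1336]); (0x3361, [::
  0x45; 0x255; 0x2224]); (0x3514, [:: 0x356; 0x3444]); (0x3521, [:: 0x3356]);
  (0x3524, [:: 0x245]); (0x3526, [:: 0x1145]); (0x3531, [:: 0x144; 0x1133]);
  (0x3532, [:: 0x166; 0x334]); (0x3534, [:: 0x5]); (0x3536, [:: 0x13; 0x466;
  0x1122; 0x1346; 0x1135]); (0x3561, [:: 0x1126; 0x1255]); (0x3564, [:: 0x556;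
  0x1225]); (0x3614, [:: 0x46; 0x1456; 0x1235; 0x1155])]%num.
by vm_compute.
Qed.

End Certificates13.

(** * Relations and quotients for l = 15 *)

Section Certificates15.
Local Notation a := (var 15 8).
Local Notation b := (var 15 4).
Local Notation c := (var 15 2).
Local Notation d := (var 15 6).
Local Notation y1 := (var 15 1).
Local Notation y3 := (var 15 3).
Local Notation y5 := (var 15 5).
Local Notation y7 := (var 15 7).
Local Notation o := (a ++ b ^^ 4).
Local Notation oc := (c ++ y1 ^^ 4).
Local Notation E := (a ** c ^^ 4 ++ b ^^ 5).

Definition base15_0 : pol :=
  hexp [:: 0x27; 0x116; 0x146; 0x235; 0x357; 0x446]%num.
Definition base15_1 : pol :=
  hexp [:: 0x6; 0x117; 0x155; 0x244; 0x366; 0x455]%num.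
Definition base15_2 : pol :=
  hexp [:: 0x15; 0x45; 0x126; 0x134; 0x467; 0x556]%num.
Definition base15_3 : pol :=
  hexp [:: 0x33; 0x114; 0x144; 0x225; 0x577; 0x666]%num.
Definition base15_4 : pol :=
  hexp [:: 0x5; 0x34; 0x67; 0x356; 0x1127; 0x1177; 0x1247; 0x1255; 0x1477;
  0x3346; 0x3667; 0x4477; 0x4557; 0x5555]%num.
Definition base15_5 : pol :=
  hexp [:: 0x5; 0x34; 0x67; 0x1127; 0x1177; 0x1336; 0x1477; 0x1557; 0x2366;
  0x2455; 0x4477; 0x5555]%num.
Definition base15_6 : pol :=
  hexp [:: 0x166; 0x466; 0x1277; 0x2247; 0x2255; 0x2336; 0x2557; 0x3367;
  0x5577; 0x5666]%num.
Definition base15_7 : pol :=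
  hexp [:: 0x136; 0x266; 0x346; 0x667; 0x1245; 0x1457; 0x2227; 0x2277; 0x2777;
  0x3566]%num.
Definition base15 : seq pol := [:: base15_0; base15_1; base15_2; base15_3; base15_4; base15_5;
  base15_6; base15_7].

(** Here each relation is certified only after multiplication by a nonzero [minor] or by X_3. The
    list is peeled from its end, so the certificate of a relation uses only the base relations that
    precede it. *)
Lemma base15_vanish : vanish_on 15 base15.
Proof.
rewrite (_ : base15 = (rcons (rcons (rcons (rcons (rcons (rcons (rcons (rcons [::] base15_0)
  base15_1) base15_2) base15_3) base15_4) base15_5) base15_6) base15_7)) //.
apply: (@vanish_rcons 15 isT (rcons (rcons (rcons (rcons (rcons (rcons (rcons [::] base15_0)
  base15_1) base15_2) base15_3) base15_4) base15_5) base15_6) (minor 15 3 6) base15_7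
  [:: (0x101, [:: 0x3677; 0x2367; 0x2236]); (0x102, [:: 0x3567; 0x2356;
  0x23667]); (0x111, [:: 0x33566]); (0x122, [:: 0x34566; 0x13566]); (0x141,
  [:: 0x366]); (0x144, [:: 0x366])]%num);
  [|by move=> u ul; exact: minor_neq0|by vm_compute].
apply: (@vanish_rcons 15 isT (rcons (rcons (rcons (rcons (rcons (rcons [::] base15_0)
  base15_1) base15_2) base15_3) base15_4) base15_5) (minor 15 3 6) base15_6
  [:: (0x101, [:: 0x3556; 0x2346; 0x1367; 0x35667; 0x23566]); (0x102, [::
  0x35566; 0x34667; 0x12366]); (0x111, [:: 0x3466; 0x1366; 0x35666]); (0x112,
  [:: 0x33667; 0x23366]); (0x122, [:: 0x3567; 0x2356])]%num);
  [|by move=> u ul; exact: minor_neq0|by vm_compute].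
apply: (@vanish_rcons 15 isT (rcons (rcons (rcons (rcons (rcons [::] base15_0) base15_1)
  base15_2) base15_3) base15_4) (minor 15 3 6) base15_5
  [:: (0x101, [:: 0x1346; 0x34566; 0x13566]); (0x102, [:: 0x34466; 0x13466;
  0x11366]); (0x112, [:: 0x3566]); (0x121, [:: 0x3567; 0x2356]); (0x141, [::
  0x36]); (0x144, [:: 0x3366])]%num);
  [|by move=> u ul; exact: minor_neq0|by vm_compute].
apply: (@vanish_rcons 15 isT (rcons (rcons (rcons (rcons [::] base15_0) base15_1) base15_2)
  base15_3) [:: [:: 3]]%N base15_4
  [:: (0x112, [:: 0x5; 0x67; 0x34]); (0x121, [:: 0x77]); (0x122, [:: 0x55;
  0x17; 0x12])]%num);
  [|by move=> u ul; by rewrite pev_var; apply: theta_at_neq0|by vm_compute].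
apply: (@vanish_rcons 15 isT (rcons (rcons (rcons [::] base15_0) base15_1) base15_2) (minor 15
  5 3) base15_3
  [:: (0x235, [:: 0x5]); (0x267, [:: 0x1]); (0x45412, [:: 0x3]); (0x46313, [::
  0x6]); (0x46321, [:: 0x1]); (0x46513, [:: 0x7]); (0x46531, [:: 0x2]);
  (0x46543, [:: 0x2]); (0x46652, [:: 0x2]); (0x47214, [:: 0x6]); (0x47313, [::
  0x5]); (0x47326, [:: 0x5]); (0x47424, [:: 0x6]); (0x47525, [:: 0]);
  (0x47631, [:: 0x4]); (0x47634, [:: 0x4]); (0x47656, [:: 0x7]); (0x47721, [::
  0])]%num);
  [|by move=> u ul; exact: minor_neq0|by vm_compute].
apply: (@vanish_rcons 15 isT (rcons (rcons [::] base15_0) base15_1) (minor 15 5 3) base15_2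
  [:: (0x212, [:: 0x57]); (0x213, [:: 0x557]); (0x214, [:: 0x45; 0x15; 0x556;
  0x134]); (0x215, [:: 0x17]); (0x217, [:: 0x347]); (0x225, [:: 0x27]);
  (0x234, [:: 0x255]); (0x247, [:: 0x25; 0x234]); (0x45531, [:: 0x7]);
  (0x45543, [:: 0x2]); (0x47434, [:: 0x2]); (0x47764, [:: 0x7])]%num);
  [|by move=> u ul; exact: minor_neq0|by vm_compute].
apply: (@vanish_rcons 15 isT (rcons [::] base15_0) (minor 15 5 3) base15_1
  [:: (0x213, [:: 0x7]); (0x214, [:: 0x6]); (0x216, [:: 0x56]); (0x223, [::
  0x16]); (0x227, [:: 0x66]); (0x234, [:: 0x2; 0x35]); (0x236, [:: 0x57;
  0x25]); (0x256, [:: 0x13]); (0x46311, [:: 0x5]); (0x46434, [:: 0x5]);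
  (0x46533, [:: 0x6]); (0x46641, [:: 0x1]); (0x47316, [:: 0x2]); (0x47533, [::
  0x5]); (0x47616, [:: 0x5]); (0x47751, [:: 0x6])]%num);
  [|by move=> u ul; exact: minor_neq0|by vm_compute].
apply: (@vanish_rcons 15 isT [::] (minor 15 5 3) base15_0
  [:: (0x213, [:: 0x147]); (0x214, [:: 0x27; 0x146]); (0x234, [:: 0x124]);
  (0x45311, [:: 0x7]); (0x45434, [:: 0x2]); (0x46215, [:: 0x2]); (0x46315, [::
  0x3]); (0x46321, [:: 0x6]); (0x46435, [:: 0x3]); (0x46542, [:: 0x7]);
  (0x47516, [:: 0x2]); (0x47643, [:: 0x6]); (0x47654, [:: 0x7])]%num);
  [|by move=> u ul; exact: minor_neq0|by vm_compute].
exact: vanish_nil.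
Qed.

Lemma mult15_1 : lies 15 base15 (nil_gens 15 5) a (b ^^ 4 ** var 15 1).
Proof.
exists (hexp [:: 0x56; 0x266; 0x1245; 0x1457; 0x2333; 0x2445; 0x4555; 0x11123;
0x13455; 0x14677; 0x22446; 0x33335; 0x34447; 0x34455; 0x44677]%num);
  first by vm_compute.
exists [:: (0x101, [:: 0x4556; 0x1134; 0x3577]); (0x107, [:: 0x444; 0x2355; 0x4456;
  0x3557; 0x1377]); (0x111, [:: 0x123; 0x2356; 0x1335]); (0x117, [:: 0x344;
  0x113]); (0x127, [:: 0x447; 0x147; 0x1345; 0x1135; 0x2377]); (0x131, [::
  0x1136]); (0x137, [:: 0x2236]); (0x141, [:: 0x34]); (0x147, [:: 0x67]);
  (0x154, [:: 0x356]); (0x171, [:: 0x236]); (0x253, [:: 0x7]); (0x276, [::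
  0x13]); (0x3623, [:: 0x2]); (0x3753, [:: 0x33]); (0x3754, [:: 0x47]);
  (0x3763, [:: 0x35]); (0x43176, [:: 0x5]); (0x43617, [:: 0x5]); (0x44316, [::
  0x4]); (0x44427, [:: 0]); (0x44575, [:: 0]); (0x45527, [:: 0x3])]%num.
by vm_compute.
Qed.

Lemma mult15_6 : lies 15 base15 (nil_gens 15 5) a (b ^^ 4 ** var 15 6).
Proof.
exists (hexp [:: 0x155; 0x244; 0x366; 0x455; 0x3333]%num);
  first by vm_compute.
exists [:: (0x111, [:: 0x7]); (0x234, [:: 0])]%num.
by vm_compute.
Qed.

Lemma mult15_2 : lies 15 base15 (nil_gens 15 5) a (b ^^ 4 ** var 15 2).
Proof.
exists (hexp [:: 0x2; 0x133; 0x1111; 0x1144; 0x5557; 0x13336; 0x22344; 0x23366;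
0x23455; 0x35555; 0x44456]%num);
  first by vm_compute.
exists [:: (0x101, [:: 0x36; 0x245; 0x2467]); (0x107, [:: 0x112; 0x447]); (0x111,
  [:: 0x223; 0x237]); (0x117, [:: 0x123; 0x677; 0x2356]); (0x121, [:: 0x66;
  0x777; 0x2446; 0x1246; 0x1126]); (0x127, [:: 0x3; 0x177; 0x1446; 0x2567]);
  (0x131, [:: 0x12; 0x47; 0x1236]); (0x137, [:: 0x556]); (0x151, [:: 0x37]);
  (0x167, [:: 0x266]); (0x214, [:: 0]); (0x262, [:: 0x23]); (0x3134, [::
  0x3]); (0x3163, [:: 0x2]); (0x3165, [:: 0]); (0x3253, [:: 0x6]); (0x3654,
  [:: 0x36]); (0x3715, [:: 0x22]); (0x3753, [:: 0x6]); (0x3763, [::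
  0x16])]%num.
by vm_compute.
Qed.

Lemma mult15_3 : lies 15 base15 (nil_gens 15 5) a (b ^^ 4 ** var 15 3).
Proof.
exists (hexp [:: 0x255; 0x336; 0x477; 0x557; 0x1235; 0x1446; 0x3457; 0x3555; 0x11233;
0x13347; 0x23344; 0x33366; 0x33455; 0x34677; 0x44566]%num);
  first by vm_compute.
exists [:: (0x101, [:: 0x567]); (0x107, [:: 0x167]); (0x117, [:: 0x7]); (0x121, [::
  0x237; 0x377]); (0x127, [:: 0x57; 0x677]); (0x131, [:: 0x67]); (0x137, [::
  0x56]); (0x147, [:: 0x33]); (0x157, [:: 0x33]); (0x161, [:: 0]); (0x264, [::
  0]); (0x43351, [:: 0]); (0x43567, [:: 0]); (0x44353, [:: 0])]%num.
by vm_compute.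
Qed.

Lemma mult15_4 : lies 15 base15 (nil_gens 15 5) a (b ^^ 4 ** var 15 4).
Proof.
exists (hexp [:: 0x4; 0x56; 0x136; 0x266; 0x346; 0x1555; 0x2445; 0x3337; 0x3566;
0x4457; 0x4555; 0x11123; 0x11234; 0x13455; 0x22446; 0x23444; 0x33335; 0x33466;
0x44677]%num);
  first by vm_compute.
exists [:: (0x111, [:: 0x57; 0x123; 0x267]); (0x127, [:: 0x124; 0x447; 0x117]);
  (0x137, [:: 0x27]); (0x141, [:: 0x26]); (0x151, [:: 0x26]); (0x167, [::
  0x37]); (0x171, [:: 0x2]); (0x224, [:: 0]); (0x3623, [:: 0x2]); (0x3624, [::
  0x6]); (0x3634, [:: 0x1])]%num.
by vm_compute.
Qed.

Lemma mult15 : mult_certs 15 5 base15.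
Proof.
case=> [//|[|[|[|[|[|[|[|k]]]]]]]] // _ _.
- exact: mult15_1.
- exact: mult15_2.
- exact: mult15_3.
- exact: mult15_4.
- exact: mult15_6.
(* Since 8 = -7 modulo 15, the variable of index 7 is a itself. The index 5 needs no case as e = 5
   excludes it. *)
- by exists (b ^^ 4); [vm_compute|exists [::]; vm_compute].
Qed.

Lemma t1_15 : lies 15 base15 (nil_gens 15 5) a (y1 ^^ 2 ** y3 ** y7).
Proof.
exists (hexp [:: 0x113]%num);
  first by vm_compute.
exists [::].
by vm_compute.
Qed.

Lemma t5_15 : lies 15 base15 (nil_gens 15 5) a (y1 ** y3 ** y5 ^^ 2).
Proof.
exists (hexp [:: 0x113; 0x344; 0x467; 0x2233; 0x3377; 0x3456; 0x5667; 0x13346;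
0x13667; 0x14477; 0x23335; 0x23466; 0x24447; 0x34667; 0x44477; 0x44557;
0x45555]%num);
  first by vm_compute.
exists [:: (0x117, [:: 0x117]); (0x127, [:: 0x1]); (0x131, [:: 0x445]); (0x137, [::
  0x444; 0x257]); (0x142, [:: 0x17]); (0x151, [:: 0x47]); (0x161, [:: 0x44]);
  (0x171, [:: 0x57]); (0x3134, [:: 0x1]); (0x3734, [:: 0x7]); (0x3762, [::
  0x7]); (0x44355, [:: 0]); (0x44432, [:: 0]); (0x44437, [:: 0]); (0x44677,
  [:: 0])]%num.
by vm_compute.
Qed.

Lemma t2_15 : lies 15 base15 (nil_gens 15 5) a (y1 ** c ** b ** d).
Proof.
exists (hexp [:: 0x1337; 0x3347; 0x4566; 0x11112; 0x11124; 0x11244; 0x14447; 0x15777;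
0x33345; 0x34466; 0x45777]%num);
  first by vm_compute.
exists [:: (0x101, [:: 0x2; 0x7; 0x35]); (0x107, [:: 0x5; 0x13]); (0x111, [::
  0x147]); (0x117, [:: 0x257]); (0x121, [:: 0x1; 0x667]); (0x131, [:: 0x127;
  0x477]); (0x137, [:: 0x457]); (0x141, [:: 0x44]); (0x157, [:: 0x44]);
  (0x161, [:: 0x57]); (0x214, [:: 0x2]); (0x3165, [:: 0x7]); (0x3734, [::
  0x4]); (0x43277, [:: 0]); (0x44435, [:: 0])]%num.
by vm_compute.
Qed.

Lemma sigma_15 : lies 15 base15 (nil_gens 15 5) a ((y1 ** c ** y5) ^^ 2).
Proof.
exists (hexp [:: 0x45; 0x113; 0x467; 0x2233; 0x2337; 0x5667; 0x12447; 0x13667;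
0x14477; 0x23335; 0x23466; 0x33446; 0x34667; 0x44557; 0x45555]%num);
  first by vm_compute.
exists [:: (0x111, [:: 0x477]); (0x127, [:: 0x136]); (0x141, [:: 0x12]); (0x144,
  [:: 0x17]); (0x154, [:: 0x47]); (0x157, [:: 0x17]); (0x167, [:: 0x27]);
  (0x275, [:: 0x2]); (0x3123, [:: 0x7]); (0x3134, [:: 0x1]); (0x3715, [:: 0]);
  (0x44677, [:: 0])]%num.
by vm_compute.
Qed.

Lemma delta_15 : lies 15 base15 (nil_gens 15 5) (a ^^ 2) (o ** (c ** b ** d)).
Proof.
exists (hexp [:: 0x46; 0x1112; 0x1366; 0x1447; 0x1455; 0x2444; 0x3335; 0x3466; 0x4455;
0x5777; 0x13333; 0x34777]%num);
  first by vm_compute.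
exists [:: (0x107, [:: 0x2557; 0x3367; 0x5577]); (0x111, [:: 0x247; 0x477; 0x177]);
  (0x127, [:: 0x3337]); (0x131, [:: 0x1467]); (0x151, [:: 0x17]); (0x154, [::
  0x567]); (0x157, [:: 0x567]); (0x167, [:: 0x27]); (0x234, [:: 0x24]);
  (0x275, [:: 0x7]); (0x276, [:: 0x47]); (0x3123, [:: 0x7]); (0x3164, [::
  0x37]); (0x3625, [:: 0x67]); (0x3765, [:: 0x67])]%num.
by vm_compute.
Qed.

Lemma nu_15 : lies 15 base15 (nil_gens 15 5) (a ^^ 2) ((c ** d) ^^ 3 ++ a ** b ^^ 3 ** c ^^ 2).
Proof.
exists (hexp [:: 0x46; 0x233; 0x337; 0x1112; 0x1124; 0x1244; 0x1366; 0x1447; 0x1455;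
0x2444; 0x4455; 0x5777]%num);
  first by vm_compute.
exists [:: (0x107, [:: 0x37]); (0x141, [:: 0x47; 0x17]); (0x157, [:: 0x47]);
  (0x275, [:: 0x7]); (0x3234, [:: 0x2]); (0x3734, [:: 0x7])]%num.
by vm_compute.
Qed.

Lemma zeta_15 : lies 15 base15 (nil_gens 15 5) (a ^^ 3) ((c ** d) ^^ 2 ** E ** b).
Proof.
exists (hexp [:: 0x123; 0x234; 0x347; 0x1335; 0x2356; 0x3567; 0x4466; 0x11445;
0x13334; 0x14777; 0x22447; 0x23346; 0x24557; 0x33344; 0x33467; 0x234555;
0x344444; 0x444467]%num);
  first by vm_compute.
exists [:: (0x101, [:: 0x225; 0x666; 0x144; 0x114; 0x257; 0x2355; 0x3336; 0x2226;
  0x1223; 0x1456; 0x1156; 0x3557; 0x2347; 0x1237; 0x45566]); (0x107, [:: 0x3;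
  0x247; 0x127; 0x477; 0x177; 0x3555; 0x4446; 0x1235; 0x1446; 0x1146; 0x1116;
  0x2567; 0x1357; 0x23556; 0x22346; 0x14566; 0x23467; 0x333333]); (0x111, [::
  0x24; 0x47; 0x256; 0x135; 0x567]); (0x117, [:: 0x44; 0x14; 0x11]); (0x121,
  [:: 0; 0x555]); (0x127, [:: 0x66; 0x445; 0x222; 0x145; 0x115; 0x227;
  0x777]); (0x131, [:: 0x22]); (0x137, [:: 0x25; 0x57; 0x234]); (0x167, [::
  0x4444]); (0x212, [:: 0x455; 0x24667]); (0x213, [:: 0x4; 0x56; 0x266;
  0x2333; 0x2445; 0x3337]); (0x214, [:: 0x33; 0x225; 0x666; 0x577; 0x3557;
  0x24466]); (0x215, [:: 0x66; 0x333; 0x445; 0x222; 0x227; 0x277; 0x2446]);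
  (0x216, [:: 0x23; 0x335; 0x5577]); (0x224, [:: 0x455]); (0x225, [:: 0;
  0x457]); (0x253, [:: 0x5; 0x67]); (0x254, [:: 0x66]); (0x262, [:: 0x4;
  0x56]); (0x263, [:: 0x344; 0x3456; 0x3377]); (0x264, [:: 0x3367; 0x5577;
  0x4777]); (0x265, [:: 0x46; 0x3466]); (0x271, [:: 0x455; 0x155]); (0x272,
  [:: 0x255; 0x557; 0x477; 0x177; 0x4446; 0x1446; 0x1146; 0x1116]); (0x273,
  [:: 0x2; 0x7; 0x334; 0x3356; 0x1144; 0x1114]); (0x274, [:: 0x6; 0x455;
  0x366; 0x155; 0x447; 0x1135; 0x2237]); (0x275, [:: 0; 0x36; 0x125; 0x3366;
  0x1137]); (0x276, [:: 0x4; 0x1; 0x2277]); (0x3123, [:: 0x36; 0x555]);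
  (0x3124, [:: 0x44]); (0x3125, [:: 0x45]); (0x3134, [:: 0x66]); (0x3153, [::
  0x6]); (0x3154, [:: 0x27; 0x77]); (0x3162, [:: 0x445; 0x277]); (0x3163, [::
  0x233; 0x566]); (0x3164, [:: 0x255; 0x224; 0x557]); (0x3165, [:: 0x33;
  0x444; 0x666; 0x257; 0x2347]); (0x3254, [:: 0x45]); (0x3534, [:: 0x6]);
  (0x3623, [:: 0x34; 0x67; 0x356]); (0x3624, [:: 0x66]); (0x3634, [:: 0x46]);
  (0x3653, [:: 0x4; 0x56]); (0x3654, [:: 0x33]); (0x3712, [:: 0x55; 0x12;
  0x17; 0x3344; 0x2266; 0x1334; 0x1236; 0x1367]); (0x3713, [:: 0x36; 0x555;
  0x125; 0x3455; 0x2556; 0x2246; 0x3366; 0x1355; 0x1234; 0x1226; 0x3447;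
  0x1347; 0x1267]); (0x3714, [:: 0x14; 0x223; 0x5566; 0x1266; 0x4667]);
  (0x3715, [:: 0x45; 0x15; 0x556; 0x134; 0x126; 0x113]); (0x3716, [:: 0x66;
  0x333; 0x445; 0x115; 0x227; 0x777; 0x3444; 0x3666; 0x4467]); (0x3723, [::
  0x33; 0x114; 0x111; 0x2226; 0x3557]); (0x3724, [:: 0x55; 0x12; 0x135;
  0x1236]); (0x3725, [:: 0x25; 0x355; 0x123; 0x347]); (0x3734, [:: 0x36;
  0x555; 0x125; 0x157]); (0x3753, [:: 0x3; 0x224; 0x122; 0x127; 0x177]);
  (0x3754, [:: 0x126; 0x167]); (0x3762, [:: 0x555; 0x157; 0x3455; 0x1226;
  0x5567; 0x4677]); (0x3763, [:: 0x34; 0x13; 0x2455; 0x1255; 0x1122; 0x4557;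
  0x1247; 0x4477]); (0x3764, [:: 0x66; 0x333; 0x445; 0x222; 0x145; 0x227;
  0x777; 0x1246; 0x4467]); (0x3765, [:: 0x366; 0x3445])]%num.
by vm_compute.
Qed.

Lemma H2_15 : exists cert, check 15 base15
  ((y1 ^^ 2 ** y3 ** y7 ++ c ^^ 2 ** b ** d ++ y1 ** y3 ** y5 ^^ 2) ^^ 2
   ++ a ** b ** c ** d ++ ((c ** d) ^^ 3 ++ a ** b ^^ 3 ** c ^^ 2)) cert.
Proof.
exists [:: (0x111, [:: 0x23344]); (0x117, [:: 0x13344]); (0x3124, [:: 0x6; 0x244]);
  (0x3163, [:: 0x344]); (0x3623, [:: 0x355]); (0x3734, [:: 0x133]); (0x3762,
  [:: 0x334])]%num.
by vm_compute.
Qed.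

(** For p_{32,12}: handles the summand oc^4 of (b^4 c/a + oc)^4, one factor oc going into this
    quotient. *)
Lemma phi_15 : lies 15 base15 (nil_gens 15 5) (a ^^ 2) (oc ** b ** o).
Proof.
exists (hexp [:: 0x136; 0x346; 0x1125; 0x2333; 0x3337; 0x12344; 0x13455; 0x113345;
0x144466; 0x234456; 0x334445; 0x1144445; 0x2334446; 0x4444445]%num);
  first by vm_compute.
exists [:: (0x101, [:: 0x1; 0x56; 0x346; 0x266; 0x136; 0x667; 0x4555; 0x2222;
  0x2277; 0x2777]); (0x107, [:: 0x46; 0x16; 0x233; 0x3335; 0x4455; 0x3466;
  0x1366; 0x1155; 0x4447; 0x2257; 0x6667; 0x1447; 0x1147; 0x1117; 0x24456;
  0x35666]); (0x111, [:: 0x225; 0x144; 0x111]); (0x117, [:: 0x555; 0x245;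
  0x125; 0x157]); (0x121, [:: 0x335; 0x466; 0x166]); (0x127, [:: 0x5; 0x356]);
  (0x131, [:: 0x112; 0x447]); (0x137, [:: 0x445; 0x222; 0x227]); (0x167, [::
  0x44; 0x44555]); (0x212, [:: 0x35; 0x334]); (0x213, [:: 0x57; 0x226;
  0x2356]); (0x214, [:: 0x4]); (0x215, [:: 0x5; 0x34; 0x26; 0x2366; 0x4477]);
  (0x216, [:: 0x344; 0x3377]); (0x223, [:: 0x456; 0x5566]); (0x224, [::
  0x4577]); (0x225, [:: 0x466; 0x4445; 0x4777]); (0x253, [:: 0x77]); (0x254,
  [:: 0x5; 0x67]); (0x262, [:: 0x347]); (0x264, [:: 0x344]); (0x265, [::
  0x47]); (0x271, [:: 0x7; 0x334; 0x133; 0x4444; 0x2245]); (0x272, [:: 0x46;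
  0x16; 0x233; 0x4455; 0x2444; 0x1455; 0x1366; 0x1155; 0x1124; 0x1447;
  0x1117]); (0x273, [:: 0x44; 0x14; 0x223; 0x3446; 0x5566; 0x1667]); (0x274,
  [:: 0x2; 0x35; 0x334; 0x4666; 0x1225; 0x1666; 0x1114; 0x5557; 0x4577]);
  (0x275, [:: 0x23; 0x4445; 0x2224; 0x1445; 0x5577; 0x4777]); (0x276, [::
  0x57; 0x355; 0x226]); (0x3123, [:: 0x23; 0x37]); (0x3125, [:: 0x3]);
  (0x3134, [:: 0x34; 0x67]); (0x3154, [:: 0x6]); (0x3162, [:: 0x5; 0x34; 0x26;
  0x67]); (0x3163, [:: 0x55; 0x24; 0x47; 0x567]); (0x3165, [:: 0x56]);
  (0x3253, [:: 0x46]); (0x3623, [:: 0x77]); (0x3624, [:: 0x67]); (0x3625, [::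
  0x7]); (0x3653, [:: 0x57]); (0x3654, [:: 0x56]); (0x3712, [:: 0x225; 0x144;
  0x114; 0x111; 0x577; 0x4456; 0x2226]); (0x3713, [:: 0x335; 0x3334; 0x2224;
  0x1333; 0x1145; 0x1115; 0x1227; 0x5577; 0x1777]); (0x3714, [:: 0; 0x36;
  0x2344; 0x3366; 0x1226; 0x3447; 0x4677; 0x1677]); (0x3715, [:: 0x3; 0x224;
  0x122; 0x557; 0x477; 0x3555; 0x4446; 0x1446; 0x1146]); (0x3716, [:: 0x34;
  0x26; 0x5555; 0x3346; 0x2366; 0x1336; 0x4557; 0x2447; 0x3667; 0x1477]);
  (0x3723, [:: 0x4; 0x56; 0x667]); (0x3724, [:: 0x444; 0x666; 0x144; 0x111;
  0x1377]); (0x3725, [:: 0x66; 0x222; 0x145; 0x277; 0x2446; 0x3666; 0x1344;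
  0x1113]); (0x3734, [:: 0x23; 0x37; 0x335]); (0x3753, [:: 0x46; 0x233; 0x566;
  0x5777]); (0x3754, [:: 0x255; 0x224; 0x557; 0x477; 0x5677]); (0x3762, [::
  0x466; 0x166; 0x3334; 0x4445; 0x2255; 0x5666; 0x1333; 0x1445; 0x1222;
  0x1115; 0x1277; 0x4777]); (0x3763, [:: 0x446; 0x3355; 0x1337; 0x3677]);
  (0x3764, [:: 0x5; 0x34; 0x67; 0x2455; 0x2244; 0x2366; 0x1336; 0x1122;
  0x2447]); (0x3765, [:: 0x35; 0x133; 0x2555; 0x3356; 0x4666; 0x1144])]%num.
by vm_compute.
Qed.

(** The quotient o b^4/a^2, from which (b^3/a)^4 leads to o b^16/a^6. *)
Definition h_15 : pol :=
  hexp [:: 0x245; 0x457; 0x1123; 0x1234; 0x2246; 0x2344; 0x3366; 0x3455;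
  0x4677; 0x13345; 0x14466; 0x22233; 0x33333; 0x33445; 0x34567; 0x114445;
  0x133344; 0x222444; 0x224447; 0x444445]%num.

Lemma h_15_quo : exists cert, check 15 base15 ((a ^^ 2) ** h_15 ++ o ** b ^^ 4) cert.
Proof.
exists [:: (0x101, [:: 0x13567]); (0x107, [:: 0x366; 0x155; 0x23357; 0x13467]);
  (0x111, [:: 0x237; 0x25666; 0x12445; 0x22557]); (0x117, [:: 0x1466; 0x1166;
  0x3567; 0x12255; 0x13367; 0x11277]); (0x121, [:: 0x1467; 0x22334]); (0x127,
  [:: 0x33366; 0x35567; 0x12367]); (0x131, [:: 0x24; 0x12; 0x135; 0x2266;
  0x33377]); (0x137, [:: 0x556; 0x14557; 0x11127]); (0x141, [:: 0x1115;
  0x2247]); (0x142, [:: 0x335]); (0x144, [:: 0x1145; 0x2247]); (0x151, [::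
  0x466]); (0x154, [:: 0x466; 0x1145]); (0x157, [:: 0x1115]); (0x161, [::
  0x26; 0x3346]); (0x167, [:: 0x4; 0x56; 0x3566]); (0x171, [:: 0x1455]);
  (0x177, [:: 0x2]); (0x212, [:: 0x257]); (0x215, [:: 0x177]); (0x223, [::
  0x56]); (0x224, [:: 0x444]); (0x225, [:: 0x227]); (0x264, [:: 0x34]);
  (0x272, [:: 0x366]); (0x3123, [:: 0x145]); (0x3125, [:: 0x357]); (0x3154,
  [:: 0x567]); (0x3162, [:: 0x224]); (0x3163, [:: 0x133]); (0x3164, [:: 0x6]);
  (0x3234, [:: 0x66; 0x277]); (0x3534, [:: 0x33; 0x444]); (0x3624, [::
  0x336]); (0x3625, [:: 0x225; 0x666; 0x257]); (0x3634, [:: 0x334; 0x133]);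
  (0x3712, [:: 0x377]); (0x3714, [:: 0x355]); (0x3723, [:: 0; 0x157]);
  (0x3724, [:: 0x44; 0x377]); (0x3734, [:: 0x277]); (0x3753, [:: 0x124; 0x147;
  0x117]); (0x3754, [:: 0x116]); (0x3762, [:: 0x66; 0x227]); (0x3763, [::
  0x566]); (0x3764, [:: 0x255]); (0x3765, [:: 0x225; 0x114]); (0x42676, [::
  0x23]); (0x43172, [:: 0x11]); (0x43176, [:: 0x37]); (0x43216, [:: 0x37]);
  (0x43275, [:: 0x25]); (0x43317, [:: 0x16]); (0x43327, [:: 0x4]); (0x43512,
  [:: 0x55; 0x47; 0x17]); (0x43521, [:: 0x17]); (0x43526, [:: 0x67]);
  (0x43612, [:: 0x23]); (0x43672, [:: 0x46]); (0x43675, [:: 0x26]); (0x44263,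
  [:: 0x37]); (0x44325, [:: 0x55; 0x47]); (0x44353, [:: 0x5]); (0x44355, [::
  0x22]); (0x44361, [:: 0x2]); (0x44371, [:: 0x27]); (0x44461, [:: 0x47]);
  (0x44515, [:: 0x3]); (0x44521, [:: 0x6]); (0x44523, [:: 0x12]); (0x44525,
  [:: 0x33]); (0x44526, [:: 0x15]); (0x44527, [:: 0]); (0x44561, [:: 0x11]);
  (0x44563, [:: 0x4]); (0x44571, [:: 0x6]); (0x44615, [:: 0x11]); (0x44676,
  [:: 0x2; 0x35]); (0x45177, [:: 0]); (0x45212, [:: 0x36])]%num.
by vm_compute.
Qed.

(* The element needed is (b^3 / a)^4 h. Rather than expanding it, multiplication by
   b^3 / a is followed through ideals generated by the monomials in b3_gens2,
   b3_gens1 and b3_gens0. *)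
Definition b3_gens2 : seq mon := [:: [:: 7]; [:: 1; 1; 1; 6]; [:: 1; 1; 1; 1]]%N.
Definition b3_gens1 : seq mon := [:: [:: 7]; [:: 4; 4; 4]; [:: 1; 1; 6]; [:: 1; 1; 1]]%N.
Definition b3_gens0 : seq mon := [:: [:: 7]; [:: 4; 4]; [:: 1; 1]]%N.
(** An intermediate ideal for (cd/a)^4 o: it contains o (cd)^2/a^2, and (cd)^2/a^2 maps it into S.
    It involves X_5, which is not among the generators used for [nil_ideal]. *)
Definition theta_gens : seq mon := [:: [:: 5]; [:: 4; 6]]%N.

Lemma p_15 : lies 15 base15 b3_gens2 a (b ^^ 3 ** h_15).
Proof.
exists (hexp [:: 0x11227; 0x12557; 0x13367; 0x33467; 0x36677; 0x45577; 0x111113;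
0x111126; 0x111134; 0x111246; 0x111556; 0x122567; 0x123457; 0x135557;
0x233337; 0x255567; 0x345557; 0x1112566; 0x2345567; 0x3333357; 0x3344557;
0x11112244; 0x11112455; 0x11113346; 0x11115555; 0x11123466]%num);
  first by vm_compute.
exists [:: (0x101, [:: 0x2455; 0x2244; 0x44446; 0x33337; 0x111566; 0x234467]);
  (0x107, [:: 0x56; 0x23666; 0x12344; 0x111466; 0x134567; 0x367777]); (0x111,
  [:: 0x1344; 0x1167; 0x55566; 0x22367; 0x113346; 0x111557]); (0x117, [::
  0x3457; 0x1357; 0x113335; 0x114447; 0x111117; 0x222777]); (0x121, [:: 0x233;
  0x4455; 0x3466; 0x12456; 0x23557; 0x11567; 0x124667; 0x111367; 0x116677]);
  (0x127, [:: 0x22556; 0x23366; 0x14456; 0x46777; 0x111667]); (0x131, [::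
  0x33777; 0x334556; 0x114445; 0x155557; 0x112477]); (0x137, [:: 0x117;
  0x23357; 0x155555; 0x223367]); (0x141, [:: 0x14455; 0x25557]); (0x142, [::
  0x1337; 0x15777]); (0x144, [:: 0x23356; 0x12666; 0x46667; 0x11447;
  0x24577]); (0x147, [:: 0x55666]); (0x151, [:: 0x116; 0x11155; 0x25557;
  0x12257; 0x24577; 0x12577]); (0x152, [:: 0x11366]); (0x154, [:: 0x446;
  0x4566; 0x12444; 0x13466]); (0x157, [:: 0x55666; 0x12444; 0x16667;
  0x24577]); (0x161, [:: 0x17]); (0x167, [:: 0x11127]); (0x171, [:: 0x456]);
  (0x213, [:: 0x1566]); (0x215, [:: 0x2245; 0x2457]); (0x223, [:: 0x167]);
  (0x224, [:: 0x4445]); (0x225, [:: 0x46; 0x2444]); (0x234, [:: 0x116]);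
  (0x253, [:: 0x11]); (0x254, [:: 0x1114]); (0x262, [:: 0x2334]); (0x273, [::
  0x556]); (0x275, [:: 0x3466; 0x1124]); (0x276, [:: 0x3347]); (0x3124, [::
  0x122; 0x477; 0x5677]); (0x3125, [:: 0x2226; 0x2267]); (0x3134, [::
  0x1666]); (0x3154, [:: 0x3447; 0x4677]); (0x3162, [:: 0x7]); (0x3164, [::
  0x4457]); (0x3234, [:: 0x233; 0x2577]); (0x3253, [:: 0x2333]); (0x3254, [::
  0x1377; 0x6777]); (0x3623, [:: 0x1136]); (0x3624, [:: 0x133; 0x1225;
  0x1257]); (0x3625, [:: 0x2336; 0x1277]); (0x3634, [:: 0x123; 0x1466]);
  (0x3653, [:: 0x146]); (0x3654, [:: 0x34]); (0x3713, [:: 0x2577]); (0x3716,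
  [:: 0x35; 0x367; 0x1666; 0x5557]); (0x3723, [:: 0x5; 0x1255; 0x1224;
  0x3667]); (0x3724, [:: 0x222; 0x1126]); (0x3734, [:: 0x337]); (0x3753, [::
  0x3566; 0x3337; 0x7777]); (0x3754, [:: 0x4456; 0x1156; 0x3477]); (0x3762,
  [:: 0x337; 0x2444; 0x2577]); (0x42171, [:: 0x37]); (0x42217, [:: 0x16]);
  (0x42261, [:: 0x111]); (0x42616, [:: 0x137]); (0x42617, [:: 0x444]);
  (0x43172, [:: 0x66; 0x777]); (0x43176, [:: 0x27; 0x77]); (0x43215, [::
  0x125; 0x157]); (0x43216, [:: 0x116]); (0x43261, [:: 0x22]); (0x43277, [::
  0x117]); (0x43351, [:: 0x24]); (0x43352, [:: 0x355]); (0x43512, [:: 0x36]);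
  (0x43515, [:: 0x444; 0x666; 0x114]); (0x43516, [:: 0x126]); (0x43521, [::
  0x245]); (0x43526, [:: 0x135]); (0x43561, [:: 0x134]); (0x43566, [::
  0x346]); (0x43572, [:: 0x127]); (0x43576, [:: 0x24]); (0x43577, [:: 0x127]);
  (0x43615, [:: 0x15]); (0x43672, [:: 0x156]); (0x43675, [:: 0x24]); (0x44175,
  [:: 0x667]); (0x44176, [:: 0x3]); (0x44177, [:: 0x23]); (0x44212, [::
  0x166]); (0x44213, [:: 0x257]); (0x44261, [:: 0x177]); (0x44262, [::
  0x444]); (0x44265, [:: 0x117]); (0x44267, [:: 0x114; 0x257; 0x577]);
  (0x44271, [:: 0x23]); (0x44273, [:: 0x777]); (0x44311, [:: 0x336; 0x122]);
  (0x44312, [:: 0x444]); (0x44313, [:: 0x357]); (0x44315, [:: 0x117]);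
  (0x44317, [:: 0x114]); (0x44321, [:: 0x444]); (0x44325, [:: 0x245]);
  (0x44327, [:: 0x227]); (0x44352, [:: 0x457]); (0x44355, [:: 0x225; 0x257]);
  (0x44365, [:: 0x45; 0x246]); (0x44367, [:: 0x116]); (0x44372, [:: 0x222;
  0x115]); (0x44375, [:: 0x245]); (0x44376, [:: 0x116]); (0x44421, [:: 0x2]);
  (0x44432, [:: 0x225]); (0x44436, [:: 0x25; 0x267]); (0x44437, [:: 0x33]);
  (0x44451, [:: 0x337]); (0x44452, [:: 0x346]); (0x44456, [:: 0x333; 0x145]);
  (0x44457, [:: 0x4; 0x667]); (0x44467, [:: 0x3]); (0x44512, [:: 0x346]);
  (0x44513, [:: 0x124]); (0x44516, [:: 0x445; 0x227]); (0x44522, [:: 0x13]);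
  (0x44526, [:: 0x147]); (0x44562, [:: 0x6; 0x455]); (0x44565, [:: 0x336]);
  (0x44567, [:: 0x447]); (0x44571, [:: 0x1; 0x346]); (0x44575, [:: 0x23]);
  (0x44612, [:: 0x127]); (0x44616, [:: 0x24]); (0x44617, [:: 0x247]);
  (0x44673, [:: 0x22]); (0x44675, [:: 0x112]); (0x45216, [:: 0x155; 0x124]);
  (0x45217, [:: 0x13]); (0x45262, [:: 0x157]); (0x45277, [:: 0x334]);
  (0x45517, [:: 0x37]); (0x45567, [:: 0x114]); (0x45617, [:: 0x117]);
  (0x45671, [:: 0x244; 0x155; 0x117]); (0x45676, [:: 0x344; 0x556; 0x126]);
  (0x46177, [:: 0x144])]%num.
by vm_compute.
Qed.

Lemma b3_gens2_7 : lies 15 base15 b3_gens1 a (b ^^ 3 ** [:: [:: 7]%N]).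
Proof.
exists (hexp [:: 0x444]%num);
  first by vm_compute.
exists [::].
by vm_compute.
Qed.

Lemma b3_gens2_1116 : lies 15 base15 b3_gens1 a (b ^^ 3 ** [:: [:: 1; 1; 1; 6]%N]).
Proof.
exists (hexp [:: 0x27; 0x116; 0x2367; 0x11366; 0x11447; 0x12257; 0x12444; 0x22457;
0x24444; 0x24577; 0x25557; 0x44455; 0x111256; 0x111345; 0x112456; 0x134445;
0x234557; 0x244456; 0x344445]%num);
  first by vm_compute.
exists [:: (0x101, [:: 0x7; 0x133; 0x2555; 0x1114; 0x5557; 0x2457; 0x1257]);
  (0x107, [:: 0x2455; 0x1122; 0x1557]); (0x111, [:: 0x455; 0x155; 0x124;
  0x447; 0x2456; 0x1345; 0x2237]); (0x117, [:: 0x257; 0x3477]); (0x121, [::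
  0x2445; 0x1125]); (0x127, [:: 0x3334; 0x1333; 0x1445; 0x1222; 0x1145]);
  (0x131, [:: 0x2345; 0x3457]); (0x142, [:: 0x237]); (0x144, [:: 0x456;
  0x377]); (0x152, [:: 0x223; 0x237]); (0x154, [:: 0x14]); (0x157, [::
  0x377]); (0x161, [:: 0x234; 0x347]); (0x212, [:: 0x46]); (0x213, [:: 0x14]);
  (0x223, [:: 0x55; 0x24; 0x17]); (0x225, [:: 0x1; 0x56]); (0x254, [:: 0x37]);
  (0x272, [:: 0x13]); (0x273, [:: 0x55]); (0x3123, [:: 0x1]); (0x3162, [::
  0x37]); (0x3163, [:: 0x77]); (0x3165, [:: 0x2]); (0x3624, [:: 0x23]);
  (0x3716, [:: 0x23; 0x37])]%num.
by vm_compute.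
Qed.

Lemma b3_gens2_1111 : lies 15 base15 b3_gens1 a (b ^^ 3 ** [:: [:: 1; 1; 1; 1]%N]).
Proof.
exists (hexp [:: 0x111; 0x257; 0x577; 0x1156; 0x1237; 0x2267; 0x2677; 0x3557; 0x6777;
0x11266; 0x11346; 0x13357; 0x14667; 0x33457; 0x34446; 0x111125; 0x111245;
0x111555; 0x113566; 0x124445; 0x224557; 0x333447; 0x335567; 0x456667;
0x1111123; 0x2244446; 0x2344444]%num);
  first by vm_compute.
exists [:: (0x101, [:: 0x57; 0x355; 0x234; 0x226; 0x137; 0x677; 0x2356; 0x1466;
  0x1166]); (0x107, [:: 0x12; 0x17; 0x345; 0x256; 0x567; 0x1236; 0x1133;
  0x3467; 0x1367; 0x6677; 0x22445; 0x44666]); (0x111, [:: 0x1; 0x1245;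
  0x1457]); (0x117, [:: 0x23; 0x466; 0x166; 0x3334; 0x2255; 0x5666; 0x1445]);
  (0x121, [:: 0x45; 0x15; 0x344]); (0x127, [:: 0x22; 0x27; 0x77; 0x146]);
  (0x131, [:: 0x2]); (0x137, [:: 0x34; 0x13]); (0x167, [:: 0x555]); (0x213,
  [:: 0x66; 0x277]); (0x214, [:: 0x355; 0x347; 0x267; 0x677]); (0x215, [::
  0x27; 0x77; 0x446]); (0x216, [:: 0x557; 0x477]); (0x262, [:: 0x66]); (0x263,
  [:: 0x46]); (0x264, [:: 0x557]); (0x265, [:: 0x577]); (0x271, [:: 0x44;
  0x237; 0x377]); (0x272, [:: 0x55]); (0x273, [:: 0; 0x555]); (0x274, [::
  0x223]); (0x275, [:: 0x45; 0x113]); (0x276, [:: 0x115; 0x277]); (0x3123, [::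
  0x344]); (0x3124, [:: 0x23]); (0x3125, [:: 0x46; 0x566]); (0x3154, [:: 0x2;
  0x35]); (0x3162, [:: 0x22; 0x77; 0x446]); (0x3163, [:: 0x33; 0x444; 0x225;
  0x257; 0x577]); (0x3164, [:: 0x55]); (0x3165, [:: 0x25; 0x355; 0x226;
  0x267]); (0x3234, [:: 0x45]); (0x3253, [:: 0x55]); (0x3254, [:: 0x46]);
  (0x3653, [:: 0x66]); (0x3654, [:: 0x57]); (0x3712, [:: 0x4; 0x56; 0x266;
  0x667]); (0x3713, [:: 0x15; 0x344; 0x556; 0x126]); (0x3714, [:: 0x335;
  0x466]); (0x3715, [:: 0x566; 0x337]); (0x3723, [:: 0x57; 0x355; 0x226]);
  (0x3724, [:: 0x1; 0x56]); (0x3725, [:: 0x5; 0x67]); (0x3734, [:: 0x45; 0x15;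
  0x344; 0x113; 0x167]); (0x3753, [:: 0x12; 0x135]); (0x3754, [:: 0x233;
  0x566]); (0x3762, [:: 0x45; 0x15; 0x556]); (0x3763, [:: 0x6; 0x455; 0x155;
  0x117]); (0x3764, [:: 0x446; 0x116]); (0x3765, [:: 0x14; 0x11; 0x156;
  0x377])]%num.
by vm_compute.
Qed.

Lemma b3_gens1_7 : lies 15 base15 b3_gens0 a (b ^^ 3 ** [:: [:: 7]%N]).
Proof.
exists (hexp [:: 0x444]%num);
  first by vm_compute.
exists [::].
by vm_compute.
Qed.

Lemma b3_gens1_444 : lies 15 base15 b3_gens0 a (b ^^ 3 ** [:: [:: 4; 4; 4]%N]).
Proof.
exists (hexp [:: 0x44; 0x237; 0x1136; 0x3357; 0x3446; 0x11125; 0x11457; 0x12227;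
0x12445; 0x22557; 0x23367]%num);
  first by vm_compute.
exists [:: (0x101, [:: 0x23; 0x335; 0x166]); (0x121, [:: 0x67; 0x356]); (0x131, [::
  0x114]); (0x152, [:: 0x45]); (0x157, [:: 0x15]); (0x171, [:: 0x55; 0x24;
  0x47]); (0x177, [:: 0x11]); (0x212, [:: 0x1]); (0x224, [:: 0x4]); (0x272,
  [:: 0x2]); (0x3125, [:: 0x6]); (0x3153, [:: 0x1]); (0x43525, [:: 0]);
  (0x43575, [:: 0]); (0x44561, [:: 0])]%num.
by vm_compute.
Qed.

Lemma b3_gens1_116 : lies 15 base15 b3_gens0 a (b ^^ 3 ** [:: [:: 1; 1; 6]%N]).
Proof.
exists (hexp [:: 0x1147; 0x1155; 0x1244; 0x4455; 0x12237; 0x13445; 0x34445]%num);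
  first by vm_compute.
exists [:: (0x107, [:: 0x336; 0x247]); (0x111, [:: 0x345]); (0x127, [:: 0x333]);
  (0x137, [:: 0x234; 0x347]); (0x167, [:: 0x35]); (0x177, [:: 0x46]); (0x234,
  [:: 0x1]); (0x3234, [:: 0]); (0x3253, [:: 0x3]); (0x3653, [:: 0x1]);
  (0x3734, [:: 0]); (0x43326, [:: 0])]%num.
by vm_compute.
Qed.

Lemma b3_gens1_111 : lies 15 base15 b3_gens0 a (b ^^ 3 ** [:: [:: 1; 1; 1]%N]).
Proof.
exists (hexp [:: 0x11; 0x3357; 0x11125; 0x11245; 0x11457; 0x11555; 0x12227; 0x12445;
0x13337; 0x14457; 0x17777; 0x22247; 0x25577; 0x44555; 0x111123; 0x113455;
0x123444; 0x224446; 0x244556; 0x334466; 0x344455]%num);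
  first by vm_compute.
exists [:: (0x101, [:: 0x2336; 0x2247; 0x5577]); (0x107, [:: 0x1225; 0x1666;
  0x4577]); (0x111, [:: 0x2467]); (0x117, [:: 0x1246; 0x2357]); (0x121, [::
  0x2455; 0x3346; 0x3667]); (0x127, [:: 0x1366; 0x1155; 0x1112]); (0x131, [::
  0x3557; 0x2347; 0x3477]); (0x137, [:: 0x1235]); (0x142, [:: 0x45]); (0x144,
  [:: 0x134]); (0x147, [:: 0x167]); (0x151, [:: 0x45; 0x15; 0x126]); (0x152,
  [:: 0x15]); (0x157, [:: 0x167]); (0x161, [:: 0x146]); (0x167, [:: 0x57;
  0x234]); (0x171, [:: 0x345]); (0x177, [:: 0x223]); (0x253, [:: 0x24]);
  (0x262, [:: 0x15]); (0x265, [:: 0x14]); (0x3134, [:: 0x16]); (0x3234, [::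
  0x13]); (0x3253, [:: 0x35]); (0x3634, [:: 0x14]); (0x3654, [:: 0x37]);
  (0x3753, [:: 0x2]); (0x3763, [:: 0x24; 0x47]); (0x43172, [:: 0]); (0x43266,
  [:: 0x1]); (0x44172, [:: 0x4]); (0x44173, [:: 0x6]); (0x44271, [:: 0x1]);
  (0x44363, [:: 0x1]); (0x44377, [:: 0]); (0x44512, [:: 0x7]); (0x44521, [::
  0x7]); (0x44525, [:: 0x1]); (0x44571, [:: 0x2])]%num.
by vm_compute.
Qed.

Lemma b3_gens0_7 : lies 15 base15 (nil_gens 15 5) a (b ^^ 3 ** [:: [:: 7]%N]).
Proof.
exists (hexp [:: 0x444]%num);
  first by vm_compute.
exists [::].
by vm_compute.
Qed.

Lemma b3_gens0_44 : lies 15 base15 (nil_gens 15 5) a (b ^^ 3 ** [:: [:: 4; 4]%N]).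
Proof.
exists (hexp [:: 0x4; 0x1125; 0x1245; 0x3337; 0x3566; 0x4457; 0x11123; 0x12344;
0x13366; 0x22235; 0x23444; 0x23666; 0x34455]%num);
  first by vm_compute.
exists [:: (0x107, [:: 0x33; 0x225]); (0x117, [:: 0x134]); (0x121, [:: 0x336]);
  (0x127, [:: 0x366; 0x447]); (0x131, [:: 0x223]); (0x137, [:: 0x27]); (0x151,
  [:: 0x13]); (0x157, [:: 0x13]); (0x171, [:: 0x2]); (0x224, [:: 0]); (0x3623,
  [:: 0x2; 0x7]); (0x3624, [:: 0x6]); (0x3634, [:: 0x1])]%num.
by vm_compute.
Qed.

Lemma b3_gens0_11 : lies 15 base15 (nil_gens 15 5) a (b ^^ 3 ** [:: [:: 1; 1]%N]).
Proof.
exists (hexp [:: 0x1; 0x56; 0x266; 0x1555; 0x2333; 0x2445; 0x3566; 0x4457; 0x7777;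
0x11123; 0x12556; 0x22235; 0x22446; 0x23666; 0x33335; 0x33466; 0x36667]%num);
  first by vm_compute.
exists [:: (0x101, [:: 0x66; 0x227; 0x277; 0x1344]); (0x111, [:: 0x57; 0x677]);
  (0x117, [:: 0x113]); (0x121, [:: 0x336; 0x1146]); (0x127, [:: 0x366;
  0x3777]); (0x131, [:: 0x44; 0x156]); (0x144, [:: 0x67]); (0x151, [:: 0x13]);
  (0x152, [:: 0x67]); (0x161, [:: 0x16]); (0x167, [:: 0x23]); (0x171, [::
  0x334]); (0x216, [:: 0x16]); (0x234, [:: 0x13]); (0x253, [:: 0x7]); (0x271,
  [:: 0x36]); (0x274, [:: 0]); (0x275, [:: 0x3]); (0x276, [:: 0x13]); (0x3124,
  [:: 0x15]); (0x3134, [:: 0x6]); (0x3153, [:: 0]); (0x3154, [:: 0x14]);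
  (0x3623, [:: 0x2]); (0x3653, [:: 0x34]); (0x3654, [:: 0x66]); (0x3712, [::
  0x25]); (0x3713, [:: 0x3]); (0x3762, [:: 0x3]); (0x43321, [:: 0x7]);
  (0x43617, [:: 0x5]); (0x43671, [:: 0x5]); (0x44266, [:: 0x1]); (0x44363, [::
  0]); (0x45517, [:: 0])]%num.
by vm_compute.
Qed.

Lemma sth_15 : lies 15 base15 theta_gens (a ^^ 2) (o ** (c ** d) ^^ 2).
Proof.
exists (hexp [:: 0x1125; 0x1245; 0x3566; 0x12467; 0x22235; 0x24556; 0x33335; 0x33466;
0x34455; 0x135556; 0x234456; 0x345556]%num);
  first by vm_compute.
exists [:: (0x101, [:: 0x1555; 0x33466; 0x45567; 0x11267; 0x23577; 0x11677]);
  (0x107, [:: 0x2257; 0x45556; 0x44567; 0x35577]); (0x111, [:: 0x2234; 0x1456;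
  0x3557; 0x45566; 0x12466]); (0x117, [:: 0x157; 0x1355; 0x3447]); (0x121, [::
  0x466; 0x166; 0x2255; 0x34666; 0x14556; 0x35557]); (0x127, [:: 0x356;
  0x1336; 0x12345]); (0x137, [:: 0x2235; 0x1246; 0x4467; 0x55566]); (0x142,
  [:: 0x57; 0x3345; 0x1466]); (0x144, [:: 0x3345; 0x4466; 0x3567]); (0x147,
  [:: 0x57; 0x267; 0x4466]); (0x152, [:: 0x234; 0x267]); (0x154, [:: 0x234;
  0x1166]); (0x157, [:: 0x4466]); (0x161, [:: 0x15]); (0x167, [:: 0x156;
  0x1667]); (0x177, [:: 0x567; 0x2266]); (0x213, [:: 0x267; 0x677]); (0x224,
  [:: 0x35]); (0x234, [:: 0x57; 0x226; 0x267]); (0x254, [:: 0x34]); (0x262,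
  [:: 0x57; 0x347]); (0x265, [:: 0x47]); (0x275, [:: 0x335]); (0x3123, [::
  0x466; 0x166]); (0x3124, [:: 0x36; 0x457]); (0x3134, [:: 0x5; 0x67]);
  (0x3153, [:: 0x35; 0x367]); (0x3154, [:: 0x155]); (0x3163, [:: 0x47;
  0x567]); (0x3164, [:: 0x46; 0x566]); (0x3534, [:: 0x236]); (0x3623, [::
  0x77]); (0x3624, [:: 0x67; 0x356]); (0x3634, [:: 0x24; 0x567]); (0x3654, [::
  0x4; 0x56; 0x266]); (0x3713, [:: 0x37; 0x335]); (0x3714, [:: 0x36]);
  (0x3724, [:: 0x257]); (0x3725, [:: 0x66]); (0x3753, [:: 0x16]); (0x3754, [::
  0x224]); (0x3763, [:: 0x116]); (0x3764, [:: 0x26])]%num.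
by vm_compute.
Qed.

Lemma theta_gens_5 : lies 15 base15 [:: [::]] (a ^^ 2) ((c ** d) ^^ 2 ** [:: [:: 5]%N]).
Proof.
exists (hexp [:: 0x46; 0x233; 0x566; 0x1112; 0x1124; 0x1244; 0x1366; 0x2225; 0x2666;
0x4455; 0x6667; 0x12456; 0x13333; 0x15556; 0x22355; 0x33334; 0x35666]%num);
  first by vm_compute.
exists [:: (0x101, [:: 0x6667]); (0x107, [:: 0x37; 0x2247; 0x1227]); (0x111, [::
  0x122; 0x177; 0x5677]); (0x117, [:: 0x447; 0x2237]); (0x127, [:: 0x1; 0x266;
  0x136; 0x667; 0x1555; 0x1125; 0x2277]); (0x131, [:: 0x1126; 0x1167;
  0x3577]); (0x142, [:: 0x47]); (0x144, [:: 0x17; 0x567]); (0x151, [:: 0x47;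
  0x135]); (0x167, [:: 0x77]); (0x177, [:: 0x126]); (0x212, [:: 0x67]);
  (0x262, [:: 0x47]); (0x264, [:: 0x14]); (0x3123, [:: 0x35]); (0x3534, [::
  0x26]); (0x3714, [:: 0x6]); (0x3734, [:: 0x2; 0x7]); (0x3765, [:: 0x67]);
  (0x42217, [:: 0x2]); (0x43271, [:: 0x3]); (0x43326, [:: 0x7]); (0x44267, [::
  0]); (0x44421, [:: 0x4]); (0x44672, [:: 0]); (0x45527, [:: 0x7]); (0x45567,
  [:: 0])]%num.
by vm_compute.
Qed.

Lemma theta_gens_46 : lies 15 base15 [:: [::]] (a ^^ 2) ((c ** d) ^^ 2 ** [:: [:: 4; 6]%N]).
Proof.
exists (hexp [:: 0x2; 0x35; 0x133; 0x236; 0x1111; 0x1114; 0x2457; 0x2555; 0x3356;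
0x12226; 0x12355; 0x23455; 0x35555]%num);
  first by vm_compute.
exists [:: (0x101, [:: 0x367; 0x2245; 0x3356; 0x5557]); (0x107, [:: 0x67]); (0x111,
  [:: 0x447; 0x1345]); (0x117, [:: 0x111; 0x577]); (0x121, [:: 0x2277]);
  (0x127, [:: 0x37; 0x1145; 0x2557]); (0x131, [:: 0x477; 0x2345]); (0x137, [::
  0x245; 0x457; 0x5567]); (0x152, [:: 0x456]); (0x154, [:: 0x156]); (0x157,
  [:: 0x156]); (0x167, [:: 0x47]); (0x216, [:: 0x57]); (0x225, [:: 0x56]);
  (0x276, [:: 0x11]); (0x3134, [:: 0x23]); (0x3234, [:: 0x1]); (0x3634, [::
  0x22; 0x77]); (0x3723, [:: 0x35]); (0x3725, [:: 0x36]); (0x3734, [:: 0x1]);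
  (0x3754, [:: 0x66]); (0x3764, [:: 0x23]); (0x43566, [:: 0x5]); (0x44372, [::
  0x6]); (0x44375, [:: 0x3]); (0x44435, [:: 0]); (0x44513, [:: 0]); (0x44521,
  [:: 0x5]); (0x44527, [:: 0x7]); (0x44562, [:: 0]); (0x44573, [:: 0x3]);
  (0x45172, [:: 0x7]); (0x45211, [:: 0x5]); (0x45216, [:: 0]); (0x45267, [::
  0x3]); (0x45617, [:: 0])]%num.
by vm_compute.
Qed.

Lemma b3_gens2_step m : m \in b3_gens2 -> lies 15 base15 b3_gens1 a (b ^^ 3 ** [:: m]).
Proof.
rewrite !inE => /or3P[] /eqP ->; [exact: b3_gens2_7|exact: b3_gens2_1116|exact: b3_gens2_1111].
Qed.

Lemma b3_gens1_step m : m \in b3_gens1 -> lies 15 base15 b3_gens0 a (b ^^ 3 ** [:: m]).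
Proof.
rewrite !inE => /or4P[] /eqP ->; [exact: b3_gens1_7|exact: b3_gens1_444|exact:
  b3_gens1_116|exact: b3_gens1_111].
Qed.

Lemma b3_gens0_step m : m \in b3_gens0 -> lies 15 base15 (nil_gens 15 5) a (b ^^ 3 ** [:: m]).
Proof.
rewrite !inE => /or3P[] /eqP ->; [exact: b3_gens0_7|exact: b3_gens0_44|exact: b3_gens0_11].
Qed.

Lemma theta_gens_step m : m \in theta_gens -> lies 15 base15 [:: [::]] (a ^^ 2) ((c ** d) ^^ 2
  ** [:: m]).
Proof.
rewrite !inE => /orP[] /eqP ->; [exact: theta_gens_5|exact: theta_gens_46].
Qed.

End Certificates15.

(** The numerator is the expansion of (cd)^2, so (cd)^2/a is b times a sum of multipliers. The next
    identity does the same for E/a. *)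
Lemma divide_theta (F : fieldType) (a b c : F) : a != 0 -> b != 0 ->
  (b * a + b * b ^+ 4 + a * c ^+ 4) / a = b * (1 + b ^+ 4 / a + c ^+ 4 / b).
Proof. by move=> a0 b0; field; rewrite a0 b0. Qed.

Lemma divide_eps (F : fieldType) (a b c : F) : a != 0 -> b != 0 ->
  (a * c ^+ 4 + b ^+ 5) / a = b * (b ^+ 4 / a + c ^+ 4 / b).
Proof. by move=> a0 b0; field; rewrite a0 b0. Qed.

(** * The projections of 1/a *)

Section Targets.
Variables (l e : nat) (base : seq pol) (u : int).
Hypotheses (l_odd : odd l) (l_gt1 : (1 < l)%N) (e_dvd : (e %| l)%N).
Hypotheses (base0 : vanish_on l base) (u_l : coprimez u l%:Z).
Local Notation y := (theta_at l u).
Local Notation S := (theta_ring l).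
Local Notation n := (nil_ideal l e).
Local Notation T := (multiplier l e).
Local Notation G := (nil_gens l e).
Local Notation h := (l./2.+1).
Local Notation pa := (var l 8).
Local Notation pb := (var l 4).
Local Notation pc := (var l 2).
Local Notation pd := (var l 6).
Local Notation p1 := (var l 1).
Local Notation p3 := (var l 3).
Local Notation p5 := (var l 5).
Local Notation p7 := (var l 7).
Local Notation po := (pa ++ pb ^^ 4).
Local Notation a := (y 8).
Local Notation b := (y 4).
Local Notation c := (y 2).
Local Notation d := (y 6).
Local Notation x1 := (y 1).
Local Notation x3 := (y 3).
Local Notation x5 := (y 5).
Local Notation x7 := (y 7).
Local Notation e1 := (y h).
Local Notation e5 := (y (5 * h)).
Local Notation v := (a^-1).
Local Notation o := (a + b ^+ 4).
Local Notation ob := (b + c ^+ 4).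
Local Notation oc := (c + x1 ^+ 4).
Local Notation E := (a * c ^+ 4 + b ^+ 5).
Local Notation w := (b ^+ 4 * v).
Local Notation wb := (c ^+ 4 / b).
Local Notation wc := (x1 ^+ 4 / c).
Local Notation w1 := (e1 ^+ 4 / x1).
Local Notation w5 := (e5 ^+ 4 / x5).
Local Notation H := (x1 ^+ 2 * x3 * x7 + c ^+ 2 * b * d + x1 * x3 * x5 ^+ 2).
Local Notation K := ((c * d) ^+ 3 + a * b ^+ 3 * c ^+ 2).

Let y_pow2_neq0 k : y (2 ^ k)%N != 0.
Proof. by apply: theta_at_neq0 => //; exact: l_ndvd_pow2. Qed.
Let a0 : a != 0 := y_pow2_neq0 3.
Let b0 : b != 0 := y_pow2_neq0 2.
Let c0 : c != 0 := y_pow2_neq0 1.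
Let x10 : x1 != 0 := y_pow2_neq0 0.
Let av : a * v = 1. Proof. exact: divff. Qed.

Let ymod (i j : nat) : (i = j %[mod l])%N -> y i = y j.
Proof. exact: theta_at_mod. Qed.

(** h = (l + 1)/2 inverts 2 modulo l, so the index kh stands for k/2. *)
Let h2 (k : nat) : (2 * (k * h) = k %[mod l])%N.
Proof.
have -> : (2 * (k * h) = k * l + k)%N.
  by rewrite -{2}(odd_double_half l) l_odd; lia.
by rewrite modnMDl.
Qed.

Lemma theta_at_lhom i j : (2 * j = i %[mod l])%N -> lhom 8 1 (y i + y j ^+ 4).
Proof.
by move=> ij; rewrite -(ymod ij) theta_at_dbl; exact: thetaO_lhom.
Qed.

(** This is [theta_rel'] at the half indices s = i/2 and t = i/2 + q, for which s + t = i + q and s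
    - t = -q. *)
Lemma theta_at_rel i q : (y (i + q) * y q) ^+ 2 = y i * y (i + 2 * q)
  + y i * y ((i + 2 * q) * h) ^+ 4 + y (i + 2 * q) * y (i * h) ^+ 4.
Proof.
have yiq : y (i + q) = theta l ((i * h)%:Z * u + ((i + 2 * q) * h)%:Z * u).
  rewrite -theta_at_add; apply: ymod; rewrite -mulnDl.
  have -> : (i + (i + 2 * q) = 2 * (i + q))%N by lia.
  by rewrite -mulnA h2.
have yq : y q = theta l ((i * h)%:Z * u - ((i + 2 * q) * h)%:Z * u).
  have e' : (2 * (q * h))%N%:Z * u = ((i + 2 * q) * h)%N%:Z * u - (i * h)%N%:Z * u.
    by rewrite !PoszM (PoszD i (2 * q)) PoszM; ring.
  by rewrite -(ymod (h2 q)) /theta_at e' -opprB thetaN.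
rewrite yiq yq theta_rel' // -!theta_at_dbl (ymod (h2 i)) (ymod (h2 (i + 2 * q))).
by [].
Qed.

(** The odd part of a product of two theta series: each of its two terms is a series in class 1
    modulo 8 times a fourth power. *)
Lemma theta_at_lhom4 i q : lhom 4 1 (y i * y (i + 2 * q) + (y (i + q) * y q) ^+ 2).
Proof.
set s := y (i * h); set t := y ((i + 2 * q) * h).
have p4 f : lhom 4 0 (f ^+ 4) := lhom_exp4 (@lhom1 f).
have d8 k : lhom 4 1 (y k + y (k * h) ^+ 4).
  by apply: (@lhom_dvd 8) => //; apply: theta_at_lhom; exact: h2.
have -> : y i * y (i + 2 * q) + (y (i + q) * y q) ^+ 2
    = (y i + s ^+ 4) * t ^+ 4 + (y (i + 2 * q) + t ^+ 4) * s ^+ 4.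
  rewrite theta_at_rel -/s -/t.
  apply: (@laurent2_eq _ _ (y i * y (i + 2 * q) - s ^+ 4 * t ^+ 4)).
  by ring.
by apply: lhomD; rewrite -[1]addr0; apply: lhomM; rewrite ?addr0.
Qed.

Opaque theta_at.
Let o_lhom : lhom 8 1 o. Proof. exact: theta_at_lhom. Qed.
Let ob_lhom : lhom 8 1 ob. Proof. exact: theta_at_lhom. Qed.
Let oc_lhom : lhom 8 1 oc. Proof. exact: theta_at_lhom. Qed.
Let o1_lhom : lhom 8 1 (x1 + e1 ^+ 4).
Proof. by apply: theta_at_lhom; rewrite -[h]mul1n h2. Qed.
Let o5_lhom : lhom 8 1 (x5 + e5 ^+ 4).
Proof. by apply: theta_at_lhom; rewrite h2. Qed.
Let cd2 : (c * d) ^+ 2 = b * a + b * b ^+ 4 + a * c ^+ 4.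
Proof.
have := theta_at_rel 4 2; rewrite -[(4 + 2)%N]/6%N -[(4 + 2 * 2)%N]/8%N.
rewrite (ymod (_ : 8 * h = 4 %[mod l])%N); last by rewrite -[8%N]/(2 * 4)%N -mulnA h2.
rewrite (ymod (_ : 4 * h = 2 %[mod l])%N); last by rewrite -[4%N]/(2 * 2)%N -mulnA h2.
by rewrite mulrC.
Qed.
Let o_ob : o * ob = (c * d) ^+ 2 + (b * c) ^+ 4.
Proof. by rewrite cd2; ring. Qed.
Let x3c : (x3 * c) ^+ 2 = x1 * x5 + x1 * e5 ^+ 4 + x5 * e1 ^+ 4.
Proof. by have := theta_at_rel 1 2; rewrite mul1n. Qed.

Let P26_lhom : lhom 4 1 (c * d + (b * c) ^+ 2). Proof. exact: theta_at_lhom4 2 2. Qed.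
Let P37_lhom : lhom 4 1 (x3 * x7 + (x5 * c) ^+ 2). Proof. exact: theta_at_lhom4 3 2. Qed.
Let P46_lhom : lhom 4 1 (b * d + (x5 * x1) ^+ 2). Proof. exact: theta_at_lhom4 4 1. Qed.
Let P13_lhom : lhom 4 1 (x1 * x3 + (c * x1) ^+ 2). Proof. exact: theta_at_lhom4 1 1. Qed.
Let P15_lhom : lhom 4 1 (x1 * x5 + (x3 * c) ^+ 2). Proof. exact: theta_at_lhom4 1 2. Qed.

Lemma ideal_quo Gs M N : pev y M != 0 -> lies l base Gs M N ->
  ideal l u Gs (pev y N / pev y M).
Proof. exact: liesP. Qed.

Lemma named_quo M N Q : pev y M != 0 -> (exists cert, check l base (M ** Q ++ N) cert) ->
  pev y N / pev y M = pev y Q.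
Proof. by move=> M0 [cert]; exact: check_quo. Qed.

Let pevs := (pev_cat, pev_mul, pev_pow, pev_var_at).

Lemma inv_theta_pow Gs k N : lies l base Gs (pa ^^ k) N -> ideal l u Gs (pev y N * v ^+ k).
Proof.
move=> /(@ideal_quo _ _ _ _); rewrite pev_pow pev_var_at // exprVn; apply.
by rewrite expf_neq0.
Qed.

Lemma inv_theta Gs N : lies l base Gs pa N -> ideal l u Gs (pev y N * v).
Proof. by move=> /(@ideal_quo _ _ _ _); rewrite pev_var_at //; exact. Qed.

Lemma named_pow k N Q : (exists cert, check l base (pa ^^ k ** Q ++ N) cert) ->
  pev y N * v ^+ k = pev y Q.
Proof.
move=> /(@named_quo _ _ _ _); rewrite pev_pow pev_var_at // exprVn; apply.
by rewrite expf_neq0.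
Qed.

Lemma named_inv N Q : (exists cert, check l base (pa ** Q ++ N) cert) ->
  pev y N * v = pev y Q.
Proof. by move=> /(@named_quo _ _ _ _); rewrite pev_var_at //; exact. Qed.

Let nG f : ideal l u G f -> n f. Proof. exact: ideal_nil. Qed.
Let nS f : n f -> S f. Proof. exact: nil_ring. Qed.

Lemma nil_pow k N : lies l base G (pa ^^ k) N -> n (pev y N * v ^+ k).
Proof. by move/inv_theta_pow/nG. Qed.

Lemma nil_inv N : lies l base G pa N -> n (pev y N * v).
Proof. by move/inv_theta/nG. Qed.

Lemma nil_pev Q : supported G Q -> n (pev y Q).
Proof. by move=> QG; apply: nG; exact: ideal_pev. Qed.

Lemma named_tau k Q : (exists cert, check l base (pa ** pb ** Q ++ po ** k) cert) ->
  o * b ^+ 3 * v ^+ 2 = pev y k -> o ^+ 2 * b ^+ 2 * v ^+ 3 = pev y Q.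
Proof.
move=> /(@named_quo _ _ _ _); rewrite !pevs // mulf_neq0 // => /(_ isT) <- <-.
(* The extra b/b matches the factor b^3 of the numerator and the factor b of the divisor ab. *)
rewrite invfM; have {1}-> : b ^+ 2 = b ^+ 2 * (b / b) by rewrite divff ?mulr1.
by ring.
Qed.

Lemma level_b3 Gs Gs' f : (forall m, m \in Gs -> lies l base Gs' pa (pb ^^ 3 ** [:: m])) ->
  ideal l u Gs f -> ideal l u Gs' (b ^+ 3 * v * f).
Proof.
move=> hm; apply: span_map => g [m mG ->].
by have := inv_theta (hm m mG); rewrite !pevs // /pev big_seq1 mulrAC.
Qed.

Lemma level_theta Gs Gs' f :
  (forall m, m \in Gs -> lies l base Gs' (pa ^^ 2) ((pc ** pd) ^^ 2 ** [:: m])) ->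
  ideal l u Gs f -> ideal l u Gs' ((c * d) ^+ 2 * v ^+ 2 * f).
Proof.
move=> hm; apply: span_map => g [m mG ->].
by have := inv_theta_pow (hm m mG); rewrite !pevs // /pev big_seq1 mulrAC.
Qed.

Hypothesis certs : mult_certs l e base.

Lemma mult_theta i j : coprime j l -> (2 * j = i %[mod l])%N -> T (y j ^+ 4 / y i).
Proof.
move=> jl ij; rewrite -(ymod ij) theta_at_dbl.
apply: (mult_ratio l_odd e_dvd l_gt1 base0 certs).
by rewrite coprimezMl u_l coprimezE /= jl.
Qed.
Let pow2_l k : coprime (2 ^ k)%N l.
Proof. by rewrite coprimeXl // coprime2n. Qed.
Lemma h_coprime : coprime h l.
Proof.
have l2h : l%:Z = 2 * h%:Z - 1 by rewrite -[in LHS](odd_double_half l) l_odd; lia.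
have : coprimez h%:Z l%:Z by apply/coprimezP; exists (2, -1) => /=; rewrite l2h; ring.
by rewrite coprimezE.
Qed.
Let Tw : T w. Proof. exact: (mult_theta (pow2_l 2)). Qed.
Let Twb : T wb. Proof. exact: (mult_theta (pow2_l 1)). Qed.
Let Twc : T wc. Proof. exact: (mult_theta (pow2_l 0)). Qed.
Let Tw1 : T w1. Proof. by apply: (mult_theta h_coprime); rewrite -[h]mul1n h2. Qed.
Let sE : o * v = 1 + w. Proof. by rewrite mulrDl av. Qed.
Let Ts : T (o * v).
Proof. by rewrite sE; apply: multD => //; exact: mult1. Qed.
Let thetaE : (c * d) ^+ 2 * v = b * (1 + w + wb).
Proof.
rewrite cd2; exact: divide_theta.
Qed.
Let EE : E * v = b * (w + wb). Proof. exact: divide_eps. Qed.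
Let Trho : T (1 + w + wb).
Proof. by do 2!apply: multD => //; exact: mult1. Qed.
Let nb k : ~~ (e %| k)%N -> n (y k). Proof. exact: nil_theta. Qed.
Let Sy k : S (y k). Proof. exact: theta_ring_theta. Qed.
Let nD f g : n f -> n g -> n (f + g). Proof. exact: spanD. Qed.
Let nZ s f : S s -> n f -> n (s * f). Proof. exact: spanZ. Qed.
Let SX f k : S f -> S (f ^+ k). Proof. exact: theta_ringX. Qed.

(** One factor (cd)^2/a is b times a multiplier. Moving that b onto the other factors gives the
    quotient in the hypothesis. *)
Lemma theta_cd_E : n ((c * d) ^+ 2 * E * b * v ^+ 3) -> n ((c * d * v) ^+ 4 * E).
Proof.
move=> zn; have -> : (c * d * v) ^+ 4 * E
    = (c * d) ^+ 2 * v * ((c * d) ^+ 2 * E * v ^+ 3) by ring.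
rewrite thetaE; have -> : b * (1 + w + wb) * ((c * d) ^+ 2 * E * v ^+ 3)
   = (1 + w + wb) * ((c * d) ^+ 2 * E * b * v ^+ 3) by ring.
exact: Trho.
Qed.

Lemma theta_cd_o : n (o * (c * d) ^+ 2 * b * v ^+ 3) -> S ((c * d * v) ^+ 4 * o).
Proof.
move=> xn; have -> : (c * d * v) ^+ 4 * o
    = (c * d) ^+ 2 * v * (o * (c * d) ^+ 2 * v ^+ 3) by ring.
rewrite thetaE; have -> : b * (1 + w + wb) * (o * (c * d) ^+ 2 * v ^+ 3)
   = (1 + w + wb) * (o * (c * d) ^+ 2 * b * v ^+ 3) by ring.
by apply: nS; exact: Trho.
Qed.

Lemma target_16_4 : n ((c * d) ^+ 2 * E * b * v ^+ 3) -> S (laurent_proj 16 4 v).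
Proof.
move=> /theta_cd_E zn.
rewrite (proj_inv_b2 a0 o_lhom 8 2) (proj_b2v_b3 a0 o_lhom 4 1).
rewrite (proj41_b3v a0 o_lhom ob_lhom o_ob).
by do 2!apply: SX; exact: nS.
Qed.

Lemma target_8_2 : S ((c * d * v) ^+ 4 * o) -> S (laurent_proj 8 2 v).
Proof.
move=> xS; rewrite (proj_inv_b2 a0 o_lhom 4 1).
by rewrite (proj41_b2v a0 o_lhom ob_lhom o_ob); exact: SX.
Qed.

(** In this and the similar lemmas the suffix counts the factors b^4 of the quotient assumed to be
    in the ideal; what remains is a product of the multipliers b^4/a and o/a. *)
Lemma target_8_1_pow3 : n (o * b ^+ 12 * v ^+ 5) -> S (laurent_proj 8 1 v).
Proof.
move=> gn; rewrite (proj81_inv c a0 o_lhom).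
have -> : o * b ^+ 24 * v ^+ 8 = w ^+ 3 * (o * b ^+ 12 * v ^+ 5) by ring.
by apply: nS; exact: (multX 3 Tw).
Qed.

Lemma target_8_1_pow4 : n (o * b ^+ 16 * v ^+ 6) -> S (laurent_proj 8 1 v).
Proof.
move=> gn; rewrite (proj81_inv c a0 o_lhom).
have -> : o * b ^+ 24 * v ^+ 8 = w ^+ 2 * (o * b ^+ 16 * v ^+ 6) by ring.
by apply: nS; exact: (multX 2 Tw).
Qed.

Lemma target_8_3_pow3 : n (o * b ^+ 12 * v ^+ 5) -> S (laurent_proj 8 3 v).
Proof.
move=> gn; rewrite (proj83_inv c a0 o_lhom).
have -> : o ^+ 3 * b ^+ 16 * v ^+ 8 = (o * v) ^+ 2 * (w * (o * b ^+ 12 * v ^+ 5)) by ring.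
by apply: nS; apply: (multX 2 Ts); exact: Tw.
Qed.

Lemma target_8_3_pow4 : n (o * b ^+ 16 * v ^+ 6) -> S (laurent_proj 8 3 v).
Proof.
move=> gn; rewrite (proj83_inv c a0 o_lhom).
have -> : o ^+ 3 * b ^+ 16 * v ^+ 8 = (o * v) ^+ 2 * (o * b ^+ 16 * v ^+ 6) by ring.
by apply: nS; exact: (multX 2 Ts).
Qed.

Lemma target_8_3_pow1 : n (o ^+ 3 * b ^+ 4 * v ^+ 5) -> S (laurent_proj 8 3 v).
Proof.
move=> gn; rewrite (proj83_inv c a0 o_lhom).
have -> : o ^+ 3 * b ^+ 16 * v ^+ 8 = w ^+ 3 * (o ^+ 3 * b ^+ 4 * v ^+ 5) by ring.
by apply: nS; exact: (multX 3 Tw).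
Qed.

Lemma target_8_5 : n (o ^+ 3 * b ^+ 4 * v ^+ 5) -> S (laurent_proj 8 5 v).
Proof.
move=> gn; rewrite (proj85_inv c a0 o_lhom).
have -> : o ^+ 5 * b ^+ 8 * v ^+ 8 = (o * v) ^+ 2 * (w * (o ^+ 3 * b ^+ 4 * v ^+ 5)) by ring.
by apply: nS; apply: (multX 2 Ts); exact: Tw.
Qed.

Lemma target_8_6 : n (E ^+ 2 * v ^+ 4 * o) -> S (laurent_proj 8 6 v).
Proof.
move=> yn; rewrite (proj_inv_b2 a0 o_lhom 4 3).
by rewrite (proj43_b2v a0 o_lhom ob_lhom o_ob); apply: SX; exact: nS.
Qed.

(** Since E^2 = a^2 c^8 + b^10, the quotient is c^5 times the first hypothesis plus b^4/a times the
    second. *)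
Lemma square_E_o : n (o * c ^+ 3 * v ^+ 2) -> n (o * b ^+ 6 * v ^+ 3) ->
  n (E ^+ 2 * v ^+ 4 * o).
Proof.
move=> mn kn.
have -> : E ^+ 2 * v ^+ 4 * o = (a * v) ^+ 2 * (c ^+ 5 * (o * c ^+ 3 * v ^+ 2))
    + w * (o * b ^+ 6 * v ^+ 3) by rewrite laurent2_sqrD; ring.
rewrite av expr1n mul1r; apply: nD; last exact: Tw.
by apply: nZ => //; exact: SX.
Qed.

Lemma target_16_10 : n (E ^+ 2 * v ^+ 4 * o) -> S (laurent_proj 16 10 v).
Proof.
move=> yn; rewrite (proj_inv_b2 a0 o_lhom 8 5) (proj85_b2v a0 o_lhom ob_lhom).
have -> : o ^+ 3 * b ^+ 8 * E ^+ 2 * v ^+ 8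
  = (o * v) ^+ 2 * (w ^+ 2 * (E ^+ 2 * v ^+ 4 * o)) by ring.
by apply: SX; apply: nS; apply: (multX 2 Ts); exact: (multX 2 Tw).
Qed.

Let Twwb : T (w + wb). Proof. exact: multD. Qed.

(** The factor b^2 of the hypothesis is supplied by (E/a)^2, which is b^2 times the square of a
    multiplier. *)
Lemma target_16_14 : n (o ^+ 2 * b ^+ 2 * v ^+ 3) -> S (laurent_proj 16 14 v).
Proof.
move=> tn; rewrite (proj_inv_b2 a0 o_lhom 8 7) (proj87_b2v a0 o_lhom ob_lhom).
have -> : o ^+ 5 * E ^+ 2 * v ^+ 8 = (o * v) ^+ 3 * ((E * v) ^+ 2 * (o ^+ 2 * v ^+ 3)) by ring.
rewrite EE; have -> : (b * (w + wb)) ^+ 2 * (o ^+ 2 * v ^+ 3)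
  = (w + wb) ^+ 2 * (o ^+ 2 * b ^+ 2 * v ^+ 3) by move: (w + wb) => t; ring.
by apply: SX; apply: nS; apply: (multX 3 Ts); exact: (multX 2 Twwb).
Qed.

Lemma target_16_6 : n (o * b ^+ 16 * v ^+ 6) -> S (laurent_proj 16 6 v).
Proof.
move=> gn; rewrite (proj_inv_b2 a0 o_lhom 8 3) (proj83_b2v a0 o_lhom ob_lhom).
have -> : o * b ^+ 16 * E ^+ 2 * v ^+ 8 = (E * v) ^+ 2 * (o * b ^+ 16 * v ^+ 6) by ring.
rewrite EE; have -> : (b * (w + wb)) ^+ 2 * (o * b ^+ 16 * v ^+ 6)
  = (w + wb) ^+ 2 * (b ^+ 2 * (o * b ^+ 16 * v ^+ 6)) by move: (w + wb) => t; ring.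
apply: SX; apply: nS; apply: (multX 2 Twwb); apply: nZ => //; exact: SX.
Qed.

Lemma target_32_12 : n ((c * d) ^+ 2 * E * b * v ^+ 3) ->
  S (E ^+ 2 * o * v ^+ 4 * (w * c + oc) ^+ 4) -> S (laurent_proj 32 12 v).
Proof.
move=> /theta_cd_E zn xS.
rewrite (proj_inv_b2 a0 o_lhom 16 6) (proj_b2v_b3 a0 o_lhom 8 3).
rewrite (proj83_b3v a0 o_lhom ob_lhom oc_lhom o_ob).
do 2!apply: SX; apply: theta_ringD => //; apply: theta_ringM.
  by apply: theta_ringD => //; exact: SX.
by apply: SX; exact: nS.
Qed.

Lemma class_3_y : ~~ (e %| 2)%N -> n (E ^+ 2 * v ^+ 4 * o) ->
  S (E ^+ 2 * o * v ^+ 4 * (w * c + oc) ^+ 4).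
Proof.
move=> e2 yn; rewrite (_ : E ^+ 2 * o * v ^+ 4 = E ^+ 2 * v ^+ 4 * o); last by ring.
apply: theta_ringM; [exact: nS|apply: SX; apply: theta_ringD].
  by apply: nS; apply: Tw; exact: nb.
by apply: theta_ringD => //; exact: SX.
Qed.

(** Two of the factors b come from (E/a)^2. The third comes from the fourth power, because w c + oc
    is c times a multiplier and c^4 = (c^4/b) b. *)
Lemma class_3_kappa : n (o * b ^+ 3 * v ^+ 2) ->
  S (E ^+ 2 * o * v ^+ 4 * (w * c + oc) ^+ 4).
Proof.
move=> kn.
have cE : c ^+ 4 = wb * b by rewrite divfK.
have oE : oc = c * (1 + wc) by rewrite mulrDr mulr1 [c * wc]mulrC divfK.
have -> : E ^+ 2 * o * v ^+ 4 * (w * c + oc) ^+ 4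
  = (E * v) ^+ 2 * (o * v ^+ 2) * (w * c + oc) ^+ 4 by move: (w * c + oc) => t; ring.
(* The ratios are generalised to variables so that [ring] does not unfold them into inverses. *)
have K W WB WC : c ^+ 4 = WB * b ->
    (b * (W + WB)) ^+ 2 * (o * v ^+ 2) * (W * c + c * (1 + WC)) ^+ 4
    = (W + WB) ^+ 2 * (WB * ((W + (1 + WC)) ^+ 4 * (o * b ^+ 3 * v ^+ 2))).
  move=> e4; have -> : W * c + c * (1 + WC) = c * (W + (1 + WC)) by ring.
  by rewrite [(c * _) ^+ 4]exprMn e4; ring.
rewrite EE oE (K w wb wc cE).
apply: nS; apply: (multX 2 Twwb); apply: Twb; apply: multX kn.
by apply: multD => //; apply: multD => //; exact: mult1.
Qed.

(** The fourth power is additive: the summand w^4 c^4 produces o b^16/a^6, and oc^4 produces the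
    other quotient. *)
Lemma class_3_phi : n (o * b ^+ 16 * v ^+ 6) -> n (oc * b * o * v ^+ 2) ->
  S (E ^+ 2 * o * v ^+ 4 * (w * c + oc) ^+ 4).
Proof.
move=> gn fn.
have -> : (w * c + oc) ^+ 4 = w ^+ 4 * c ^+ 4 + oc ^+ 4.
  by rewrite -[4%N]/(2 * 2)%N !exprM !laurent2_sqrD; ring.
have -> : E ^+ 2 * o * v ^+ 4 * (w ^+ 4 * c ^+ 4 + oc ^+ 4)
  = (E * v) ^+ 2 * (c ^+ 4 * (o * b ^+ 16 * v ^+ 6) + oc ^+ 4 * (o * v ^+ 2)) by ring.
rewrite EE; have -> : (b * (w + wb)) ^+ 2 * (c ^+ 4 * (o * b ^+ 16 * v ^+ 6) + oc ^+ 4 * (o *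
  v ^+ 2))
   = (w + wb) ^+ 2 * (b ^+ 2 * c ^+ 4 * (o * b ^+ 16 * v ^+ 6) + oc ^+ 3 * b * (oc * b * o * v
     ^+ 2)).
  by move: (w + wb) => t; ring.
apply: nS; apply: (multX 2 Twwb); apply: nD; apply: nZ => //.
  by apply: theta_ringM; exact: SX.
by apply: theta_ringM => //; apply: SX; apply: theta_ringD => //; exact: SX.
Qed.

(** * Projections obtained through the relation H^2 = abcd + K *)

Hypothesis H2 : exists cert, check l base
  ((p1 ^^ 2 ** p3 ** p7 ++ pc ^^ 2 ** pb ** pd ++ p1 ** p3 ** p5 ^^ 2) ^^ 2
   ++ pa ** pb ** pc ** pd ++ ((pc ** pd) ^^ 3 ++ pa ** pb ^^ 3 ** pc ^^ 2)) cert.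

Let HH : H ^+ 2 = a * b * c * d + K.
Proof.
have [cert /(checkP l_odd base0 u_l)] := H2; rewrite !pevs // => hh.
apply: (@laurent2_eq _ _ (- (a * b * c * d + K))).
by rewrite -[RHS]addr0 -hh; ring.
Qed.

Lemma target_16_8 : lies l base G (pa ^^ 2) ((pc ** pd) ^^ 3 ++ pa ** pb ^^ 3 ** pc ^^ 2) ->
  S (laurent_proj 16 8 v).
Proof.
move=> /inv_theta_pow /nG; rewrite !pevs // => nu.
rewrite (proj_inv_b2 a0 o_lhom 8 4) (proj_b2v_b3 a0 o_lhom 4 2).
rewrite (proj_b3v_bcd a0 o_lhom ob_lhom o_ob 2 1).
rewrite (proj21_bcdv a0 o_lhom ob_lhom o_ob P26_lhom HH).
by do 3!apply: SX; exact: nS.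
Qed.

Hypothesis t1_lies : lies l base G pa (p1 ^^ 2 ** p3 ** p7).
Hypothesis t5_lies : lies l base G pa (p1 ** p3 ** p5 ^^ 2).
Hypothesis t2_lies : lies l base G pa (p1 ** pc ** pb ** pd).
Hypothesis sigma_lies : lies l base G pa ((p1 ** pc ** p5) ^^ 2).
Hypothesis delta_lies : lies l base G (pa ^^ 2) (po ** (pc ** pb ** pd)).
Let t1n : n (x1 ^+ 2 * x3 * x7 * v).
Proof. by have /nG := inv_theta t1_lies; rewrite !pevs. Qed.
Let t5n : n (x1 * x3 * x5 ^+ 2 * v).
Proof. by have /nG := inv_theta t5_lies; rewrite !pevs. Qed.
Let t2n : n (x1 * c * b * d * v).
Proof. by have /nG := inv_theta t2_lies; rewrite !pevs. Qed.
Let sigman : n ((x1 * c * x5) ^+ 2 * v).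
Proof. by have /nG := inv_theta sigma_lies; rewrite !pevs. Qed.
Let deltan : n (o * (c * b * d) * v ^+ 2).
Proof. by have /nG := inv_theta_pow delta_lies; rewrite !pevs. Qed.
(** H/a itself is not placed in the ideal: for its term c^2 b d/a this is only done after
    multiplication by o/a, through [delta_lies]. *)
Let sHv : n (o * v * (H * v)).
Proof.
have -> : o * v * (H * v) = o * v * (x1 ^+ 2 * x3 * x7 * v + x1 * x3 * x5 ^+ 2 * v)
   + c * (o * (c * b * d) * v ^+ 2) by ring.
by apply: nD; [apply: Ts; exact: nD|apply: nZ].
Qed.

Lemma target_32_0 : S (laurent_proj 32 0 v).
Proof.
rewrite (proj_inv_b2 a0 o_lhom 16 0) (proj_b2v_b3 a0 o_lhom 8 0).
rewrite (proj_b3v_bcd a0 o_lhom ob_lhom o_ob 4 0).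
rewrite (proj_bcdv_H a0 o_lhom ob_lhom o_ob P26_lhom HH 2 0).
rewrite (proj20_Hv a0 o_lhom P37_lhom P46_lhom P13_lhom o1_lhom oc_lhom o5_lhom).
do 4!apply: SX; apply: nS; apply: nD => //.
by rewrite (_ : o * H * v ^+ 2 = o * v * (H * v)) //; ring.
Qed.

Hypothesis Tw5 : T w5.
Hypothesis x50 : x5 != 0.
Let e1E : e1 ^+ 4 = w1 * x1. Proof. by rewrite divfK. Qed.
Let e5E : e5 ^+ 4 = w5 * x5. Proof. by rewrite divfK. Qed.
Let x1E : x1 ^+ 4 = wc * c. Proof. by rewrite divfK. Qed.

(** Writing e1^8 as w1^2 x1^2 leaves, up to multipliers, x1^2 x3 x7/a and (x1 c x5)^2/a, both in the
    ideal. The next two terms are treated in the same way. *)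
Let term37 : n (b ^+ 4 * (e1 ^+ 8 * (x3 * x7 + (x5 * c) ^+ 2)) * v ^+ 2).
Proof.
have -> : b ^+ 4 * (e1 ^+ 8 * (x3 * x7 + (x5 * c) ^+ 2)) * v ^+ 2
  = w * ((e1 ^+ 4) ^+ 2 * (x3 * x7 + (x5 * c) ^+ 2) * v) by ring.
rewrite e1E; have -> : (w1 * x1) ^+ 2 * (x3 * x7 + (x5 * c) ^+ 2) * v
  = w1 ^+ 2 * (x1 ^+ 2 * x3 * x7 * v + (x1 * c * x5) ^+ 2 * v) by ring.
by apply: Tw; apply: (multX 2 Tw1); exact: nD.
Qed.

Let term46 : n (b ^+ 4 * (x1 ^+ 8 * (b * d + (x5 * x1) ^+ 2)) * v ^+ 2).
Proof.
have -> : b ^+ 4 * (x1 ^+ 8 * (b * d + (x5 * x1) ^+ 2)) * v ^+ 2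
  = w * (x1 ^+ 4 * (x1 * x1 ^+ 3) * b * d * v + (x1 ^+ 4 * x5 * x1) ^+ 2 * v) by ring.
rewrite x1E; have -> : wc * c * (x1 * x1 ^+ 3) * b * d * v + (wc * c * x5 * x1) ^+ 2 * v
  = wc * (x1 ^+ 3 * (x1 * c * b * d * v)) + wc ^+ 2 * ((x1 * c * x5) ^+ 2 * v) by ring.
apply: Tw; apply: nD; last exact: (multX 2 Twc).
by apply: Twc; apply: nZ => //; exact: SX.
Qed.

Let term13 : n (b ^+ 4 * (e5 ^+ 8 * (x1 * x3 + (c * x1) ^+ 2)) * v ^+ 2).
Proof.
have -> : b ^+ 4 * (e5 ^+ 8 * (x1 * x3 + (c * x1) ^+ 2)) * v ^+ 2
  = w * ((e5 ^+ 4) ^+ 2 * (x1 * x3 + (c * x1) ^+ 2) * v) by ring.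
rewrite e5E; have -> : (w5 * x5) ^+ 2 * (x1 * x3 + (c * x1) ^+ 2) * v
  = w5 ^+ 2 * (x1 * x3 * x5 ^+ 2 * v + (x1 * c * x5) ^+ 2 * v) by ring.
by apply: Tw; apply: (multX 2 Tw5); exact: nD.
Qed.

Local Notation Y := (x1 ^+ 4 * (x3 * c) ^+ 2 + (c + x1 ^+ 4) * (x1 * x5 + (x3 * c) ^+ 2)).
(** By [x3c], x1 x5 + (x3 c)^2 = x1 e5^4 + x5 e1^4, so Y = x1^5 x5 + c (x1 e5^4 + x5 e1^4). Each
    fourth power is a multiplier times a theta series, which makes Y a multiplier times x1 c x5. *)
Let termY : n (o * Y ^+ 2 * v ^+ 2).
Proof.
have YE W1 WC W5 : e1 ^+ 4 = W1 * x1 -> x1 ^+ 4 = WC * c -> e5 ^+ 4 = W5 * x5 ->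
    Y = (W1 + WC + W5) * (x1 * c * x5).
  move=> E1 E2 E5; rewrite x3c E1 E5 E2.
  apply: (@laurent2_eq _ _ (c * (x1 * x5) + WC * c * (x1 * x5 + x1 * (W5 * x5) + x5 * (W1 *
    x1)))).
  by ring.
rewrite (YE _ _ _ e1E x1E e5E).
rewrite (_ : _ * v ^+ 2 = o * v * ((w1 + wc + w5) ^+ 2 * ((x1 * c * x5) ^+ 2 * v))).
  by apply: Ts; apply: multX sigman; do 2!apply: multD => //.
by move: (w1 + wc + w5) => t; ring.
Qed.

Lemma target_64_16 : S (laurent_proj 64 16 v).
Proof.
rewrite (proj_inv_b2 a0 o_lhom 32 8) (proj_b2v_b3 a0 o_lhom 16 4).
rewrite (proj_b3v_bcd a0 o_lhom ob_lhom o_ob 8 2).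
rewrite (proj_bcdv_H a0 o_lhom ob_lhom o_ob P26_lhom HH 4 1).
rewrite (proj41_Hv a0 o_lhom P37_lhom P46_lhom P13_lhom P15_lhom o1_lhom oc_lhom o5_lhom).
do 4!apply: SX; apply: nS; apply: nD.
  have -> t p q r z : (t * (p + q + r) + z) * v ^+ 2
     = t * p * v ^+ 2 + t * q * v ^+ 2 + t * r * v ^+ 2 + z * v ^+ 2 :> L2 by ring.
  exact: (nD (nD (nD term37 term46) term13) termY).
have -> : (b ^+ 4 * (H + (x1 * c * x5) ^+ 2) + o * (x1 * c * x5) ^+ 2) * o ^+ 2 * v ^+ 4
   = w * (o * v * (o * v * (H * v))) + (w * (o * v) ^+ 2 + (o * v) ^+ 3) * ((x1 * c * x5) ^+ 2
     * v).
  by ring.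
apply: nD; first by apply: Tw; exact: Ts.
by apply: multD sigman; [apply: multM => //|]; exact: multX.
Qed.
End Targets.

(** * The nine projections for l = 11 *)

Section Quotients11.
Variable u : int.
Hypothesis u_l : coprimez u 11%:Z.
Local Notation y := (theta_at 11 u).
Local Notation a := (y 8).
Local Notation b := (y 4).
Local Notation c := (y 2).
Local Notation d := (y 6).
Local Notation v := (a^-1).
Local Notation o := (a + b ^+ 4).
Local Notation oc := (c + y 1 ^+ 4).
Local Notation E := (a * c ^+ 4 + b ^+ 5).
Local Notation S := (theta_ring 11).
Local Notation n := (nil_ideal 11 11).

Let l_odd : odd 11 := isT.
Let l_gt1 : (1 < 11)%N := isT.
Let e_dvd : (11 %| 11)%N := isT.
Let base0 := base11_vanish.
Let certs := mult11.
Let pevs := (pev_cat, pev_mul, pev_pow, @pev_var_at 11 l_odd u).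

Let zeta_n : n ((c * d) ^+ 2 * E * b * v ^+ 3).
Proof. by have := nil_pow l_odd l_gt1 e_dvd base0 u_l zeta_11; rewrite !pevs. Qed.

Let kapE : o * b ^+ 3 * v ^+ 2 = pev y kap_11.
Proof. by have := named_pow l_odd l_gt1 base0 u_l kap_11_quo; rewrite !pevs. Qed.

Let kap1E : o * b ^+ 6 * v ^+ 3 = pev y kap1_11.
Proof.
have := named_inv l_odd l_gt1 base0 u_l kap1_11_quo; rewrite !pevs => <-.
by rewrite -kapE; ring.
Qed.

Let kap2E : o * b ^+ 9 * v ^+ 4 = pev y kap2_11.
Proof.
have := named_inv l_odd l_gt1 base0 u_l kap2_11_quo; rewrite !pevs => <-.
by rewrite -kap1E; ring.
Qed.

Let g_n : n (o * b ^+ 12 * v ^+ 5).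
Proof.
have := nil_inv l_odd l_gt1 e_dvd base0 u_l g_11; rewrite !pevs -kap2E.
by congr n; ring.
Qed.

Let E2_n : n (E ^+ 2 * v ^+ 4 * o).
Proof.
apply: (square_E_o l_odd l_gt1 e_dvd base0 u_l certs).
  by have := nil_pow l_odd l_gt1 e_dvd base0 u_l mu_11; rewrite !pevs.
by rewrite kap1E; apply: nil_pev.
Qed.

Let mult_w5 : multiplier 11 11 (y (5 * (11./2).+1) ^+ 4 / y 5).
Proof. exact: (mult_theta l_odd l_gt1 e_dvd base0 u_l certs). Qed.

Let y5_neq0 : y 5 != 0.
Proof. exact: theta_at_neq0. Qed.

Lemma targets11 qj : qj \in [:: (8, 1); (8, 3); (8, 6); (16, 4); (16, 8); (16, 10); (32, 0);
  (32, 12); (64, 16)]%N -> S (laurent_proj qj.1 qj.2 v).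
Proof.
rewrite !inE.
case/orP=> [/eqP->|]; first exact: (target_8_1_pow3 l_odd l_gt1 e_dvd base0 u_l certs g_n).
case/orP=> [/eqP->|]; first exact: (target_8_3_pow3 l_odd l_gt1 e_dvd base0 u_l certs g_n).
case/orP=> [/eqP->|]; first exact: (target_8_6 l_odd l_gt1 e_dvd u_l E2_n).
case/orP=> [/eqP->|]; first exact: (target_16_4 l_odd l_gt1 e_dvd base0 u_l certs zeta_n).
case/orP=> [/eqP->|]; first exact: (target_16_8 l_odd l_gt1 e_dvd base0 u_l H2_11 nu_11).
case/orP=> [/eqP->|]; first exact: (target_16_10 l_odd l_gt1 e_dvd base0 u_l certs E2_n).
case/orP=> [/eqP->|]; first exact: (target_32_0 l_odd l_gt1 e_dvd base0 u_l certs H2_11 t1_11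
  t5_11 sigma_11 delta_11).
case/orP=> [/eqP->|]; first exact: (target_32_12 l_odd l_gt1 e_dvd base0 u_l certs zeta_n
  (class_3_y l_odd l_gt1 e_dvd base0 u_l certs isT E2_n)).
move/eqP->; exact: (target_64_16 l_odd l_gt1 e_dvd base0 u_l certs H2_11 t1_11 t5_11 t2_11
  sigma_11 delta_11 mult_w5 y5_neq0).
Qed.
End Quotients11.

(** * The nine projections for l = 13 *)

Section Quotients13.
Variable u : int.
Hypothesis u_l : coprimez u 13%:Z.
Local Notation y := (theta_at 13 u).
Local Notation a := (y 8).
Local Notation b := (y 4).
Local Notation c := (y 2).
Local Notation d := (y 6).
Local Notation v := (a^-1).
Local Notation o := (a + b ^+ 4).
Local Notation oc := (c + y 1 ^+ 4).
Local Notation E := (a * c ^+ 4 + b ^+ 5).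
Local Notation S := (theta_ring 13).
Local Notation n := (nil_ideal 13 13).

Let l_odd : odd 13 := isT.
Let l_gt1 : (1 < 13)%N := isT.
Let e_dvd : (13 %| 13)%N := isT.
Let base0 := base13_vanish.
Let certs := mult13.
Let pevs := (pev_cat, pev_mul, pev_pow, @pev_var_at 13 l_odd u).

Let zeta_n : n ((c * d) ^+ 2 * E * b * v ^+ 3).
Proof. by have := nil_pow l_odd l_gt1 e_dvd base0 u_l zeta_13; rewrite !pevs. Qed.

Let kapE : o * b ^+ 3 * v ^+ 2 = pev y kap_13.
Proof. by have := named_pow l_odd l_gt1 base0 u_l kap_13_quo; rewrite !pevs. Qed.

Let tauE : o ^+ 2 * b ^+ 2 * v ^+ 3 = pev y tau_13.
Proof. exact: (named_tau l_odd l_gt1 base0 u_l tau_13_quo). Qed.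

Let kap_n : n (o * b ^+ 3 * v ^+ 2).
Proof. by rewrite kapE; apply: nil_pev. Qed.

Let tau_n : n (o ^+ 2 * b ^+ 2 * v ^+ 3).
Proof. by rewrite tauE; apply: nil_pev. Qed.

Let g_n : n (o ^+ 3 * b ^+ 4 * v ^+ 5).
Proof.
have := nil_pow l_odd l_gt1 e_dvd base0 u_l g_13; rewrite !pevs -tauE.
by congr n; ring.
Qed.

Let x_S : S ((c * d * v) ^+ 4 * o).
Proof.
apply: (theta_cd_o l_odd l_gt1 e_dvd base0 u_l certs).
by have := nil_pow l_odd l_gt1 e_dvd base0 u_l x1_13; rewrite !pevs.
Qed.

Let mult_w5 : multiplier 13 13 (y (5 * (13./2).+1) ^+ 4 / y 5).
Proof. exact: (mult_theta l_odd l_gt1 e_dvd base0 u_l certs). Qed.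

Let y5_neq0 : y 5 != 0.
Proof. exact: theta_at_neq0. Qed.

Lemma targets13 qj : qj \in [:: (8, 2); (8, 3); (8, 5); (16, 4); (16, 8); (16, 14); (32, 0);
  (32, 12); (64, 16)]%N -> S (laurent_proj qj.1 qj.2 v).
Proof.
rewrite !inE.
case/orP=> [/eqP->|]; first exact: (target_8_2 l_odd l_gt1 e_dvd u_l x_S).
case/orP=> [/eqP->|]; first exact: (target_8_3_pow1 l_odd l_gt1 e_dvd base0 u_l certs g_n).
case/orP=> [/eqP->|]; first exact: (target_8_5 l_odd l_gt1 e_dvd base0 u_l certs g_n).
case/orP=> [/eqP->|]; first exact: (target_16_4 l_odd l_gt1 e_dvd base0 u_l certs zeta_n).
case/orP=> [/eqP->|]; first exact: (target_16_8 l_odd l_gt1 e_dvd base0 u_l H2_13 nu_13).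
case/orP=> [/eqP->|]; first exact: (target_16_14 l_odd l_gt1 e_dvd base0 u_l certs tau_n).
case/orP=> [/eqP->|]; first exact: (target_32_0 l_odd l_gt1 e_dvd base0 u_l certs H2_13 t1_13
  t5_13 sigma_13 delta_13).
case/orP=> [/eqP->|]; first exact: (target_32_12 l_odd l_gt1 e_dvd base0 u_l certs zeta_n
  (class_3_kappa l_odd l_gt1 e_dvd base0 u_l certs kap_n)).
move/eqP->; exact: (target_64_16 l_odd l_gt1 e_dvd base0 u_l certs H2_13 t1_13 t5_13 t2_13
  sigma_13 delta_13 mult_w5 y5_neq0).
Qed.
End Quotients13.

(** * The nine projections for l = 15 *)

Section Quotients15.
Variable u : int.
Hypothesis u_l : coprimez u 15%:Z.
Local Notation y := (theta_at 15 u).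
Local Notation a := (y 8).
Local Notation b := (y 4).
Local Notation c := (y 2).
Local Notation d := (y 6).
Local Notation v := (a^-1).
Local Notation o := (a + b ^+ 4).
Local Notation oc := (c + y 1 ^+ 4).
Local Notation E := (a * c ^+ 4 + b ^+ 5).
Local Notation S := (theta_ring 15).
Local Notation n := (nil_ideal 15 5).

Let l_odd : odd 15 := isT.
Let l_gt1 : (1 < 15)%N := isT.
Let e_dvd : (5 %| 15)%N := isT.
Let base0 := base15_vanish.
Let certs := mult15.
Let pevs := (pev_cat, pev_mul, pev_pow, @pev_var_at 15 l_odd u).

Let zeta_n : n ((c * d) ^+ 2 * E * b * v ^+ 3).
Proof. by have := nil_pow l_odd l_gt1 e_dvd base0 u_l zeta_15; rewrite !pevs. Qed.

Let hE : o * b ^+ 4 * v ^+ 2 = pev y h_15.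
Proof. by have := named_pow l_odd l_gt1 base0 u_l h_15_quo; rewrite !pevs. Qed.

Let g_n : n (o * b ^+ 16 * v ^+ 6).
Proof.
have := inv_theta l_odd l_gt1 base0 u_l p_15; rewrite !pevs -hE.
(* [p_15] already contains one factor b^3/a; three more give (b^3/a)^4 times o b^4/a^2. *)
move/(level_b3 l_odd l_gt1 base0 u_l b3_gens2_step)/(level_b3 l_odd l_gt1 base0 u_l
  b3_gens1_step).
move/(level_b3 l_odd l_gt1 base0 u_l b3_gens0_step)/(ideal_nil e_dvd u_l).
by congr n; ring.
Qed.

Let x_S : S ((c * d * v) ^+ 4 * o).
Proof.
have := inv_theta_pow l_odd l_gt1 base0 u_l sth_15; rewrite !pevs.
move/(level_theta l_odd l_gt1 base0 u_l theta_gens_step)/ideal_ring => xS.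
have -> : (c * d * v) ^+ 4 * o = (c * d) ^+ 2 * v ^+ 2 * (o * (c * d) ^+ 2 * v ^+ 2) by ring.
exact: xS.
Qed.

Let phi_n : n (oc * b * o * v ^+ 2).
Proof. by have := nil_pow l_odd l_gt1 e_dvd base0 u_l phi_15; rewrite !pevs. Qed.

Let y5_neq0 : y 5 != 0.
Proof. exact: theta_at_neq0. Qed.

Let mult_w5 : multiplier 15 5 (y (5 * (15./2).+1) ^+ 4 / y 5).
Proof.
(* 5 is not prime to 15, so [mult_theta] does not apply; but 40 = -5 modulo 15, and the ratio is
   simply the cube of X_5u. *)
have -> : y (5 * (15./2).+1) = y 5 by rewrite -[LHS]theta_at_index // -[RHS]theta_at_index.
by rewrite exprSr mulfK //; apply: multS; apply: theta_ringX; exact: theta_ring_theta.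
Qed.

Lemma targets15 qj : qj \in [:: (8, 1); (8, 2); (8, 3); (16, 4); (16, 6); (16, 8); (32, 0);
  (32, 12); (64, 16)]%N -> S (laurent_proj qj.1 qj.2 v).
Proof.
rewrite !inE.
case/orP=> [/eqP->|]; first exact: (target_8_1_pow4 l_odd l_gt1 e_dvd base0 u_l certs g_n).
case/orP=> [/eqP->|]; first exact: (target_8_2 l_odd l_gt1 e_dvd u_l x_S).
case/orP=> [/eqP->|]; first exact: (target_8_3_pow4 l_odd l_gt1 e_dvd base0 u_l certs g_n).
case/orP=> [/eqP->|]; first exact: (target_16_4 l_odd l_gt1 e_dvd base0 u_l certs zeta_n).
case/orP=> [/eqP->|]; first exact: (target_16_6 l_odd l_gt1 e_dvd base0 u_l certs g_n).
case/orP=> [/eqP->|]; first exact: (target_16_8 l_odd l_gt1 e_dvd base0 u_l H2_15 nu_15).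
case/orP=> [/eqP->|]; first exact: (target_32_0 l_odd l_gt1 e_dvd base0 u_l certs H2_15 t1_15
  t5_15 sigma_15 delta_15).
case/orP=> [/eqP->|]; first exact: (target_32_12 l_odd l_gt1 e_dvd base0 u_l certs zeta_n
  (class_3_phi l_odd l_gt1 e_dvd base0 u_l certs g_n phi_n)).
move/eqP->; exact: (target_64_16 l_odd l_gt1 e_dvd base0 u_l certs H2_15 t1_15 t5_15 t2_15
  sigma_15 delta_15 mult_w5 y5_neq0).
Qed.
End Quotients15.

Lemma theta_unit l (r k : int) : odd l -> (8 * k = 1 %[mod l%:Z])%Z -> coprimez r l%:Z ->
  exists2 u, coprimez u l%:Z & theta l r = theta_at l u 8.
Proof.
move=> l_odd k8 rl; have /eqP := k8; rewrite eqz_mod_dvd => /dvdzP[q qE].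
exists (r * k).
  rewrite coprimezMl rl /=; apply/coprimezP; exists (8, - q) => /=.
  by rewrite mulNr -qE; ring.
apply: theta_mod; apply/esym; rewrite mulrCA -modzMmr k8 modzMmr mulr1 //.
Qed.

Theorem theorem7p2 :
  (forall r : int, coprimez r 11%:Z ->
     forall qj : nat * nat,
       qj \in [:: (8, 1); (8, 3); (8, 6); (16, 4); (16, 8); (16, 10);
                  (32, 0); (32, 12); (64, 16)]%N ->
       theta_ring 11 (laurent_proj qj.1 qj.2 (1 / theta 11 r))) /\
  (forall r : int, coprimez r 13%:Z ->
     forall qj : nat * nat,
       qj \in [:: (8, 2); (8, 3); (8, 5); (16, 4); (16, 8); (16, 14);
                  (32, 0); (32, 12); (64, 16)]%N ->
       theta_ring 13 (laurent_proj qj.1 qj.2 (1 / theta 13 r))) /\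
  (forall r : int, coprimez r 15%:Z ->
     forall qj : nat * nat,
       qj \in [:: (8, 1); (8, 2); (8, 3); (16, 4); (16, 6); (16, 8);
                  (32, 0); (32, 12); (64, 16)]%N ->
       theta_ring 15 (laurent_proj qj.1 qj.2 (1 / theta 15 r))).
Proof.
split; [|split] => r rl qj qjP; rewrite div1r.
(* 7, 5 and 2 are the inverses of 8 modulo 11, 13 and 15. *)
- have [u ul ->] := theta_unit (k := 7) (isT : odd 11) (erefl _) rl.
  exact: targets11 qjP.
- have [u ul ->] := theta_unit (k := 5) (isT : odd 13) (erefl _) rl.
  exact: targets13 qjP.
- have [u ul ->] := theta_unit (k := 2) (isT : odd 15) (erefl _) rl.
  exact: targets15 qjP.
Qed.
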